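(* Let $\varphi:\mathbb P^1\to\mathbb P^1$ be a branched Galois covering of degree $4$ with Galois group the dihedral group $D_2$ of order $4$; up to Möbius transformations, $\varphi$ is $[x,y]\mapsto-\alpha_2^2/\gamma^2$, where $\alpha_2=(x^2-y^2)/2$, $\beta_2=(x^2+y^2)/2$, $\gamma=xy$. Let $g([x,y]):\mathbb P^1\to\mathbb P^3$ be a holomorphic curve which is a Galois lift, with covering $\varphi$, of a sextic curve $F$ in $\mathcal V_5$, so $f_1\circ g=F\circ\varphi$. Then $\deg g=5$, and up to Möbius transformations on $\mathbb P^1$, $g$ is $PSL_2$-equivalent to one of the following: (1) $$g=\begin{pmatrix} a_1 & 1 & 0 \\ b_1 & 0 & 1 \end{pmatrix}\begin{pmatrix} x\alpha_2^2 & x\gamma^2 & -x\alpha_2\beta_2 \\ y\alpha_2^2 & y\gamma^2 & y\alpha_2\beta_2 \end{pmatrix}^T,$$ which depends on two free parameters $a_1,b_1$ and belongs to the generally ramified family; or (2) $$g=\begin{pmatrix} a_1 & 1 & 0 \\ b_1 & 0 & 1 \end{pmatrix}\begin{pmatrix} x\alpha_2^2 & x\gamma^2 & -x\alpha_2\beta_2 \\ \xi_1y\alpha_2^2 & \xi_1y\gamma^2 & \xi_1y\alpha_2\beta_2 \end{pmatrix}^T,$$ where $\xi_1=\exp(\frac{\pi i}4)$ and $\begin{pmatrix} a_1 & 1 & 0 \\ b_1 & 0 & 1 \end{pmatrix}\in G(2,3)$ is the unique $2$-plane that is perpendicular to $\big((t^2-1)^2(\xi_1-t),\,4(\xi_1-t)t^2,\,(t^4-1)(\xi_1+t)\big)$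 under the usual bilinear inner product. This class depends on one free parameter $t$ and belongs to the exceptional transversal family.
   Context: The ground field is $\mathbb C$. $V_n$ is the space of binary forms of degree $n$ in $u,v$, with $SL_2=SL_2(\mathbb C)$ acting by $(A\cdot f)(u,v)=f(A^{-1}(u,v)^T)$. $\mathcal V_5\subset\mathbb P(V_6)=\mathbb P^6$ is the closure of $PSL_2\cdot[uv(u^4-v^4)]$; it is the disjoint union of this open orbit, the $2$-dimensional orbit $PSL_2\cdot[u^5v]$ and the $1$-dimensional orbit $PSL_2\cdot[u^6]$. A sextic curve is a holomorphic curve $F:\mathbb P^1\to\mathcal V_5\subset\mathbb P^6$ of degree $6$, linearly full in $\mathbb P^6$, not contained in $\overline{PSL_2\cdot[u^5v]}$. It is in the generally ramified family if it is tangent to the $1$-dimensional orbit at some point where it meets that orbit; otherwise it is in the exceptional transversal family. A class of curves $g$ is said to belong to one of these families if the corresponding curves $F$ do. Points of $\mathbb P^3$ are nonzero $2\times2$ matrices $\begin{pmatrix} a & b \\ c & d \end{pmatrix}$ up to scale, and $f_1:\mathbb P^3\dashrightarrow\mathbb P(V_6)$ sends this matrix to $[(du-bv)(av-cu)((du-bv)^4-(av-cu)^4)]$; on $PSL_2$ it is the orbit map of $[uv(u^4-v^4)]$. $S_4^*\subset SU(2)$ is the binary octahedral group (order $48$) generated by $\mathrm{diag}(e^{\pi i/4},e^{-\pi i/4})$ and $\frac1{\sqrt2}\begin{pmatrix} 1 & -1 \\ 1 & 1 \end{pmatrix}$; its image in $PSL_2$ is the stabilizer of $[uv(u^4-v^4)]$.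 A branched covering $\varphi$ is Galois if its group $G=\{\sigma:\varphi\circ\sigma=\varphi\}$ has order $\deg\varphi$. A map $g:\mathbb P^1\to\mathbb P^3$ of degree $n$ is a $2\times2$ matrix of degree-$n$ forms in $x,y$ without common factor. It is a Galois lift of $F$ with covering $\varphi$ if $f_1\circ g=F\circ\varphi$ and the homomorphism $\sigma\mapsto g(\sigma(q))^{-1}g(q)$ (independent of generic $q$) from $G$ to the stabilizer of $[uv(u^4-v^4)]$ is injective. Two curves $g,\tilde g:\mathbb P^1\to\mathbb P^3$ are $PSL_2$-equivalent if $AgB^T=\tilde g$ for some $A\in SL_2$, $B\in S_4^*$. Möbius transformations may be applied to both copies of $\mathbb P^1$ (source and target of $\varphi$). $G(2,k)$ is the Grassmannian of $2$-planes in $\mathbb C^k$; a $2\times k$ matrix of rank $2$ denotes its row space. The bilinear inner product is $\sum_i p_iq_i$ (no conjugation). *)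

(* Defs.v *)
From HB Require Import structures.
From mathcomp Require Import all_boot all_order all_algebra.
From mathcomp Require Import reals complex.
From mathcomp Require Import mpoly.
From mathcomp Require trigo.

Set Implicit Arguments.
Unset Strict Implicit.
Unset Printing Implicit Defensive.

Import GRing.Theory Num.Theory.
Local Open Scope ring_scope.
Local Open Scope complex_scope.

(* The ground field is C = R[i], for an arbitrary model R of the reals.
   Bivariate polynomials serve both as forms in the source variables x, y of
   P^1 and as forms in the variables u, v of V_n. *)
Definition binform (R : realType) := {mpoly R[i][2]}.

Definition X0 (R : realType) : binform R := 'X_(0 : 'I_2).
Definition X1 (R : realType) : binform R := 'X_(1 : 'I_2).
Arguments X0 {R}.
Arguments X1 {R}.

Definition mx_of_rows (T : nmodType) (m n : nat) (s : seq (seq T)) : 'M[T]_(m, n) :=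
  \matrix_(i < m, j < n) nth 0 (nth [::] s i) j.

Definition cexpi (R : realType) (theta : R) : R[i] :=
  trigo.cos theta +i* trigo.sin theta.

Definition xi1 (R : realType) : R[i] := cexpi (trigo.pi / 4).
Arguments xi1 {R}.

Definition proj_eq (K : pzRingType) (V : lmodType K) (v w : V) : Prop :=
  exists2 c : K, c != 0 & v = c *: w.

(* A point of P^1 is a nonzero column q. *)
Definition ev (R : realType) (q : 'cV[R[i]]_2) (p : binform R) : R[i] :=
  p.@[fun k => q k 0].

(* Holomorphic curves of degree d from P^1 to P(matrices): tuples of degree d
   forms without common factor. *)
Definition is_curve (R : realType) (m n d : nat) (F : 'M[binform R]_(m, n)) : Prop :=
  (forall i j, F i j \is d.-homog) /\
  (forall h : binform R, (forall i j, exists r, F i j = h * r) ->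
     exists c, h = c%:MP).

Definition curve_eq (R : realType) (m n : nat) (F G : 'M[binform R]_(m, n)) : Prop :=
  exists2 c : R[i], c != 0 & F = c%:MP *: G.

Definition const_form (R : realType) (m n : nat) (A : 'M[R[i]]_(m, n)) :
  'M[binform R]_(m, n) := map_mx (@mpolyC 2 R[i]) A.

Definition lin_subst (R : realType) (S : 'M[R[i]]_2) (p : binform R) : binform R :=
  p \mPo [tuple \sum_(j < 2) S i j *: 'X_j | i < 2].

Definition precomp (R : realType) (m n : nat) (F : 'M[binform R]_(m, n))
  (S : 'M[R[i]]_2) : 'M[binform R]_(m, n) := map_mx (lin_subst S) F.

Definition postcomp (R : realType) (N : 'M[R[i]]_2) (phi : 'cV[binform R]_2) :
  'cV[binform R]_2 := const_form N *m phi.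

Definition sl2_act (R : realType) (A : 'M[R[i]]_2) (f : binform R) : binform R :=
  lin_subst (invmx A) f.

Definition psl2_orbit (R : realType) (f0 f : binform R) : Prop :=
  exists2 A : 'M[R[i]]_2, \det A = 1 & proj_eq f (sl2_act A f0).

Definition sextic_coord (R : realType) (f : binform R) (k : 'I_7) : R[i] :=
  f@_[multinom [tuple (6 - k)%N; k : nat]].

(* Zariski closure in P(V_6); for a PSL_2-orbit it agrees with the closure in
   the usual topology. *)
Definition zclosure (R : realType) (X : binform R -> Prop) (f : binform R) : Prop :=
  [/\ f \is 6.-homog, f != 0 &
      forall (d : nat) (H : {mpoly R[i][7]}), H \is d.-homog ->
        (forall f', X f' -> H.@[sextic_coord f'] = 0) ->
        H.@[sextic_coord f] = 0].

Definition octa_form (R : realType) : binform R := X0 * X1 * (X0 ^+ 4 - X1 ^+ 4).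

Definition fano_V5 (R : realType) : binform R -> Prop :=
  zclosure (psl2_orbit (octa_form R)).

Definition orbit2_closure (R : realType) : binform R -> Prop :=
  zclosure (psl2_orbit (X0 ^+ 5 * X1)).

(* Homogeneous coordinates on P(V_6) are the coefficients of u^(6-k) v^k. *)
Definition sextic_of (R : realType) (a : 'I_7 -> R[i]) : binform R :=
  \sum_(k < 7) a k *: (X0 ^+ (6 - k) * X1 ^+ k).

Definition curve_at (R : realType) (F : 'rV[binform R]_7) (p : 'cV[R[i]]_2) : binform R :=
  sextic_of (fun k => ev p (F 0 k)).

Definition curve_diff (R : realType) (F : 'rV[binform R]_7) (i : 'I_2)
  (p : 'cV[R[i]]_2) : binform R := sextic_of (fun k => ev p (mderiv i (F 0 k))).

Definition linearly_full (R : realType) (F : 'rV[binform R]_7) : Prop :=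
  forall c : 'cV[R[i]]_7, F *m const_form c = 0 -> c = 0.

Definition sextic_curve (R : realType) (F : 'rV[binform R]_7) : Prop :=
  [/\ is_curve 6 F,
      linearly_full F,
      forall p : 'cV[R[i]]_2, p != 0 -> fano_V5 (curve_at F p) &
      ~ (forall p : 'cV[R[i]]_2, p != 0 -> orbit2_closure (curve_at F p))].

(* The affine cone over the tangent line of F at p is spanned by the two partial
   derivatives of F at p.  The tangent space of the cone over PSL_2.[u^6] at
   A.u^6 is spanned by A.u^6 and A.(u^5 v). *)
Definition generally_ramified (R : realType) (F : 'rV[binform R]_7) : Prop :=
  exists (p : 'cV[R[i]]_2) (A : 'M[R[i]]_2),
    [/\ p != 0, \det A = 1,
        proj_eq (curve_at F p) (sl2_act A (X0 ^+ 6)) &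
        forall i : 'I_2, exists a b : R[i],
          curve_diff F i p =
            a *: sl2_act A (X0 ^+ 6) + b *: sl2_act A (X0 ^+ 5 * X1)].

Definition exceptional_transversal (R : realType) (F : 'rV[binform R]_7) : Prop :=
  ~ generally_ramified F.

(* S in GL_2 represents a Moebius transformation of the source; two matrices
   represent the same one iff they are related by [proj_eq]. *)
Definition deck (R : realType) (phi : 'cV[binform R]_2) (S : 'M[R[i]]_2) : Prop :=
  S \in unitmx /\ curve_eq (precomp phi S) phi.

Definition deck_order (R : realType) (phi : 'cV[binform R]_2) (d : nat) : Prop :=
  exists s : 'I_d -> 'M[R[i]]_2,
    [/\ forall i, deck phi (s i),
        forall i j, proj_eq (s i) (s j) -> i = j &
        forall S, deck phi S -> exists i, proj_eq S (s i)].

Definition galois_covering (R : realType) (d : nat) (phi : 'cV[binform R]_2) : Prop :=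
  is_curve d phi /\ deck_order phi d.

(* D_2 = <r, s | r^2, s^2, (r s)^2>, of order 4. *)
Definition deck_group_D2 (R : realType) (phi : 'cV[binform R]_2) : Prop :=
  deck_order phi 4 /\
  exists r s : 'M[R[i]]_2,
    [/\ deck phi r, deck phi s,
        [/\ proj_eq (r *m r) 1%:M, proj_eq (s *m s) 1%:M &
            proj_eq ((r *m s) *m (r *m s)) 1%:M] &
        forall S, deck phi S ->
          [\/ proj_eq S 1%:M, proj_eq S r, proj_eq S s | proj_eq S (r *m s)]].

Definition f1 (R : realType) (M : 'M[R[i]]_2) : binform R :=
  let P := M 1 1 *: X0 - M 0 1 *: X1 in
  let Q := M 0 0 *: X1 - M 1 0 *: X0 in
  P * Q * (P ^+ 4 - Q ^+ 4).

Definition mat_at (R : realType) (m n : nat) (g : 'M[binform R]_(m, n))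
  (q : 'cV[R[i]]_2) : 'M[R[i]]_(m, n) := map_mx (ev q) g.

(* f_1 o g = F o phi holds as an equality of maps to P(V_6) wherever f_1 o g is
   defined.  The group homomorphism is constant in generic q, so comparing its
   values at two deck transformations for all q with invertible g is the same
   as comparing them at one generic q. *)
Definition galois_lift (R : realType) (phi : 'cV[binform R]_2) (F : 'rV[binform R]_7)
  (g : 'M[binform R]_2) : Prop :=
  [/\ \det g != 0,
      forall q : 'cV[R[i]]_2, q != 0 -> f1 (mat_at g q) != 0 ->
        proj_eq (f1 (mat_at g q)) (curve_at F (mat_at phi q)) &
      forall S T : 'M[R[i]]_2, deck phi S -> deck phi T ->
        (forall q : 'cV[R[i]]_2,
           mat_at g q \in unitmx -> mat_at g (S *m q) \in unitmx ->
           mat_at g (T *m q) \in unitmx ->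
           proj_eq (invmx (mat_at g (S *m q)) *m mat_at g q)
                   (invmx (mat_at g (T *m q)) *m mat_at g q)) ->
        proj_eq S T].

Inductive S4star (R : realType) : 'M[R[i]]_2 -> Prop :=
| S4star_one : S4star 1%:M
| S4star_diag : S4star (mx_of_rows 2 2
    [:: [:: cexpi (trigo.pi / 4); 0]; [:: 0; cexpi (- (trigo.pi / 4))]])
| S4star_rot : S4star ((Num.sqrt (2 : R))^-1%:C *:
    mx_of_rows 2 2 [:: [:: 1; -1]; [:: 1; 1]])
| S4star_mul A B : S4star A -> S4star B -> S4star (A *m B)
| S4star_inv A : S4star A -> S4star (invmx A).

Definition psl2_equivalent (R : realType) (g g' : 'M[binform R]_2) : Prop :=
  exists A B : 'M[R[i]]_2,
    [/\ \det A = 1, S4star B &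
        curve_eq (const_form A *m g *m (const_form B)^T) g'].

Definition alpha2 (R : realType) : binform R := 2^-1 *: (X0 ^+ 2 - X1 ^+ 2).
Definition beta2 (R : realType) : binform R := 2^-1 *: (X0 ^+ 2 + X1 ^+ 2).
Definition gamma (R : realType) : binform R := X0 * X1.
Arguments alpha2 {R}.
Arguments beta2 {R}.
Arguments gamma {R}.

(* The covering - alpha_2^2 / gamma^2, as [- alpha_2^2, gamma^2]. *)
Definition phi0 (R : realType) : 'cV[binform R]_2 :=
  mx_of_rows 2 1 [:: [:: - alpha2 ^+ 2]; [:: gamma ^+ 2]].

Definition normalizes (R : realType) (phi : 'cV[binform R]_2) (mu nu : 'M[R[i]]_2) : Prop :=
  [/\ mu \in unitmx, nu \in unitmx &
      curve_eq (postcomp nu (precomp phi mu)) (phi0 R)].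

(* The same source transformation is applied to phi and to g. *)
Definition equiv_mod_moebius (R : realType) (phi : 'cV[binform R]_2)
  (g g' : 'M[binform R]_2) : Prop :=
  exists mu nu : 'M[R[i]]_2,
    normalizes phi mu nu /\ psl2_equivalent (precomp g mu) g'.

Definition plane (R : realType) (a b : R[i]) : 'M[R[i]]_(2, 3) :=
  mx_of_rows 2 3 [:: [:: a; 1; 0]; [:: b; 0; 1]].

(* The common shape of the two classes: z = 1 in the first, z = xi_1 in the
   second. *)
Definition lift_form (R : realType) (z a b : R[i]) : 'M[binform R]_2 :=
  const_form (plane a b) *m
  (mx_of_rows 2 3
     [:: [:: X0 * alpha2 ^+ 2; X0 * gamma ^+ 2; - (X0 * alpha2 * beta2)];
         [:: z *: (X1 * alpha2 ^+ 2); z *: (X1 * gamma ^+ 2);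
             z *: (X1 * alpha2 * beta2)]])^T.

Definition g_ram (R : realType) (a b : R[i]) : 'M[binform R]_2 := lift_form 1 a b.
Definition g_exc (R : realType) (a b : R[i]) : 'M[binform R]_2 := lift_form xi1 a b.

Definition normal_vec (R : realType) (t : R[i]) : 'rV[R[i]]_3 :=
  mx_of_rows 1 3 [:: [:: (t ^+ 2 - 1) ^+ 2 * (xi1 - t);
                         4 * (xi1 - t) * t ^+ 2;
                         (t ^+ 4 - 1) * (xi1 + t)]].

(* The row space of [plane a b] is the orthogonal complement of [normal_vec t]
   for the bilinear inner product, hence is the only 2-plane perpendicular to
   it. *)
Definition plane_perp (R : realType) (t a b : R[i]) : Prop :=
  (plane a b :=: kermx (normal_vec t)^T)%MS.

(* Main.v *)
Require Import Defs.
From mathcomp Require Import all_boot all_order all_algebra.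
From mathcomp Require Import reals complex.
From mathcomp Require Import mpoly.
From mathcomp Require Import ring zify.

(** The idea of the proof.

    A matrix M acts on octa = u v (u^4 - v^4) through its adjugate, and f_1(M) is the result.
    For a lift g of degree n of F the seven coordinates of f_1 o g, of degree 6 n, are
    proportional to those of F o phi, which have degree 24 and no common zero; hence they are
    multiples of the latter by a form h of degree 6 n - 24 ([lift_factor], [form_cancel]).
    The Hessian of octa is -25 octa8, and octa and octa8 have no common zero. Comparing the
    Hessians of f_1 o g and of F o phi ([lift_hess]) one sees that h^2 divides (det g)^2, so
    n <= 6 ([lift_deg_le]).

    The covering. The generators of the deck group are commuting involutions of the line. As
    matrices they anticommute, so they are diag(1,-1) and the exchange of x and y in suitable
    coordinates ([klein_coordinates]), and the invariant quartics are the combinations of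
    alpha_2^2 and gamma^2 ([klein_quartic]). This brings phi to the standard covering
    ([d2_normalizes]).

    The normal form. For a deck transformation S the sextics f_1(g(S q)) and f_1(g(q)) are
    proportional, so g(S q) = g(q) B with B in the octahedral group up to scalars, and B does not
    depend on q ([equivariant], [octa_classify]). Injectivity of the homomorphism of the
    Galois lift makes the matrices X and Y of the two generators nonscalar involutions, and
    X Y = (-1)^n Y X. For even n they would commute and X Y would be scalar, so n = 5
    ([lift_rep]). One of X, Y and X Y is a half turn about a coordinate axis
    ([anticommuting_axis]), and the Moebius transformations that permute the deck transformations
    and the octahedral group move it to X = diag(1,-1). Then each row of g is x A and z y A'
    where A' is A with x and y exchanged; the octahedral group reduces z to 1 or xi_1, and row
    operations produce the matrix of the plane ([lift_normal_form]).

    The two families. For z = 1 the coordinate F_k is divisible by the k-th power of a linear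
    form, so F is tangent to the one-dimensional orbit at its zero ([ram_tangent]). For z = xi_1
    the divisibility of (det g)^2 by h^2 forces a polynomial relation between a and b, or else
    b^2 = 1 - a; the latter is excluded because F would lie in a hyperplane ([exc_necessary],
    [exc_not_square]). The relation defines a rational curve with parameter t, and is equivalent
    to the orthogonality of the plane to the given vector for some t ([exc_exists_t],
    [perp_exc_rel]). Finally a tangent curve has a Hessian with a double zero ([tangent6_hess]),
    which the zeros of alpha_2 beta_2 rule out in this family ([exc_not_tangent]).

    Existence. The coordinates of F are explicit in each family. They are independent as soon
    as a determinant of their values at seven points is not zero, which is seen at one
    member of each family modulo a small prime ([ram_eval_F7], [exc_eval_F11]). Independent
    sextics have no common zero, hence no common factor ([indep_nz], [is_curve_of_nz]). The
    values of F lie in the closure of the orbit of octa, but not all of them are in the closure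
    of the orbit of u^5 v, where the quadratic invariant of sextics vanishes ([exist_F_V5],
    [exist_F_orbit2]). *)

Set Implicit Arguments.
Unset Strict Implicit.
Unset Printing Implicit Defensive.

Import Order.TTheory GRing.Theory Num.Theory.
Local Open Scope ring_scope.
Local Open Scope complex_scope.

(** * Binary forms *)

Section Forms.
Variable R : realType.
Notation K := R[i].
Implicit Types (p r : binform R) (q : 'cV[K]_2).

(** Points of C^2; [ptE] lets a polynomial in the point be computed in coordinates. *)
Definition pt (x y : K) : 'cV[K]_2 := \col_i (if i == 0 then x else y).

Lemma ptE q : q = pt (q 0 0) (q 1 0).
Proof.
apply/matrixP=> i j; rewrite ord1 mxE; case: i => [[|[|//]] /= Hi].
  by congr (q _ _); apply/val_inj.
by congr (q _ _); apply/val_inj.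
Qed.

Lemma pt0 x y : pt x y 0 0 = x. Proof. by rewrite mxE. Qed.
Lemma pt1 x y : pt x y 1 0 = y. Proof. by rewrite mxE. Qed.

Lemma pt_eq0 x y : (pt x y == 0) = (x == 0) && (y == 0).
Proof.
apply/eqP/andP => [E|[/eqP-> /eqP->]].
  by rewrite -(pt0 x y) -{2}(pt1 x y) E !mxE eqxx.
by apply/matrixP => i j; rewrite !mxE; case: ifP.
Qed.

Lemma evC q c : ev q c%:MP = c. Proof. exact: mevalC. Qed.
Lemma evD q p r : ev q (p + r) = ev q p + ev q r. Proof. exact: mevalD. Qed.
Lemma evB q p r : ev q (p - r) = ev q p - ev q r. Proof. exact: mevalB. Qed.
Lemma evN q p : ev q (- p) = - ev q p. Proof. exact: mevalN. Qed.
Lemma evM q p r : ev q (p * r) = ev q p * ev q r. Proof. exact: mevalM. Qed.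
Lemma evZ q c p : ev q (c *: p) = c * ev q p. Proof. exact: mevalZ. Qed.
Lemma evX q p n : ev q (p ^+ n) = ev q p ^+ n. Proof. exact: rmorphXn. Qed.
Lemma ev0 q : ev q 0 = 0. Proof. exact: meval0. Qed.
Lemma ev1 q : ev q 1 = 1. Proof. exact: meval1. Qed.
Lemma evX0 q : ev q X0 = q 0 0. Proof. exact: mevalXU. Qed.
Lemma evX1 q : ev q X1 = q 1 0. Proof. exact: mevalXU. Qed.
Lemma ev_sum q (I : Type) (s : seq I) (P : pred I) (F : I -> binform R) :
  ev q (\sum_(i <- s | P i) F i) = \sum_(i <- s | P i) ev q (F i).
Proof. exact: raddf_sum. Qed.
Lemma evR q n : ev q n%:R = n%:R.
Proof. by rewrite /ev rmorph_nat. Qed.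
Definition evE := (evR, evC, evD, evB, evN, evM, evZ, evX, ev0, ev1, evX0, evX1).

Definition M2 (i j : nat) : 'X_{1..2} := [multinom [tuple i; j]].

Lemma M20 i j : M2 i j 0 = i. Proof. by []. Qed.
Lemma M21 i j : M2 i j 1 = j. Proof. by []. Qed.

Lemma eq_mnm2 (m m' : 'X_{1..2}) : m 0 = m' 0 -> m 1 = m' 1 -> m = m'.
Proof.
move=> h0 h1; apply/mnmP=> -[[|[|//]] Hk].
  by rewrite (_ : Ordinal Hk = 0) //; apply/val_inj.
by rewrite (_ : Ordinal Hk = 1) //; apply/val_inj.
Qed.

Lemma M2X i j : X0 ^+ i * X1 ^+ j = 'X_[M2 i j] :> binform R.
Proof.
rewrite /X0 /X1 !mpolyXn -mpolyXD; congr 'X_[_].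
apply: eq_mnm2; rewrite mnmDE !mulmnE !mnm1E /= ?mul1n ?mul0n ?addn0 ?add0n ?M20 ?M21 //.
Qed.

Lemma M2E (m : 'X_{1..2}) : m = M2 (m 0) (m 1).
Proof. exact: eq_mnm2. Qed.

Lemma mdegM2 i j : mdeg (M2 i j) = (i + j)%N.
Proof. by rewrite mdegE !big_ord_recl big_ord0 /= addn0. Qed.

Lemma form_sum d p : p \is d.-homog ->
  p = \sum_(k < d.+1) p@_(M2 (d - k) k) *: (X0 ^+ (d - k) * X1 ^+ k).
Proof.
move=> hp; apply/mpolyP => m; rewrite raddf_sum /=.
under eq_bigr => k _ do rewrite mcoeffZ M2X mcoeffX.
have [/eqP dm|dm] := boolP (mdeg m == d); last first.
  rewrite (dhomog_nemf_coeff hp dm) big1 // => k _.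
  case: eqP => [E|]; last by rewrite mulr0.
  by case/negP: dm; rewrite -E mdegM2 subnK // -ltnS.
have E : mdeg m = (m 0%R + m 1%R)%N by rewrite {1}(M2E m) mdegM2.
have m1d : (m 1%R < d.+1)%N by rewrite -dm E ltnS leq_addl.
rewrite (bigD1 (Ordinal m1d)) //= big1 ?addr0 => [|k /eqP kne].
  have -> : (d - m 1%R)%N = m 0 by rewrite -dm E addnK.
  by rewrite -M2E eqxx mulr1.
case: eqP => [E2|]; last by rewrite mulr0.
by case: kne; apply/val_inj => /=; rewrite -E2.
Qed.

Lemma form_ev d p x y : p \is d.-homog ->
  ev (pt x y) p = \sum_(k < d.+1) p@_(M2 (d - k) k) * (x ^+ (d - k) * y ^+ k).
Proof.
move=> hp; rewrite {1}(form_sum hp) ev_sum; apply: eq_bigr => k _.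
by rewrite !evE pt0 pt1.
Qed.

Definition dehom d p : {poly K} := \poly_(k < d.+1) p@_(M2 k (d - k)).

Lemma dehomE d p x : p \is d.-homog -> ev (pt x 1) p = (dehom d p).[x].
Proof.
move=> hp; rewrite (form_ev _ _ hp) horner_poly.
rewrite [RHS](reindex_inj rev_ord_inj) /=; apply: eq_bigr => k _.
by rewrite expr1n mulr1 subSS subKn // -ltnS.
Qed.

(** A form is determined by its values, since a nonzero univariate polynomial over a
    field of characteristic zero does not vanish at all natural numbers. *)
Lemma form_ext d p : p \is d.-homog -> (forall q, q != 0 -> ev q p = 0) -> p = 0.
Proof.
move=> hp H; have: dehom d p = 0.
  apply/eqP; case: eqP => // /eqP nz.
  have := max_poly_roots nz (rs := [seq k%:R | k <- iota 0 (size (dehom d p))]).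
  rewrite size_map size_iota ltnn; apply; last first.
    by rewrite map_inj_uniq ?iota_uniq // => i j /eqP; rewrite eqr_nat => /eqP.
  apply/allP => _ /mapP[k _ ->]; rewrite /root -dehomE // H //.
  by rewrite pt_eq0 oner_eq0 andbF.
move=> H0; rewrite (form_sum hp) big1 // => k _.
have := congr1 (fun P : {poly K} => P`_(d - k)) H0.
rewrite coef_poly coef0 ltnS leq_subr subKn; last by rewrite -ltnS.
by move=> ->; rewrite scale0r.
Qed.

Lemma form_scale d p q c : p \is d.-homog -> ev (c *: q) p = c ^+ d * ev q p.
Proof.
move=> hp; rewrite (ptE (c *: q)) (ptE q) !(form_ev _ _ hp) mulr_sumr.
apply: eq_bigr => k _; rewrite !mxE /= !exprMn mulrACA -exprD subnK; last by rewrite -ltnS.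
exact: mulrCA.
Qed.

Lemma form0_const p : p \is 0.-homog -> p = (p@_0)%:MP.
Proof.
move=> hp; rewrite {1}(form_sum hp) big_ord_recl big_ord0 addr0 /= subnn !expr0 mulr1.
rewrite -mul_mpolyC mulr1; congr (mpolyC _ p@__).
by apply: eq_mnm2; rewrite mnm0E.
Qed.

Lemma homC (c : K) : (c%:MP : binform R) \is 0.-homog.
Proof. by rewrite -(mulr1 c%:MP) mul_mpolyC dhomogZ // dhomog1. Qed.
Lemma homX0 : (X0 : binform R) \is 1.-homog.
Proof. by rewrite dhomogX; apply/eqP; exact: mdeg1. Qed.
Lemma homX1 : (X1 : binform R) \is 1.-homog.
Proof. by rewrite dhomogX; apply/eqP; exact: mdeg1. Qed.
Lemma homD d p r : p \is d.-homog -> r \is d.-homog -> p + r \is d.-homog.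
Proof. exact: dhomogD. Qed.
Lemma homB d p r : p \is d.-homog -> r \is d.-homog -> p - r \is d.-homog.
Proof. by move=> hp hr; apply: dhomogD => //; rewrite dhomogN. Qed.
Lemma homCM d c p : p \is d.-homog -> c%:MP * p \is d.-homog.
Proof. by move=> hp; rewrite mul_mpolyC dhomogZ. Qed.

Lemma homN d p : p \is d.-homog -> - p \is d.-homog.
Proof. by rewrite dhomogN. Qed.
Lemma homZ d c p : p \is d.-homog -> c *: p \is d.-homog.
Proof. exact: dhomogZ. Qed.
Lemma hom1 : (1 : binform R) \is 0.-homog.
Proof. exact: dhomog1. Qed.
Lemma homR n : (n%:R : binform R) \is 0.-homog.
Proof. by rewrite rpredMn // hom1. Qed.
Lemma hom_eq d e p : p \is d.-homog -> d = e -> p \is e.-homog.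
Proof. by move=> ? <-. Qed.
Lemma homM d e p r : p \is d.-homog -> r \is e.-homog -> p * r \is (d + e).-homog.
Proof. exact: dhomogM. Qed.
Lemma homX d n p : p \is d.-homog -> p ^+ n \is (d * n).-homog.
Proof. exact: dhomogMn. Qed.

Definition lin q : binform R := (q 1 0)%:MP * X0 - (q 0 0)%:MP * X1.

Lemma lin_homog q : lin q \is 1.-homog.
Proof. by apply: homB; apply: homCM; [exact: homX0|exact: homX1]. Qed.

Lemma ev_lin q q' : ev q' (lin q) = q 1 0 * q' 0 0 - q 0 0 * q' 1 0.
Proof. by rewrite /lin !evE. Qed.

Lemma lin_ne0 q : q != 0 -> lin q != 0.
Proof.
apply: contra_neq => H; have := ev_lin q (pt 1 0); have := ev_lin q (pt 0 1).
rewrite H ev0 !pt0 !pt1 !mulr0 !mulr1 sub0r subr0 => /eqP.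
rewrite eq_sym oppr_eq0 => /eqP h0 h1; rewrite (ptE q) h0 -h1.
by apply/eqP; rewrite ev0 pt_eq0 eqxx.
Qed.

(** Binary forms of positive degree have a zero because C is algebraically closed; the
    point at infinity is a zero when dehomogenizing lowers the degree. *)
Lemma form_zero d p : (0 < d)%N -> p \is d.-homog -> exists2 q, q != 0 & ev q p = 0.
Proof.
case: d => // d _ hp.
have [s1|s1] := boolP (size (dehom d.+1 p) == 1%N); last first.
  case/closed_rootP: s1 => x /eqP rx; exists (pt x 1).
    by rewrite pt_eq0 oner_eq0 andbF.
  by rewrite (dehomE _ hp).
exists (pt 1 0); first by rewrite pt_eq0 oner_eq0.
rewrite (form_ev _ _ hp) big_ord_recl big1 ?addr0 => [|k _]; last first.
  by rewrite /= expr0n /= !mulr0.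
have := congr1 (fun P : {poly K} => P`_d.+1) (size1_polyC (eq_leq (eqP s1))).
rewrite coefC /= coef_poly ltnSn subnn subn0 => ->.
by rewrite mul0r.
Qed.

Lemma hom1Xn n p : p \is 1.-homog -> p ^+ n \is n.-homog.
Proof. by move/(homX n); rewrite mul1n. Qed.

Lemma pow_diff d (x y z : binform R) i j : x \is 1.-homog -> y \is 1.-homog ->
  z \is 1.-homog -> (i + j = d.+1)%N ->
  exists2 r, r \is d.-homog & x ^+ i * z ^+ j - y ^+ i * z ^+ j = (x - y) * r.
Proof.
move=> hx hy hz; case: i => [|i] E.
  by exists 0; rewrite ?rpred0 // !expr0 subrr mulr0.
rewrite -mulrBl subrXX -mulrA; eexists; last by [].
have -> : d = (i + j)%N by case: E => <-.
apply: homM; last exact: hom1Xn.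
apply: rpred_sum => k _ /=.
have := homM (hom1Xn (i - k) hx) (hom1Xn k hy).
by rewrite subnK // -ltnS.
Qed.

(** Substituting q_0 X_1 for q_1 X_0 in q_1^D p turns it into p(q) times a monomial,
    which is zero, and each monomial changes by a multiple of [lin q]. *)
Lemma form_factor d p q : q != 0 -> p \is d.+1.-homog -> ev q p = 0 ->
  exists2 p', p' \is d.-homog & p = lin q * p'.
Proof.
move=> qn0 hp pq0; set D := d.+1 in hp *.
have hl0 : (q 1 0)%:MP * X0 \is 1.-homog by apply: homCM; exact: homX0.
have hl1 : (q 0 0)%:MP * X1 \is 1.-homog by apply: homCM; exact: homX1.
suff [c cn0 [r hr E]] : exists2 c : K, c != 0 & exists2 r, r \is d.-homog & c *: p = lin q * r.
  exists (c^-1 *: r); first exact: dhomogZ.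
  by rewrite -scalerAr -E scalerA mulVf // scale1r.
pose c k := p@_(M2 (D - k) k).
have S0 : \sum_(k < D.+1) c k * (q 0 0 ^+ (D - k) * q 1 0 ^+ k) = 0.
  by rewrite -(form_ev _ _ hp) -ptE.
have ksub (k : 'I_D.+1) : (D - k + k = D)%N by rewrite subnK // -ltnS.
have [q10|q1n0] := eqVneq (q 1 0) 0.
- have q0n0 : q 0 0 != 0.
    apply: contra_neq qn0 => q00; rewrite (ptE q) q10 q00; apply/eqP.
    by rewrite pt_eq0 eqxx.
  exists (q 0 0 ^+ D); first by rewrite expf_neq0.
  have [r hr E] : exists2 r, r \is d.-homog & \sum_(k < D.+1)
     (c k * q 0 0 ^+ (D - k)) *: (((q 0 0)%:MP * X1) ^+ k * X0 ^+ (D - k)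
       - ((q 1 0)%:MP * X0) ^+ k * X0 ^+ (D - k)) = lin q * r.
    elim/big_ind: _ => [|x y [r hr ->] [s hs ->]|k _].
    + by exists 0; rewrite ?rpred0 ?mulr0.
    + by exists (r + s); rewrite ?rpredD ?mulrDr.
    have [r hr ->] := pow_diff hl1 hl0 homX0 (etrans (addnC _ _) (ksub k)).
    exists ((- (c k * q 0 0 ^+ (D - k))) *: r); first exact: dhomogZ.
    by rewrite scaleNr mulrN scalerAr -mulNr opprB.
  exists r => //; rewrite -E {1}(form_sum hp) scaler_sumr.
  under [RHS]eq_bigr => k _ do rewrite scalerBr.
  rewrite sumrB [X in _ - X](_ : _ = 0) ?subr0; last first.
    transitivity (\sum_(k < D.+1) (c k * (q 0 0 ^+ (D - k) * q 1 0 ^+ k)) *: (X0 ^+ D : binform R)).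
      apply: eq_bigr => k _; rewrite exprMn -rmorphXn /= mul_mpolyC -scalerAl -exprD addnC ksub.
      by rewrite scalerA mulrA.
    by rewrite -scaler_suml S0 scale0r.
  apply: eq_bigr => k _; rewrite exprMn -rmorphXn /= mul_mpolyC -scalerAl !scalerA.
  rewrite -{1}(ksub k) exprD [X0 ^+ _ * _]mulrC; congr (_ *: _).
  by rewrite -/(c k); ring.
exists (q 1 0 ^+ D); first by rewrite expf_neq0.
have [r hr E] : exists2 r, r \is d.-homog & \sum_(k < D.+1)
   (c k * q 1 0 ^+ k) *: (((q 1 0)%:MP * X0) ^+ (D - k) * X1 ^+ k
     - ((q 0 0)%:MP * X1) ^+ (D - k) * X1 ^+ k) = lin q * r.
  elim/big_ind: _ => [|x y [r hr ->] [s hs ->]|k _].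
  + by exists 0; rewrite ?rpred0 ?mulr0.
  + by exists (r + s); rewrite ?rpredD ?mulrDr.
  have [r hr ->] := pow_diff hl0 hl1 homX1 (ksub k).
  exists ((c k * q 1 0 ^+ k) *: r); first exact: dhomogZ.
  by rewrite scalerAr.
exists r => //; rewrite -E {1}(form_sum hp) scaler_sumr.
under [RHS]eq_bigr => k _ do rewrite scalerBr.
rewrite sumrB [X in _ - X](_ : _ = 0) ?subr0; last first.
  transitivity (\sum_(k < D.+1) (c k * (q 0 0 ^+ (D - k) * q 1 0 ^+ k)) *: (X1 ^+ D : binform R)).
    apply: eq_bigr => k _; rewrite exprMn -rmorphXn /= mul_mpolyC -scalerAl -exprD ksub.
    by rewrite scalerA mulrAC mulrA.
  by rewrite -scaler_suml S0 scale0r.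
apply: eq_bigr => k _; rewrite exprMn -rmorphXn /= mul_mpolyC -scalerAl !scalerA.
rewrite -{1}(ksub k) exprD; congr (_ *: _).
by rewrite -/(c k); ring.
Qed.

(** Forms w_i without common zero are coprime to every form, so they can be removed from a
    divisibility. By induction on the degree of D: at a zero q of D some w_i is nonzero, so
    C vanishes too, and the linear factor at q is taken out of both. *)
Lemma form_cancel (I : Type) (w : I -> binform R) m n (D C : binform R) :
  D \is m.-homog -> D != 0 -> C \is n.-homog -> C != 0 ->
  (forall i, exists r, C * w i = D * r) ->
  (forall q, q != 0 -> ev q D = 0 -> exists i, ev q (w i) != 0) ->
  (m <= n)%N /\ exists2 r, r \is (n - m).-homog & C = D * r.
Proof.
elim: m n D C => [|m IH] n D C hD D0 hC C0 H Hw.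
  split=> //; rewrite (form0_const hD) in D0 *.
  exists ((D@_0)^-1%:MP * C); first by rewrite subn0 homCM.
  rewrite mulrA -mpolyCM divff ?mul1r //.
  by apply: contra_neq D0 => ->.
have [q q0 qD] := form_zero (ltn0Sn m) hD.
have [D' hD' DE] := form_factor q0 hD qD.
have [i wi] := Hw _ q0 qD.
have Cq : ev q C = 0.
  have [r /(congr1 (ev q))] := H i; rewrite !evM qD mul0r => /eqP.
  by rewrite mulf_eq0 (negbTE wi) orbF => /eqP.
case: n hC => [hC|n hC].
  move: Cq; rewrite (form0_const hC) evC => E; case/negP: C0; rewrite (form0_const hC) E; by rewrite mpolyC0 eqxx.
have [C' hC' CE] := form_factor q0 hC Cq.
have l0 := lin_ne0 q0.
have [D'0 C'0] : D' != 0 /\ C' != 0.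
  by split; [apply: contra_neq D0 => E; rewrite DE E mulr0
            |apply: contra_neq C0 => E; rewrite CE E mulr0].
have [|q' q'0 q'D|mn [r hr E]] := IH n D' C' hD' D'0 hC' C'0.
- move=> j; have [r E] := H j; exists r; apply: (mulfI l0).
  by rewrite !mulrA -CE -DE.
- by apply: Hw => //; rewrite DE evM q'D mulr0.
by split=> //; exists r; rewrite ?subSS // CE DE E mulrA.
Qed.

End Forms.

(** [hmg] reads off the degree of a form from the way it is written; [hmgd] then
    compares it with the expected one. *)
Ltac hmg :=
  lazymatch goal with
  | |- is_true (?p + ?r \is _) =>
      eapply homD; [hmg | eapply hom_eq; [hmg | clear; lia]]
  | |- is_true (- ?p \is _) => eapply homN; hmg
  | |- is_true (?c *: ?p \is _) => eapply homZ; hmg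
  | |- is_true (?p * ?r \is _) => eapply homM; hmg
  | |- is_true (?p ^+ _ \is _) => eapply homX; hmg
  | |- is_true (_%:MP \is _) => eapply homC
  | |- is_true (1 \is _) => eapply hom1
  | |- is_true (_%:R \is _) => eapply homR
  | |- is_true (X0 \is _) => eapply homX0
  | |- is_true (X1 \is _) => eapply homX1
  | |- is_true (lin _ \is _) => eapply lin_homog
  | |- _ => solve [eassumption | eauto 2]
  end.
Ltac hmgd := eapply hom_eq; [hmg | clear; lia].

(** * The octahedral form, its Hessian and the map f_1 *)

Lemma sum2 (V : nmodType) (f : 'I_2 -> V) : \sum_i f i = f 0 + f 1.
Proof.
rewrite !big_ord_recl big_ord0 addr0; congr (f _ + f _); exact/val_inj.
Qed.

Lemma ord2P (k : 'I_2) : k = 0 \/ k = 1.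
Proof. by case: k => -[|[|//]] Hk; [left|right]; exact/val_inj. Qed.

Lemma mulmx2E (T : pzSemiRingType) m n (A : 'M[T]_(m, 2)) (B : 'M[T]_(2, n)) i j :
  (A *m B) i j = A i 0 * B 0 j + A i 1 * B 1 j.
Proof. by rewrite mxE sum2. Qed.

Section Octa.
Variable T : comNzRingType.
Implicit Types u v p q r s : T.

Definition octa u v : T := u * v * (u ^+ 4 - v ^+ 4).
(** Up to a constant, the Hessian of [octa]: its eight roots are the vertices of a cube
    whose dual octahedron has the roots of [octa] as vertices. *)
Definition octa8 u v : T := u ^+ 8 + 14 * u ^+ 4 * v ^+ 4 + v ^+ 8.

Definition octa_coef (k : nat) p q r s : T :=
  match k with
  | 0 => p ^+ 5 * r - p * r ^+ 5
  | 1 => 5 * p ^+ 4 * q * r + p ^+ 5 * s - 5 * r ^+ 4 * s * p - r ^+ 5 * q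
  | 2 => 10 * p ^+ 3 * q ^+ 2 * r + 5 * p ^+ 4 * q * s
         - 10 * r ^+ 3 * s ^+ 2 * p - 5 * r ^+ 4 * s * q
  | 3 => 10 * p ^+ 2 * q ^+ 3 * r + 10 * p ^+ 3 * q ^+ 2 * s
         - 10 * r ^+ 2 * s ^+ 3 * p - 10 * r ^+ 3 * s ^+ 2 * q
  | 4 => 5 * p * q ^+ 4 * r + 10 * p ^+ 2 * q ^+ 3 * s
         - 5 * r * s ^+ 4 * p - 10 * r ^+ 2 * s ^+ 3 * q
  | 5 => q ^+ 5 * r + 5 * p * q ^+ 4 * s - s ^+ 5 * p - 5 * r * s ^+ 4 * q
  | _ => q ^+ 5 * s - q * s ^+ 5
  end.

Lemma octa_coefE p q r s u v :
  octa (p * u + q * v) (r * u + s * v) =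
  \sum_(k < 7) octa_coef k p q r s * (u ^+ (6 - k) * v ^+ k).
Proof.
rewrite !big_ord_recl big_ord0 /octa /octa_coef /= /bump /= !subn0 ?subSS ?subn0 ?expr0 ?expr1.
ring.
Qed.

(** The second derivatives of the sextic with coefficients c, and its Hessian determinant,
    as polynomials in u and v. *)
Definition hess_uu (c : 'I_7 -> T) u v := let a k := c (inord k) in
  30 * a 0%N * u ^+ 4 + 20 * a 1%N * u ^+ 3 * v + 12 * a 2%N * u ^+ 2 * v ^+ 2
   + 6 * a 3%N * u * v ^+ 3 + 2 * a 4%N * v ^+ 4.
Definition hess_vv (c : 'I_7 -> T) u v := let a k := c (inord k) in
  2 * a 2%N * u ^+ 4 + 6 * a 3%N * u ^+ 3 * v + 12 * a 4%N * u ^+ 2 * v ^+ 2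
   + 20 * a 5%N * u * v ^+ 3 + 30 * a 6%N * v ^+ 4.
Definition hess_uv (c : 'I_7 -> T) u v := let a k := c (inord k) in
  5 * a 1%N * u ^+ 4 + 8 * a 2%N * u ^+ 3 * v + 9 * a 3%N * u ^+ 2 * v ^+ 2
   + 8 * a 4%N * u * v ^+ 3 + 5 * a 5%N * v ^+ 4.
Definition hess c u v : T := hess_uu c u v * hess_vv c u v - hess_uv c u v ^+ 2.
Definition hess_polar c d u v : T := hess_uu d u v * hess_vv c u v + hess_uu c u v * hess_vv d u v
  - 2 * hess_uv c u v * hess_uv d u v.

(** The Hessian is a covariant of weight two, so it suffices to know that it is
    -25 [octa8] at the octahedral form itself. *)
Lemma hess_octa p q r s u v :
  hess (fun k => octa_coef k p q r s) u v =
  - 25 * (p * s - q * r) ^+ 2 * octa8 (p * u + q * v) (r * u + s * v).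
Proof.
rewrite /hess /hess_uu /hess_vv /hess_uv !inordK //= /octa8.
ring.
Qed.

Lemma hess_scale h (c : 'I_7 -> T) u v :
  hess (fun k => h * c k) u v = h ^+ 2 * hess c u v.
Proof. by rewrite /hess /hess_uu /hess_vv /hess_uv; ring. Qed.

(** Derivatives of the Hessian with respect to parameters on which the coefficients
    depend: [D] is any derivation that kills the variables u and v. *)
Lemma hess_derivation (D : T -> T) c u v :
  (forall x y, D (x + y) = D x + D y) -> (forall x y, D (x * y) = D x * y + x * D y) ->
  D u = 0 -> D v = 0 ->
  D (hess c u v) = hess_polar c (fun k => D (c k)) u v.
Proof.
move=> DD DM Du Dv.
have D1 : D 1 = 0 by apply: (addIr (D 1)); rewrite add0r -{3}[1](mulr1 1) DM mulr1 mul1r.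
have D0 : D 0 = 0 by apply: (addIr (D 0)); rewrite -DD !add0r.
have DN x : D (- x) = - D x by apply/eqP; rewrite -addr_eq0 -DD addNr D0.
have Dn n : D n%:R = 0 by elim: n => [|n IH]; rewrite ?D0 // -natr1 DD IH D1 addr0.
have DX x n : D x = 0 -> D (x ^+ n) = 0.
  by move=> h; elim: n => [|n IH]; rewrite ?expr0 ?D1 // exprS DM h IH mul0r mulr0 addr0.
have Dc x y : D y = 0 -> D (x * y) = D x * y by move=> h; rewrite DM h mulr0 addr0.
have Dl x y : D x = 0 -> D (x * y) = x * D y by move=> h; rewrite DM h mul0r add0r.
have DXu := DX u ^~ Du; have DXv := DX v ^~ Dv.
have Euu : D (hess_uu c u v) = hess_uu (fun k => D (c k)) u v.
  by rewrite /hess_uu !DD !(Dc _ (v ^+ _)) ?DXv // !(Dc _ v) // !(Dc _ (u ^+ _)) ?DXu // !(Dc _ u) // !(Dl _%:R) ?Dn.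
have Evv : D (hess_vv c u v) = hess_vv (fun k => D (c k)) u v.
  by rewrite /hess_vv !DD !(Dc _ (v ^+ _)) ?DXv // !(Dc _ v) // !(Dc _ (u ^+ _)) ?DXu // !(Dc _ u) // !(Dl _%:R) ?Dn.
have Euv : D (hess_uv c u v) = hess_uv (fun k => D (c k)) u v.
  by rewrite /hess_uv !DD !(Dc _ (v ^+ _)) ?DXv // !(Dc _ v) // !(Dc _ (u ^+ _)) ?DXu // !(Dc _ u) // !(Dl _%:R) ?Dn.
by rewrite /hess DD DN expr2 !DM Euu Evv Euv /hess_polar; ring.
Qed.

(** The coefficient of u^(6-k) v^k in the sum over j of c_j (A2 u - A1 v)^(6-j) u^j. The
    curves of the two families are linear in such coordinates: one row of g is A2 u - A1 v
    up to a multiple of u. *)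
Definition six_coef (c : nat -> T) (A1 A2 : T) (k : nat) : T := (- A1) ^+ k *
  match k with
  | 0 => c 0%N * A2 ^+ 6 + c 1%N * A2 ^+ 5 + c 2%N * A2 ^+ 4 + c 3%N * A2 ^+ 3
         + c 4%N * A2 ^+ 2 + c 5%N * A2 + c 6%N
  | 1 => 6 * c 0%N * A2 ^+ 5 + 5 * c 1%N * A2 ^+ 4 + 4 * c 2%N * A2 ^+ 3
         + 3 * c 3%N * A2 ^+ 2 + 2 * c 4%N * A2 + c 5%N
  | 2 => 15 * c 0%N * A2 ^+ 4 + 10 * c 1%N * A2 ^+ 3 + 6 * c 2%N * A2 ^+ 2
         + 3 * c 3%N * A2 + c 4%N
  | 3 => 20 * c 0%N * A2 ^+ 3 + 10 * c 1%N * A2 ^+ 2 + 4 * c 2%N * A2 + c 3%N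
  | 4 => 15 * c 0%N * A2 ^+ 2 + 5 * c 1%N * A2 + c 2%N
  | 5 => 6 * c 0%N * A2 + c 1%N
  | _ => c 0%N
  end.

(** In the coordinates of [six_coef] the sextic attached to a lift of the first family has
    coefficients that depend only on S = (alpha beta)^2 and W = alpha^2 + beta^2, which are
    polynomials in the components of the covering. *)
Definition ram_coef (S W : T) (j : nat) : T :=
  match j with
  | 0 => - 1 | 1 => 2 * W | 2 => - 5 * S | 3 => 0 | 4 => 5 * S ^+ 2
  | 5 => - 2 * W * S ^+ 2 | _ => S ^+ 3
  end.
(** The analogue of [ram_coef] for z^4 = -1. *)
Definition exc_coef (S W : T) (j : nat) : T :=
  match j with
  | 0 => W | 1 => - 8 * S | 2 => 5 * S * W | 3 => 0 | 4 => - 5 * S ^+ 2 * W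
  | 5 => 8 * S ^+ 3 | _ => - S ^+ 3 * W
  end.

Lemma octa_ram (x y s W A1 A2 : T) k : x ^+ 4 = W + 2 * s -> y ^+ 4 = W - 2 * s -> (k < 7)%N ->
  octa_coef k (y * (A2 + s)) (- (y * A1)) (- (x * (A2 - s))) (x * A1) =
  - 4 * (x * y * s) * six_coef (ram_coef (s ^+ 2) W) A1 A2 k.
Proof.
move=> hx hy; case: k => [|[|[|[|[|[|[|//]]]]]]] _; rewrite /octa_coef /six_coef /ram_coef; ring: hx hy.
Qed.

Lemma octa_exc (z x y s W A1 A2 : T) k : z ^+ 4 = - 1 -> x ^+ 4 = W + 2 * s -> y ^+ 4 = W - 2 * s ->
  (k < 7)%N ->
  octa_coef k (z * y * (A2 + s)) (- (z * y * A1)) (- (x * (A2 - s))) (x * A1) =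
  2 * z * (x * y) * six_coef (exc_coef (s ^+ 2) W) A1 A2 k.
Proof.
move=> hz hx hy; case: k => [|[|[|[|[|[|[|//]]]]]]] _; rewrite /octa_coef /six_coef /exc_coef; ring: hz hx hy.
Qed.

End Octa.

Lemma octa_coef_rmorph (T T' : comNzRingType) (f : {rmorphism T -> T'}) k p q r s :
  f (octa_coef k p q r s) = octa_coef k (f p) (f q) (f r) (f s).
Proof. case: k => [|[|[|[|[|[|k]]]]]] /=; ring. Qed.

Lemma octa_rmorph (T T' : comNzRingType) (f : {rmorphism T -> T'}) u v :
  f (octa u v) = octa (f u) (f v).
Proof. rewrite /octa; ring. Qed.

Lemma octa8_rmorph (T T' : comNzRingType) (f : {rmorphism T -> T'}) u v :
  f (octa8 u v) = octa8 (f u) (f v).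
Proof. rewrite /octa8; ring. Qed.

Lemma hess_rmorph (T T' : comNzRingType) (f : {rmorphism T -> T'}) c u v :
  f (hess c u v) = hess (fun k => f (c k)) (f u) (f v).
Proof. rewrite /hess /hess_uu /hess_vv /hess_uv; ring. Qed.

Lemma hess_polar_rmorph (T T' : comNzRingType) (f : {rmorphism T -> T'}) c d u v :
  f (hess_polar c d u v) = hess_polar (fun k => f (c k)) (fun k => f (d k)) (f u) (f v).
Proof. rewrite /hess_polar /hess_uu /hess_vv /hess_uv; ring. Qed.

Lemma six_coef_rmorph (T T' : comNzRingType) (f : {rmorphism T -> T'}) c A1 A2 k :
  f (six_coef c A1 A2 k) = six_coef (fun j => f (c j)) (f A1) (f A2) k.
Proof.
rewrite /six_coef rmorphM rmorphXn rmorphN; congr (_ * _).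
by case: k => [|[|[|[|[|[|k]]]]]]; rewrite /=; ring.
Qed.

Lemma ram_coef_rmorph (T T' : comNzRingType) (f : {rmorphism T -> T'}) S W j :
  f (ram_coef S W j) = ram_coef (f S) (f W) j.
Proof. by case: j => [|[|[|[|[|[|j]]]]]]; rewrite /ram_coef; ring. Qed.

Lemma exc_coef_rmorph (T T' : comNzRingType) (f : {rmorphism T -> T'}) S W j :
  f (exc_coef S W j) = exc_coef (f S) (f W) j.
Proof. by case: j => [|[|[|[|[|[|j]]]]]]; rewrite /exc_coef; ring. Qed.

Section Curves.
Variable R : realType.
Notation K := R[i].
Implicit Types (p r : binform R) (q : 'cV[K]_2).

Lemma octa_octa8 (u v : K) : octa u v = 0 -> octa8 u v = 0 -> u = 0 /\ v = 0.
Proof.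
move=> /eqP; rewrite /octa /octa8 !mulf_eq0 subr_eq0 => /orP[/orP[/eqP->|/eqP->]|/eqP E].
- by rewrite !expr0n mulr0 mul0r !add0r => /eqP; rewrite expf_eq0 => /eqP->.
- by rewrite !expr0n mulr0 !addr0 => /eqP; rewrite expf_eq0 => /eqP->.
have -> : u ^+ 8 + 14 * u ^+ 4 * v ^+ 4 + v ^+ 8 = 16 * v ^+ 8.
  have -> : u ^+ 8 = u ^+ 4 * u ^+ 4 by ring.
  by rewrite E; ring.
move/eqP; rewrite mulf_eq0 pnatr_eq0 /= expf_eq0 /= => /eqP v0.
by move/eqP: E; rewrite v0 expr0n expf_eq0 /= => /eqP.
Qed.

Lemma sextic_coordE (a : 'I_7 -> K) k : sextic_coord (sextic_of a) k = a k.
Proof.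
rewrite /sextic_coord -/(M2 _ _) /sextic_of raddf_sum (bigD1 k) //= mcoeffZ M2X mcoeffX eqxx mulr1.
rewrite big1 ?addr0 // => i /eqP ne; rewrite mcoeffZ M2X mcoeffX.
case: eqP => [E|]; last by rewrite mulr0.
case: ne; apply/val_inj.
by have := congr1 (fun m : 'X_{1..2} => m 1) E.
Qed.

(** The coordinates of f_1(M) in P(V_6): the form octa is evaluated at the two linear forms
    given by the rows of the adjugate of M. *)
Definition octa_mx (M : 'M[K]_2) (k : 'I_7) : K :=
  octa_coef k (M 1 1) (- M 0 1) (- M 1 0) (M 0 0).

Lemma f1E (M : 'M[K]_2) : f1 M = sextic_of (octa_mx M).
Proof.
have := octa_coefE ((M 1 1)%:MP) (- M 0 1)%:MP (- M 1 0)%:MP ((M 0 0)%:MP) X0 (@X1 R).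
rewrite /octa !mul_mpolyC !scaleNr [- _ + M 0 0 *: _]addrC => E; rewrite /f1 E /sextic_of.
apply: eq_bigr => k _; rewrite -mul_mpolyC; congr (_ * _).
by rewrite /octa_mx octa_coef_rmorph !rmorphN.
Qed.

Lemma mat_atE m n (g : 'M[binform R]_(m, n)) q i j : mat_at g q i j = ev q (g i j).
Proof. by rewrite mxE. Qed.

Lemma ev_lin_subst q S p : ev q (lin_subst S p) = ev (S *m q) p.
Proof.
rewrite /ev /lin_subst comp_mpoly_meval; apply: meval_eq => i.
rewrite tnth_mktuple raddf_sum mxE; apply: eq_bigr => j _.
exact: etrans (mevalZ _ _ _) (congr1 _ (mevalXU _ _)).
Qed.

Definition pull (phi : 'cV[binform R]_2) p := p \mPo [tuple phi i 0 | i < 2].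

Lemma ev_pull q phi p : ev q (pull phi p) = ev (mat_at phi q) p.
Proof.
rewrite /ev /pull comp_mpoly_meval; apply: meval_eq => i.
by rewrite tnth_mktuple mxE.
Qed.

Lemma mPo_homog d e (t : 2.-tuple (binform R)) p :
  (forall i, tnth t i \is e.-homog) -> p \is d.-homog -> p \mPo t \is (e * d).-homog.
Proof.
move=> ht hp; rewrite (form_sum hp) raddf_sum; apply: rpred_sum => k _.
rewrite /= comp_mpolyZ dhomogZ // M2X comp_mpolyX !big_ord_recl big_ord0 mulr1.
have -> : (e * d = e * (d - k) + e * k)%N by rewrite -mulnDr subnK // -ltnS.
by apply: homM; apply: homX.
Qed.

Lemma pull_homog d e (phi : 'cV[binform R]_2) p :
  (forall i, phi i 0 \is e.-homog) -> p \is d.-homog -> pull phi p \is (e * d).-homog.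
Proof. by move=> h; apply: mPo_homog => i; rewrite tnth_mktuple. Qed.

Lemma lin_subst_homog d S p : p \is d.-homog -> lin_subst S p \is d.-homog.
Proof.
rewrite -[X in _ -> is_true (_ \is X.-homog)]mul1n; apply: mPo_homog => i; rewrite tnth_mktuple.
by apply: rpred_sum => j _; rewrite dhomogZ // dhomogX; apply/eqP; exact: mdeg1.
Qed.

Lemma det2 (T : comNzRingType) (M : 'M[T]_2) : \det M = M 0 0 * M 1 1 - M 0 1 * M 1 0.
Proof.
rewrite (expand_det_row _ 0) !big_ord_recl big_ord0 addr0 /cofactor !det_mx11 !mxE /=.
rewrite /bump /= expr0 mul1r expr1 mulN1r mulrN.
by congr (M _ _ * M _ _ - M _ _ * M _ _); apply/val_inj.
Qed.

Definition octa_g (g : 'M[binform R]_2) (k : 'I_7) : binform R :=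
  octa_coef k (g 1 1) (- g 0 1) (- g 1 0) (g 0 0).

Lemma ev_octa_g q g k : ev q (octa_g g k) = octa_mx (mat_at g q) k.
Proof.
rewrite /octa_g /octa_mx !mxE -!evN.
exact: (octa_coef_rmorph (meval (fun k => q k 0))).
Qed.

Lemma octa_coef_homog n k (p q r s : binform R) : p \is n.-homog -> q \is n.-homog ->
  r \is n.-homog -> s \is n.-homog -> octa_coef k p q r s \is (n * 6).-homog.
Proof.
by move=> hp hq hr hs; case: k => [|[|[|[|[|[|k]]]]]] /=; hmgd.
Qed.

End Curves.

(** * Lifts and their degree *)

Section Lifts.
Variable R : realType.
Notation K := R[i].
Implicit Types (p r : binform R) (q : 'cV[K]_2).

(** A tuple of forms without common factor has no common zero: at a common zero q all of
    them would be divisible by [lin q]. *)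
Lemma curve_nz m n d (F : 'M[binform R]_(m, n)) q : is_curve d F -> q != 0 ->
  exists ij, ev q (F ij.1 ij.2) != 0.
Proof.
case=> hF hd q0; apply/existsP; apply: contraT; rewrite negb_exists => /forallP H.
have {}H i j : ev q (F i j) = 0 by have /negPn/eqP := H (i, j).
have [c /= E] : exists c, lin q = c%:MP.
  apply: hd => i j; case: d hF => [|d] hF.
    have := hF i j; move/form0_const => E; exists 0; rewrite mulr0 E.
    by rewrite (_ : _@__ = 0) ?mpolyC0 //; have := H i j; rewrite {1}E evC.
  by have [r hr Er] := form_factor q0 (hF i j) (H i j); exists r.
have := ev_lin q q; rewrite mulrC subrr E evC => c0.
by have := lin_ne0 q0; rewrite E c0 mpolyC0 eqxx.
Qed.

Lemma det_homog n (g : 'M[binform R]_2) : (forall i j, g i j \is n.-homog) ->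
  \det g \is (n + n).-homog.
Proof. by move=> hg; rewrite det2; hmgd. Qed.

Lemma ev_det q (g : 'M[binform R]_2) : ev q (\det g) = \det (mat_at g q).
Proof. by rewrite !det2 !evE !mxE. Qed.

Lemma octa_g_homog n (g : 'M[binform R]_2) k : (forall i j, g i j \is n.-homog) ->
  octa_g g k \is (n * 6).-homog.
Proof. by move=> hg; apply: octa_coef_homog; hmg. Qed.

Lemma form_nz d p : p \is d.-homog -> p != 0 -> exists2 q, q != 0 & ev q p != 0.
Proof.
move=> hp p0; case: (boolp.pselect (exists2 q : 'cV[K]_2, q != 0 & ev q p != 0)) => // H.
case/eqP: p0; apply: (form_ext hp) => q q0.
by apply/eqP; apply: contraT => e; case: H; exists q.
Qed.

(** The point where the two linear forms take the values det M and 2 det M is not a zero of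
    [octa]. *)
Lemma octa_mx_nz (M : 'M[K]_2) : \det M != 0 -> exists k, octa_mx M k != 0.
Proof.
move=> dM; apply/existsP; apply: contraT; rewrite negb_exists => /forallP H.
have E u v : octa (M 1 1 * u + - M 0 1 * v) (- M 1 0 * u + M 0 0 * v) = 0.
  by rewrite octa_coefE big1 // => k _; have := H k; rewrite negbK /octa_mx => /eqP ->; rewrite mul0r.
have := E (M 0 0 + 2 * M 0 1) (M 1 0 + 2 * M 1 1).
have -> : M 1 1 * (M 0 0 + 2 * M 0 1) + - M 0 1 * (M 1 0 + 2 * M 1 1) = \det M by rewrite det2; ring.
have -> : - M 1 0 * (M 0 0 + 2 * M 0 1) + M 0 0 * (M 1 0 + 2 * M 1 1) = 2 * \det M by rewrite det2; ring.
rewrite /octa (_ : _ * _ = - 30 * \det M ^+ 6); last by ring.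
by move/eqP; rewrite mulf_eq0 oppr_eq0 pnatr_eq0 /= expf_eq0 /= (negbTE dM).
Qed.

(** What the classification uses of a Galois lift, in terms of forms. The equality of the
    maps f_1 o g and F o phi becomes the vanishing of the 2 x 2 minors of their coordinates
    [lift_cross]. This record is stable under changes of coordinates, whereas membership of F
    in V_5 would have to be transported. *)
Record octa_lift (phi : 'cV[binform R]_2) n (F : 'rV[binform R]_7) (g : 'M[binform R]_2) : Prop :=
  OctaLift {
    lift_F : forall k, F 0 k \is 6.-homog;
    lift_Fz : forall q, q != 0 -> exists k, ev q (F 0 k) != 0;
    lift_full : linearly_full F;
    lift_g : forall i j, g i j \is n.-homog;
    lift_gz : forall q, q != 0 -> exists ij, ev q (g ij.1 ij.2) != 0;
    lift_det : \det g != 0;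
    lift_cross : forall k l, octa_g g k * pull phi (F 0 l) = octa_g g l * pull phi (F 0 k) }.

Definition al q : K := (q 0 0 ^+ 2 - q 1 0 ^+ 2) / 2.
Definition be q : K := (q 0 0 ^+ 2 + q 1 0 ^+ 2) / 2.
Definition ga q : K := q 0 0 * q 1 0.

Lemma ev_alpha2 q : ev q alpha2 = al q.
Proof. by rewrite /alpha2 !evE /al mulrC. Qed.
Lemma ev_beta2 q : ev q beta2 = be q.
Proof. by rewrite /beta2 !evE /be mulrC. Qed.
Lemma ev_gamma q : ev q gamma = ga q.
Proof. by rewrite /gamma !evE. Qed.

Lemma be2E q : be q ^+ 2 = al q ^+ 2 + ga q ^+ 2.
Proof. by rewrite /al /be /ga; field. Qed.

Lemma al_ga q : q != 0 -> al q = 0 -> ga q = 0 -> False.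
Proof.
rewrite (ptE q) pt_eq0 /al /ga !pt0 !pt1.
move=> q0 /eqP; rewrite mulf_eq0 invr_eq0 pnatr_eq0 orbF subr_eq0 => /eqP E.
move=> /eqP; rewrite mulf_eq0 => /orP[/eqP h|/eqP h]; move/eqP: E q0;
 by rewrite h expr0n /= ?expf_eq0 1?eq_sym ?expf_eq0 /= => ->; rewrite eqxx.
Qed.

Lemma homog_alpha2 : (alpha2 : binform R) \is 2.-homog. Proof. by rewrite /alpha2; hmgd. Qed.
Lemma homog_beta2 : (beta2 : binform R) \is 2.-homog. Proof. by rewrite /beta2; hmgd. Qed.
Lemma homog_gamma : (gamma : binform R) \is 2.-homog. Proof. by rewrite /gamma; hmgd. Qed.

Lemma phi0_homog i : phi0 R i 0 \is 4.-homog.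
Proof.
have := homog_alpha2; have := homog_gamma => hg ha.
case: i => -[|[|//]] Hi; rewrite mxE /=; hmgd.
Qed.

Lemma mat_phi0 q : mat_at (phi0 R) q = pt (- al q ^+ 2) (ga q ^+ 2).
Proof.
by rewrite [LHS]ptE !mxE -ev_alpha2 -ev_gamma /= !evE.
Qed.

Lemma mat_phi0_nz q : q != 0 -> mat_at (phi0 R) q != 0.
Proof.
move=> q0; rewrite mat_phi0 pt_eq0 oppr_eq0 !expf_eq0 /=.
by apply/negP => /andP[/eqP h /eqP h']; exact: (al_ga q0 h h').
Qed.

Lemma pull_phi0_homog d p : p \is d.-homog -> pull (phi0 R) p \is (4 * d).-homog.
Proof. exact: pull_homog phi0_homog. Qed.

Section Lift.
Variables (n : nat) (F : 'rV[binform R]_7) (g : 'M[binform R]_2).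
Hypothesis L : octa_lift (phi0 R) n F g.

Lemma lift_fnz : exists k, octa_g g k != 0.
Proof.
have [q q0 dq] := form_nz (det_homog (lift_g L)) (lift_det L).
rewrite ev_det in dq; have [k hk] := octa_mx_nz dq; exists k.
by apply: contra_neq hk => E; rewrite -ev_octa_g E ev0.
Qed.

Lemma lift_pullz q : q != 0 -> exists k, ev q (pull (phi0 R) (F 0 k)) != 0.
Proof.
by move=> q0; have [k hk] := lift_Fz L (mat_phi0_nz q0); exists k; rewrite ev_pull.
Qed.

(** The coordinates of F o phi have degree 24 and no common zero, those of f_1 o g have
    degree 6 n and are proportional to them; the factor of proportionality is therefore a
    form, of degree 6 n - 24. *)
Lemma lift_factor : (24 <= n * 6)%N /\ exists h, [/\ h \is (n * 6 - 24).-homog, h != 0 &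
  forall k, octa_g g k = h * pull (phi0 R) (F 0 k)].
Proof.
have [k hk] := lift_fnz.
have [l hl] : exists l, pull (phi0 R) (F 0 l) != 0.
  have q0 : pt 1 0 != 0 :> 'cV[K]_2 by rewrite pt_eq0 oner_eq0.
  by have [l hl] := lift_pullz q0; exists l; apply: contra_neq hl => ->; rewrite ev0.
have cr := lift_cross L.
have Pk : pull (phi0 R) (F 0 k) != 0.
  have : octa_g g k * pull (phi0 R) (F 0 l) != 0 by rewrite mulf_neq0.
  by rewrite cr mulf_eq0 negb_or => /andP[].
have [|le [h hh E]] := form_cancel (pull_phi0_homog (lift_F L k)) Pk (octa_g_homog k (lift_g L)) hk
  (fun l => ex_intro _ _ (etrans (cr k l) (mulrC _ _))).
  by move=> q q0 _; exact: lift_pullz.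
split=> //; exists h; split=> //.
  by apply: contra_neq hk => h0; rewrite E h0 mulr0.
have aux (x y z : binform R) : x * y * z = y * z * x by ring.
move=> j; apply: (mulIf Pk); rewrite (cr j k) E; exact: aux.
Qed.

(** The two linear forms in u and v, with coefficients the entries of g, whose [octa] is the
    sextic f_1 o g. *)
Definition octa_row1 u v : binform R := g 1 1 * u%:MP + - g 0 1 * v%:MP.
Definition octa_row2 u v : binform R := - g 1 0 * u%:MP + g 0 0 * v%:MP.

(** Both sides are the Hessian of f_1 o g, once as h times F o phi and once by
    [hess_octa]. *)
Lemma lift_hess h : (forall k, octa_g g k = h * pull (phi0 R) (F 0 k)) ->
  forall u v, h ^+ 2 * hess (fun k => pull (phi0 R) (F 0 k)) u%:MP v%:MP =
   - 25 * (\det g) ^+ 2 * octa8 (octa_row1 u v) (octa_row2 u v).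
Proof.
move=> E u v; rewrite -hess_scale.
transitivity (hess (octa_g g) u%:MP v%:MP); first by rewrite /hess /hess_uu /hess_vv /hess_uv !E.
have -> : \det g = g 1 1 * g 0 0 - (- g 0 1) * (- g 1 0).
  by rewrite det2 mulrNN [g 1 1 * _]mulrC.
exact: (hess_octa (g 1 1) (- g 0 1) (- g 1 0) (g 0 0)).
Qed.

Lemma lift_hess_dvd h : (forall k, octa_g g k = h * pull (phi0 R) (F 0 k)) ->
  forall u v, exists r, (\det g) ^+ 2 * octa8 (octa_row1 u v) (octa_row2 u v) = h ^+ 2 * r.
Proof.
move=> E u v; have H := lift_hess E u v.
have h25 : (- 25 : K) != 0 by rewrite oppr_eq0 pnatr_eq0.
exists ((- 25)^-1%:MP * hess (fun k => pull (phi0 R) (F 0 k)) u%:MP v%:MP).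
rewrite mulrCA H; have -> : (- 25 : binform R) = (- 25 : K)%:MP.
  by rewrite mpolyCN; congr (- _); exact: esym (rmorph_nat _ _).
by rewrite -[X in _ = _ * X]mulrA [RHS]mulrA -mpolyCM mulVf // mul1r.
Qed.

Lemma row_nz q : q != 0 -> exists u v, ev q (octa_row1 u v) != 0 \/ ev q (octa_row2 u v) != 0.
Proof.
move=> q0; have [[i j] /= hij] := lift_gz L q0.
pose b := (i == 0) (+) (j == 0).
have i01 (k : 'I_2) : k = 0 \/ k = 1.
  by case: k => -[|[|//]] Hi; [left|right]; exact/val_inj.
have [Ei|Ei] := i01 i; have [Ej|Ej] := i01 j; rewrite {}Ei {}Ej in hij.
- by exists 0, 1; right; rewrite /octa_row2 !evE mulr0 add0r mulr1.
- by exists 0, 1; left; rewrite /octa_row1 !evE mulr0 add0r mulr1 oppr_eq0.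
- by exists 1, 0; right; rewrite /octa_row2 !evE mulr0 addr0 mulr1 oppr_eq0.
- by exists 1, 0; left; rewrite /octa_row1 !evE mulr0 addr0 mulr1.
Qed.

Lemma ev_octa_row q u v : ev q (octa (octa_row1 u v) (octa_row2 u v)) =
  \sum_(k < 7) ev q (octa_g g k) * (u ^+ (6 - k) * v ^+ k).
Proof.
rewrite octa_coefE ev_sum; apply: eq_bigr => k _.
by rewrite evM [X in _ * X]evM !evX !evC.
Qed.

Lemma ev_octa q p r : ev q (octa p r) = octa (ev q p) (ev q r).
Proof. exact: (octa_rmorph (meval (fun k => q k 0))). Qed.
Lemma ev_octa8 q p r : ev q (octa8 p r) = octa8 (ev q p) (ev q r).
Proof. exact: (octa8_rmorph (meval (fun k => q k 0))). Qed.

(** Where f_1 o g vanishes, octa vanishes on the two rows, so octa8 does not. *)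
Lemma octa8_nz q : q != 0 -> (forall k, ev q (octa_g g k) = 0) ->
  exists u v, ev q (octa8 (octa_row1 u v) (octa_row2 u v)) != 0.
Proof.
move=> q0 H; have [u [v uv]] := row_nz q0; exists u, v; rewrite ev_octa8.
apply/eqP => H8; have := ev_octa_row q u v; rewrite ev_octa big1 => [|k _]; last by rewrite H mul0r.
by move=> Ho; have [h1 h2] := octa_octa8 Ho H8; move: uv; rewrite h1 h2 eqxx; case.
Qed.

(** At the zeros of h the form octa8 of the rows is not identically zero by [octa8_nz], so
    h^2 divides (det g)^2 by [lift_hess]; compare degrees: 2 (6 n - 24) <= 4 n. *)
Lemma lift_deg_le : (n <= 6)%N.
Proof.
have [le [h [hh h0 E]]] := lift_factor.
have hD := det_homog (lift_g L).
have [||||w|q q0 hq|le2 _] := @form_cancel R (K * K)%type (fun w => octa8 (octa_row1 w.1 w.2) (octa_row2 w.1 w.2))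
   ((n * 6 - 24) * 2)%N ((n + n) * 2)%N (h ^+ 2) (\det g ^+ 2).
- exact: homX.
- by rewrite expf_neq0.
- exact: homX.
- by rewrite expf_neq0 // (lift_det L).
- exact: lift_hess_dvd.
- have [|u [v uv]] := octa8_nz q0; last by exists (u, v).
  move=> k; rewrite E evM; move: hq; rewrite evX => /eqP; rewrite expf_eq0 /= => /eqP->.
  by rewrite mul0r.
by move: le le2; clear; lia.
Qed.

End Lift.
End Lifts.

(** * Coordinates of sextics and tangency to the one-dimensional orbit *)

Section Chain.
Variables (T : comNzRingType) (L D D0 D1 : T -> T) (a b p r : T).
Hypothesis LD : forall x y, L (x + y) = L x + L y.
Definition chain_at x := D (L x) = a * L (D0 x) + b * L (D1 x).

(** The chain rule for a linear substitution is the statement that two derivations along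
    [L] agree; it is enough to check it on generators, by these two lemmas. *)
Lemma derivation_chainM (LM : forall x y, L (x * y) = L x * L y)
  (DM : forall x y, D (x * y) = D x * y + x * D y)
  (D0M : forall x y, D0 (x * y) = D0 x * y + x * D0 y)
  (D1M : forall x y, D1 (x * y) = D1 x * y + x * D1 y) :
  chain_at p -> chain_at r -> chain_at (p * r).
Proof.
rewrite /chain_at => hp hr; rewrite LM DM hp hr D0M D1M !LD !LM; ring.
Qed.

Lemma derivation_chainD (DD : forall x y, D (x + y) = D x + D y)
  (D0D : forall x y, D0 (x + y) = D0 x + D0 y) (D1D : forall x y, D1 (x + y) = D1 x + D1 y) :
  chain_at p -> chain_at r -> chain_at (p + r).
Proof.
rewrite /chain_at => hp hr; rewrite LD DD hp hr D0D D1D !LD; ring.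
Qed.
End Chain.

Section Transport.
Variable R : realType.
Notation K := R[i].
Implicit Types (p r : binform R) (q : 'cV[K]_2) (N S A B M : 'M[K]_2).

(** Sextics in u and v are compared through their values; [sextval_inj] recovers the
    coefficients. *)
Definition sextval (a : 'I_7 -> K) (u v : K) : K := \sum_(k < 7) a k * (u ^+ (6 - k) * v ^+ k).

Lemma ev_sextic_of a u v : ev (pt u v) (sextic_of a) = sextval a u v.
Proof. by rewrite /sextic_of ev_sum; apply: eq_bigr => k _; rewrite !evE pt0 pt1. Qed.

Lemma sextic_of_homog (a : 'I_7 -> K) : sextic_of a \is 6.-homog.
Proof.
rewrite /sextic_of; apply: rpred_sum => k _; rewrite dhomogZ // M2X dhomogX.
by apply/eqP; rewrite [LHS]mdegM2 subnK // -ltnS.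
Qed.

Lemma form_eq d p r : p \is d.-homog -> r \is d.-homog ->
  (forall u v, ev (pt u v) p = ev (pt u v) r) -> p = r.
Proof.
move=> hp hr H; apply/eqP; rewrite -subr_eq0; apply/eqP; apply: (form_ext (homB hp hr)).
by move=> q _; rewrite evB (ptE q) H subrr.
Qed.

Lemma sextval_inj a b : (forall u v, sextval a u v = sextval b u v) -> a =1 b.
Proof.
move=> H k; rewrite -(sextic_coordE a) -(sextic_coordE b); congr sextic_coord.
by apply: form_eq (sextic_of_homog a) (sextic_of_homog b) _ => u v; rewrite !ev_sextic_of.
Qed.

Definition lform N (i : 'I_2) : binform R := (N i 0)%:MP * X0 + (N i 1)%:MP * X1.
Definition subst6 N : 'M[K]_7 :=
  \matrix_(k, l) sextic_coord (lform N 0 ^+ (6 - l) * lform N 1 ^+ l) k.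

Lemma sextic_of_coord p : p \is 6.-homog -> sextic_of (sextic_coord p) = p.
Proof. by move=> hp; rewrite [RHS](form_sum hp). Qed.

Lemma sextval_subst6 N a u v :
  sextval (fun k => \sum_l subst6 N k l * a l) u v =
  sextval a (N 0 0 * u + N 0 1 * v) (N 1 0 * u + N 1 1 * v).
Proof.
rewrite /sextval; under eq_bigr => k _ do rewrite mulr_suml.
rewrite exchange_big /=; apply: eq_bigr => l _.
have hl i : lform N i \is 1.-homog by rewrite /lform; hmgd.
have hP : lform N 0 ^+ (6 - l) * lform N 1 ^+ l \is 6.-homog.
  have l7 : (l < 7)%N := ltn_ord l.
  apply: hom_eq; first (apply: homM; apply: homX; exact: hl).
  by rewrite !mul1n subnK // -ltnS.
transitivity (a l * ev (pt u v) (lform N 0 ^+ (6 - l) * lform N 1 ^+ l)); last first.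
  by rewrite /lform !evE pt0 pt1.
rewrite -[in RHS](sextic_of_coord hP) ev_sextic_of /sextval mulr_sumr.
by apply: eq_bigr => k _; rewrite mxE [RHS]mulrA [a l * _]mulrC.
Qed.

Lemma subst6M N S : N *m S = 1%:M -> subst6 S *m subst6 N = 1%:M.
Proof.
move=> NS; apply/matrixP=> k l.
pose e (j : 'I_7) : K := (j == l)%:R.
have E N' j : subst6 N' j l = \sum_i subst6 N' j i * e i.
  by rewrite (bigD1 l) //= /e eqxx mulr1 big1 ?addr0 // => i /negbTE->; rewrite mulr0.
transitivity (\sum_j subst6 S k j * \sum_i subst6 N j i * e i).
  by rewrite mxE; apply: eq_bigr => j _; rewrite [X in _ * X]E.
rewrite [RHS]mxE -/(e k); apply: (@sextval_inj (fun k => \sum_j subst6 S k j * \sum_i subst6 N j i * e i) e _ k).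
move=> u v; rewrite sextval_subst6 sextval_subst6; congr sextval.
- transitivity ((N *m S) 0 0 * u + (N *m S) 0 1 * v); first by rewrite !mulmx2E; ring.
  by rewrite NS !mxE /= mul1r mul0r addr0.
transitivity ((N *m S) 1 0 * u + (N *m S) 1 1 * v); first by rewrite !mulmx2E; ring.
by rewrite NS !mxE /= mul1r mul0r add0r.
Qed.

Lemma mat_at_precomp m n (g : 'M[binform R]_(m, n)) S q :
  mat_at (precomp g S) q = mat_at g (S *m q).
Proof. by apply/matrixP=> i j; rewrite !mxE ev_lin_subst. Qed.

Lemma mat_at_const m n (A' : 'M[K]_(m, n)) q : mat_at (const_form A' : 'M[binform R]_(m, n)) q = A'.
Proof. by apply/matrixP=> i j; rewrite !mxE evC. Qed.

Lemma mat_atM m n k (g : 'M[binform R]_(m, n)) (g' : 'M[binform R]_(n, k)) q :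
  mat_at (g *m g') q = mat_at g q *m mat_at g' q.
Proof.
apply/matrixP=> i j; rewrite !mxE ev_sum; apply: eq_bigr => l _.
by rewrite !mxE evM.
Qed.

Lemma mat_atZ m n c (g : 'M[binform R]_(m, n)) q :
  mat_at (c%:MP *: g) q = c *: mat_at g q.
Proof. by apply/matrixP=> i j; rewrite !mxE evM evC. Qed.

(** [generally_ramified] in terms of values: at q the sextic is c l^6, with l a linear form,
    and its derivatives lie in l^5 V_1, the affine cone over the tangent line to the
    one-dimensional orbit at l^6. *)
Definition tangent6 (F : 'rV[binform R]_7) := exists q l0 l1 c,
  [/\ q != 0, (l0 != 0) || (l1 != 0), c != 0,
    forall u v, sextval (fun k => ev q (F 0 k)) u v = c * (l0 * u + l1 * v) ^+ 6 &
    forall i, exists m0 m1, forall u v, sextval (fun k => ev q (mderiv i (F 0 k))) u v =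
      (l0 * u + l1 * v) ^+ 5 * (m0 * u + m1 * v)].

Lemma ev_curve_at F q u v : ev (pt u v) (curve_at F q) = sextval (fun k => ev q (F 0 k)) u v.
Proof. exact: ev_sextic_of. Qed.
Lemma ev_curve_diff F i q u v :
  ev (pt u v) (curve_diff F i q) = sextval (fun k => ev q (mderiv i (F 0 k))) u v.
Proof. exact: ev_sextic_of. Qed.

Lemma ev_sl2_act A f u v : ev (pt u v) (sl2_act A f) =
  ev (pt (invmx A 0 0 * u + invmx A 0 1 * v) (invmx A 1 0 * u + invmx A 1 1 * v)) f.
Proof.
by rewrite /sl2_act ev_lin_subst; congr ev; rewrite [LHS]ptE !mulmx2E pt0 pt1.
Qed.

Lemma ev_sl2_act6 A x y u v :
  ev (pt u v) (x *: sl2_act A (X0 ^+ 6) + y *: sl2_act A (X0 ^+ 5 * X1)) =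
  x * (invmx A 0 0 * u + invmx A 0 1 * v) ^+ 6 +
  y * ((invmx A 0 0 * u + invmx A 0 1 * v) ^+ 5 * (invmx A 1 0 * u + invmx A 1 1 * v)).
Proof.
rewrite evD; congr (_ + _).
  by rewrite evZ; congr (_ * _); rewrite ev_sl2_act evX evX0 pt0.
by rewrite evZ; congr (_ * _); rewrite ev_sl2_act evM evX evX0 evX1 pt0 pt1.
Qed.

(** The linear form l is the first row of A^-1; conversely a nonzero l is the first row of a
    matrix of determinant one. *)
Lemma ramified_tangent6 F : generally_ramified F <-> tangent6 F.
Proof.
split=> [[q [A [q0 dA [c c0 E] H]]]|[q [l0 [l1 [c [q0 l01 c0 E H]]]]]].
- have uA : A \in unitmx by rewrite unitmxE dA unitr1.
  have dI : \det (invmx A) != 0 by rewrite det_inv dA invr1 oner_eq0.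
  exists q, (invmx A 0 0), (invmx A 0 1), c; split=> //.
  + rewrite -negb_and; apply: contra dI => /andP[/eqP h0 /eqP h1].
    by rewrite det2 h0 h1 !mul0r subrr.
  + move=> u v; rewrite -ev_curve_at E evZ ev_sl2_act !evE pt0.
    by [].
  move=> i; have [x [y Hi]] := H i.
  exists (x * invmx A 0 0 + y * invmx A 1 0), (x * invmx A 0 1 + y * invmx A 1 1) => u v.
  rewrite -ev_curve_diff Hi ev_sl2_act6; ring.
have [m0 [m1 dm]] : exists m0 m1, l0 * m1 - l1 * m0 = 1.
  case: (eqVneq l0 0) l01 => [->|l00 _] /=.
    move=> l10; exists (- l1^-1), 0; rewrite mulrN mulr0 sub0r opprK mulfV //.
  by exists 0, l0^-1; rewrite mulfV // mulr0 subr0.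
pose N := mx_of_rows 2 2 [:: [:: l0; l1]; [:: m0; m1]].
have dN : \det N = 1 by rewrite det2 !mxE /=.
have uN : N \in unitmx by rewrite unitmxE dN unitr1.
exists q, (invmx N); split=> //.
- by rewrite det_inv dN invr1.
- exists c => //; have h6 : (X0 : binform R) ^+ 6 \is 6.-homog by hmgd.
  apply: form_eq (sextic_of_homog _) (homZ _ (lin_subst_homog _ h6)) _ => u v.
  rewrite ev_curve_at E evZ -/(sl2_act _ _) ev_sl2_act invmxK !evE pt0 !mxE /=.
  by [].
move=> i; have [x [y Hi]] := H i.
exists (x * m1 - y * m0), (y * l0 - x * l1).
have h6 : (X0 : binform R) ^+ 6 \is 6.-homog by hmgd.
have h51 : (X0 : binform R) ^+ 5 * X1 \is 6.-homog by hmgd.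
apply: form_eq (sextic_of_homog _) (homD (homZ _ (lin_subst_homog _ h6)) (homZ _ (lin_subst_homog _ h51))) _ => u v.
rewrite ev_curve_diff Hi -!/(sl2_act _ _) ev_sl2_act6 invmxK !mxE /=.
transitivity ((l0 * u + l1 * v) ^+ 5 * ((x * u + y * v) * (l0 * m1 - l1 * m0))).
  by rewrite dm mulr1.
ring.
Qed.

Definition chain S i p := mderiv i (lin_subst S p) =
  (S 0 i)%:MP * lin_subst S (mderiv 0 p) + (S 1 i)%:MP * lin_subst S (mderiv 1 p).

Lemma lin_substD S p r : lin_subst S (p + r) = lin_subst S p + lin_subst S r.
Proof. exact: comp_mpolyD. Qed.
Lemma lin_substM S p r : lin_subst S (p * r) = lin_subst S p * lin_subst S r.
Proof. exact: (rmorphM (comp_mpoly _)). Qed.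

Lemma chainM S i p r : chain S i p -> chain S i r -> chain S i (p * r).
Proof.
exact: (@derivation_chainM _ (lin_subst S) (mderiv i) (mderiv 0) (mderiv 1) _ _ p r
  (lin_substD S) (lin_substM S) (mderivM i) (mderivM 0) (mderivM 1)).
Qed.

Lemma chainD S i p r : chain S i p -> chain S i r -> chain S i (p + r).
Proof.
exact: (@derivation_chainD _ (lin_subst S) (mderiv i) (mderiv 0) (mderiv 1) _ _ p r
  (lin_substD S) (mderivD i) (mderivD 0) (mderivD 1)).
Qed.

Lemma chainC S i c : chain S i c%:MP.
Proof.
have e : lin_subst S c%:MP = c%:MP :> binform R by exact: comp_mpolyC.
have e0 : lin_subst S 0 = 0 :> binform R by exact: comp_mpoly0.
by rewrite /chain e !mderivC e0 !mulr0 addr0.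
Qed.

Lemma chainU S i (k : 'I_2) : chain S i ('X_k).
Proof.
have e : lin_subst S 'X_k = \sum_(j < 2) S k j *: 'X_j :> binform R.
  by rewrite /lin_subst comp_mpolyXU nth_mktuple.
have e1 : lin_subst S 1 = 1 :> binform R by exact: (rmorph1 (comp_mpoly _)).
have e0 : lin_subst S 0 = 0 :> binform R by exact: comp_mpoly0.
have dX (j l : 'I_2) : mderiv j ('X_l : binform R) = (l == j)%:R.
  rewrite mderivX mnm1E; case: eqP => [->|_]; last by rewrite scale0r.
  by rewrite scale1r (_ : (_ - _)%MM = 0%MM) ?mpolyX0 //; apply/mnmP => m; rewrite mnmBE subnn mnm0E.
have eb (b : bool) : lin_subst S b%:R = b%:R :> binform R by case: b.
rewrite /chain e sum2 mderivD !mderivZ !dX !eb -!mul_mpolyC.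
by clear; case: (ord2P i) => ->; case: (ord2P k) => ->; rewrite /= ?mulr1 ?mulr0 ?addr0 ?add0r.
Qed.

Lemma chainX S i p n : chain S i p -> chain S i (p ^+ n).
Proof.
by move=> hp; elim: n => [|n IH]; [exact: chainC|rewrite exprS; exact: chainM].
Qed.

Lemma mderiv_lin_subst S i d p : p \is d.-homog -> chain S i p.
Proof.
move=> /form_sum ->; elim/big_ind: _ => [|x y|k _]; [|exact: chainD|].
  by rewrite -mpolyC0; exact: chainC.
rewrite -mul_mpolyC; apply: chainM; first exact: chainC.
by apply: chainM; apply: chainX; exact: chainU.
Qed.

Lemma ev_mderiv_lin_subst S i d p q : p \is d.-homog ->
  ev q (mderiv i (lin_subst S p)) =
  S 0 i * ev (S *m q) (mderiv 0 p) + S 1 i * ev (S *m q) (mderiv 1 p).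
Proof.
move=> hp; exact: (etrans (congr1 (ev q) (mderiv_lin_subst S i hp)) (etrans (evD _ _ _)
  (congr2 +%R (etrans (evM _ _ _) (congr2 *%R (evC _ _) (ev_lin_subst _ _ _)))
              (etrans (evM _ _ _) (congr2 *%R (evC _ _) (ev_lin_subst _ _ _)))))).
Qed.

Definition substF N S (F : 'rV[binform R]_7) : 'rV[binform R]_7 :=
  \row_k \sum_l subst6 N k l *: lin_subst S (F 0 l).

Lemma ev_substF N S F q k :
  ev q (substF N S F 0 k) = \sum_l subst6 N k l * ev (S *m q) (F 0 l).
Proof.
rewrite mxE ev_sum; apply: eq_bigr => l _.
by rewrite evZ; congr (_ * _); exact: ev_lin_subst.
Qed.

Lemma substF_homog N S (F : 'rV[binform R]_7) k : (forall k, F 0 k \is 6.-homog) -> substF N S F 0 k \is 6.-homog.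
Proof.
move=> hF; rewrite mxE; apply: rpred_sum => l _; rewrite dhomogZ //.
exact: lin_subst_homog.
Qed.

Lemma sextval_substF N S F q u v : sextval (fun k => ev q (substF N S F 0 k)) u v =
  sextval (fun k => ev (S *m q) (F 0 k)) (N 0 0 * u + N 0 1 * v) (N 1 0 * u + N 1 1 * v).
Proof.
rewrite -sextval_subst6; apply: eq_bigr => k _; congr (_ * _); exact: ev_substF.
Qed.

(** Coordinate changes of P(V_6) induced by GL_2 preserve the one-dimensional orbit and its
    tangent lines. *)
Lemma tangent6_substF N S (F : 'rV[binform R]_7) : (forall k, F 0 k \is 6.-homog) ->
  N \in unitmx -> S \in unitmx -> tangent6 F -> tangent6 (substF N S F).
Proof.
move=> hF uN uS [q [l0 [l1 [c [q0 l01 c0 E H]]]]].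
have Sq : S *m (invmx S *m q) = q by rewrite mulmxA mulmxV // mul1mx.
exists (invmx S *m q), (l0 * N 0 0 + l1 * N 1 0), (l0 * N 0 1 + l1 * N 1 1), c; split=> //.
- by apply: contra_neq q0 => h; rewrite -Sq h mulmx0.
- rewrite -negb_and; apply/negP => /andP[/eqP h0 /eqP h1].
  have dN : \det N != 0 by rewrite -unitfE -unitmxE.
  case/orP: l01 => /negP; apply; rewrite -(mulrI_eq0 _ (mulfI dN)) det2; apply/eqP.
    transitivity (N 1 1 * (l0 * N 0 0 + l1 * N 1 0) - N 1 0 * (l0 * N 0 1 + l1 * N 1 1)); first by ring.
    by rewrite h0 h1 !mulr0 subrr.
  transitivity (N 0 0 * (l0 * N 0 1 + l1 * N 1 1) - N 0 1 * (l0 * N 0 0 + l1 * N 1 0)); first by ring.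
  by rewrite h0 h1 !mulr0 subrr.
- move=> u v; rewrite sextval_substF Sq E; congr (_ * _ ^+ _); ring.
move=> i; have [x0 [y0 H0]] := H 0; have [x1 [y1 H1]] := H 1.
exists ((S 0 i * x0 + S 1 i * x1) * N 0 0 + (S 0 i * y0 + S 1 i * y1) * N 1 0),
  ((S 0 i * x0 + S 1 i * x1) * N 0 1 + (S 0 i * y0 + S 1 i * y1) * N 1 1) => u v.
set u' := N 0 0 * u + N 0 1 * v; set v' := N 1 0 * u + N 1 1 * v.
transitivity (S 0 i * sextval (fun k => ev q (mderiv 0 (F 0 k))) u' v' +
              S 1 i * sextval (fun k => ev q (mderiv 1 (F 0 k))) u' v').
  rewrite -!sextval_subst6 /sextval !mulr_sumr -big_split /=; apply: eq_bigr => k _.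
  have aux (a b s t m : K) : a * (s * m) + b * (t * m) = (a * s + b * t) * m by ring.
  rewrite [RHS]aux; congr (_ * _).
  rewrite mxE linear_sum ev_sum !mulr_sumr -big_split /=; apply: eq_bigr => l _.
  transitivity (subst6 N k l * ev (invmx S *m q) (mderiv i (lin_subst S (F 0 l)))).
    exact: etrans (congr1 (ev _) (mderivZ _ _ _)) (evZ _ _ _).
  rewrite (ev_mderiv_lin_subst S i _ (hF l)) Sq.
  by rewrite mulrDr; congr (_ + _); exact: mulrCA.
rewrite H0 H1 /u' /v'; ring.
Qed.

Lemma substFK N N' S S' (F : 'rV[binform R]_7) : (forall k, F 0 k \is 6.-homog) ->
  N *m N' = 1%:M -> S *m S' = 1%:M -> substF N' S' (substF N S F) = F.
Proof.
move=> hF NN SS; apply/matrixP=> i k; rewrite ord1 {i}.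
apply: form_eq (substF_homog _ _ _ (fun k => substF_homog _ _ _ hF)) (hF k) _ => u v.
rewrite ev_substF; under eq_bigr => l _ do rewrite ev_substF mulmxA SS mul1mx mulr_sumr.
rewrite exchange_big /=; transitivity (\sum_l (1%:M : 'M[K]_7) k l * ev (pt u v) (F 0 l)).
  apply: eq_bigr => l _; rewrite -(subst6M NN) mxE mulr_suml.
  by apply: eq_bigr => j _; rewrite mulrA.
rewrite (bigD1 k) //= mxE eqxx mul1r big1 ?addr0 // => l lk.
by rewrite mxE eq_sym (negbTE lk) mul0r.
Qed.

End Transport.

(** * Transporting lifts *)

Section LiftTransport.
Variable R : realType.
Notation K := R[i].
Implicit Types (p r : binform R) (q : 'cV[K]_2) (N S A B M : 'M[K]_2).

(** B acts on the octahedral form by a scalar, through its adjugate as in [octa_mx]. *)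
Definition octa_stab B := exists2 c : K, c != 0 & forall u v,
  octa (B 1 1 * u + - B 0 1 * v) (- B 1 0 * u + B 0 0 * v) = c * octa u v.

Definition adjm A : 'M[K]_2 := mx_of_rows 2 2 [:: [:: A 1 1; - A 0 1]; [:: - A 1 0; A 0 0]].

Lemma adjm_unit A : A \in unitmx -> adjm A \in unitmx.
Proof.
rewrite !unitmxE !det2 !mxE /= mulrNN.
by rewrite [A 1 1 * A 0 0]mulrC.
Qed.

Lemma sextval_octa_mx M u v :
  sextval (octa_mx M) u v = octa (M 1 1 * u + - M 0 1 * v) (- M 1 0 * u + M 0 0 * v).
Proof. by rewrite octa_coefE. Qed.

Lemma octa_mx_trans A M B c : (forall u v,
  octa (B 1 1 * u + - B 0 1 * v) (- B 1 0 * u + B 0 0 * v) = c * octa u v) ->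
  forall k, octa_mx (A *m M *m B) k = c * \sum_l subst6 (adjm A) k l * octa_mx M l.
Proof.
move=> H; apply: sextval_inj => u v.
transitivity (c * sextval (fun k => \sum_l subst6 (adjm A) k l * octa_mx M l) u v); last first.
  by rewrite /sextval mulr_sumr; apply: eq_bigr => k _; exact: mulrA.
rewrite sextval_subst6 !sextval_octa_mx -H !mulmx2E !mxE /=.
by congr octa; ring.
Qed.

Lemma ev_cross q g k phi p : ev q (octa_g g k * pull phi p) =
  octa_mx (mat_at g q) k * ev (mat_at phi q) p.
Proof.
exact: etrans (evM _ _ _) (congr2 *%R (ev_octa_g _ _ _) (ev_pull _ _ _)).
Qed.

Lemma unit_nz S q : S \in unitmx -> q != 0 -> S *m q != 0.
Proof. by move=> uS; apply: contra_neq => h; rewrite -(mulKmx uS q) h mulmx0. Qed.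

Lemma curve_eqE m n (F G : 'M[binform R]_(m, n)) : curve_eq F G ->
  exists2 c : K, c != 0 & forall q, mat_at F q = c *: mat_at G q.
Proof. by case=> c c0 ->; exists c => // q; rewrite mat_atZ. Qed.

Lemma subst6_unit N : N \in unitmx -> subst6 N \in unitmx.
Proof.
by move=> uN; exact: (mulmx1_unit (subst6M (mulVmx uN))).1.
Qed.

Lemma full_substF N S (F : 'rV[binform R]_7) : (forall k, F 0 k \is 6.-homog) ->
  N \in unitmx -> S \in unitmx -> linearly_full F -> linearly_full (substF N S F).
Proof.
move=> hF uN uS LF c H.
have E : (subst6 N)^T *m c = 0.
  apply: LF; apply/matrixP => i j; rewrite !ord1 !mxE {i j}.
  have hs : \sum_k F 0 k * const_form ((subst6 N)^T *m c) k 0 \is 6.-homog.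
    by apply: rpred_sum => k _; rewrite mxE; eapply hom_eq; [apply: homM; [exact: hF|exact: homC]|].
  apply: (form_ext hs) => q q0.
  have := congr1 (fun m : 'M_1 => ev (invmx S *m q) (m 0 0)) H.
  rewrite !mxE !ev_sum ev0 => Hq; rewrite -[RHS]Hq.
  transitivity (\sum_k \sum_l ev q (F 0 k) * (subst6 N l k * c l 0)).
    apply: eq_bigr => k _; rewrite evM mxE evC mxE mulr_sumr.
    by apply: eq_bigr => l _; rewrite mxE.
  rewrite exchange_big; apply: eq_bigr => l _ /=.
  rewrite evM ev_substF [const_form _ _ _]mxE evC mulKVmx // mulr_suml.
  apply: eq_bigr => k _; rewrite mulrCA mulrA; congr (_ * _).
have uT : (subst6 N)^T \in unitmx by rewrite unitmx_tr subst6_unit.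
by rewrite -(mulKmx uT c) E mulmx0.
Qed.

(** Moebius transformations of both lines, the action of A on P(V_6) and right
    multiplication by the stabilizer of the octahedral form transform lifts into lifts. As
    tangency to the one-dimensional orbit is preserved, the two families can be told apart
    on the normal forms. *)
Lemma lift_transport phi n (F : 'rV[binform R]_7) (g : 'M[binform R]_2) mu nu A B :
  octa_lift phi n F g -> normalizes phi mu nu ->
  A \in unitmx -> B \in unitmx -> octa_stab B ->
  exists F', octa_lift (phi0 R) n F' (const_form A *m precomp g mu *m const_form B) /\
    (tangent6 F <-> tangent6 F').
Proof.
move=> L [umu unu] /curve_eqE[c c0 Hc] uA uB [b b0 Hb].
pose S := c *: invmx nu.
have uS : S \in unitmx by rewrite unitmxZ ?unitfE // unitmx_inv.
have Sphi q : S *m mat_at (phi0 R) q = mat_at phi (mu *m q).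
  rewrite -scalemxAl scalemxAr -Hc /postcomp mat_atM mat_at_const mat_at_precomp.
  by rewrite mulKmx.
have uN := adjm_unit uA.
set g' := _ *m _ *m _.
have mg q : mat_at g' q = A *m mat_at g (mu *m q) *m B.
  by rewrite /g' !mat_atM !mat_at_const mat_at_precomp.
have hg i j : g' i j \is n.-homog.
  rewrite /g' mulmx2E !mulmx2E; have H k l : precomp g mu k l \is n.-homog.
    by rewrite mxE; apply: lin_subst_homog; exact: (lift_g L).
  by rewrite ![const_form _ _ _]mxE; hmgd.
exists (substF (adjm A) S F); split; last first.
  split; first exact: (tangent6_substF (lift_F L)).
  have hF' := substF_homog (adjm A) S _ (lift_F L).
  move/(tangent6_substF (N := invmx (adjm A)) (S := invmx S) hF').
  rewrite (substFK (lift_F L)) ?mulmxV //; apply; by rewrite unitmx_inv.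
split.
- by move=> k; apply: substF_homog; exact: lift_F L.
- move=> q q0; have [k hk] := lift_Fz L (unit_nz uS q0).
  have hs : \sum_l (invmx (subst6 (adjm A))) k l * ev q (substF (adjm A) S F 0 l) != 0.
    rewrite (_ : \sum_l _ = ev (S *m q) (F 0 k)) //.
    under eq_bigr => l _ do rewrite ev_substF mulr_sumr.
    rewrite exchange_big /=.
    transitivity (\sum_l (1%:M : 'M[K]_7) k l * ev (S *m q) (F 0 l)).
      apply: eq_bigr => l _; rewrite -(mulVmx (subst6_unit uN)) mxE mulr_suml.
      by apply: eq_bigr => j _; rewrite mulrA.
    rewrite (bigD1 k) //= mxE eqxx mul1r big1 ?addr0 // => l lk.
    by rewrite mxE eq_sym (negbTE lk) mul0r.
  apply/existsP; apply: contraT; rewrite negb_exists => /forallP h.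
  case/eqP: hs; apply: big1 => l _; have := h l; rewrite negbK => /eqP ->; exact: mulr0.
- exact: (full_substF (lift_F L) uN uS (lift_full L)).
- exact: hg.
- move=> q q0; have [[i j] hij] := lift_gz L (unit_nz umu q0).
  suff [[k l] hkl] : exists kl, mat_at g' q kl.1 kl.2 != 0 by exists (k, l); rewrite mxE in hkl.
  apply/existsP; apply: contraT; rewrite negb_exists => /forallP h.
  have : mat_at g' q = 0.
    by apply/matrixP=> k l; have := h (k, l); rewrite negbK mxE [RHS]mxE => /eqP.
  rewrite mg => /(congr1 (fun m => invmx A *m m *m invmx B)).
  rewrite mulmx0 mul0mx !mulmxA mulVmx // mul1mx mulmxK // => /(congr1 (fun m : 'M_2 => m i j)).
  by rewrite [LHS]mxE [RHS]mxE; move/eqP: hij.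
- have [q q0 dq] := form_nz (det_homog (lift_g L)) (lift_det L).
  suff : \det (mat_at g' (invmx mu *m q)) != 0.
    by apply: contra_neq => h; rewrite -ev_det h ev0.
  rewrite mg mulKVmx // !det_mulmx -ev_det !mulf_eq0 !negb_or dq.
  by rewrite -!unitfE -!unitmxE uA uB.
move=> k l.
have hk (i j : 'I_7) : octa_g g' i * pull (phi0 R) (substF (adjm A) S F 0 j) \is (n * 6 + 4 * 6).-homog.
  apply: homM; first exact: octa_g_homog.
  by apply: pull_phi0_homog; apply: substF_homog; exact: lift_F L.
apply: form_eq (hk k l) (hk l k) _ => u v; rewrite [LHS]ev_cross [RHS]ev_cross.
set q := mu *m pt u v.
have Eg k' : octa_mx (mat_at g' (pt u v)) k' =
   b * \sum_m subst6 (adjm A) k' m * octa_mx (mat_at g q) m.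
  by rewrite mg (octa_mx_trans _ _ Hb).
have EF l' : ev (mat_at (phi0 R) (pt u v)) (substF (adjm A) S F 0 l') =
   \sum_m subst6 (adjm A) l' m * ev (mat_at phi q) (F 0 m).
  by rewrite ev_substF Sphi.
have X m m' : octa_mx (mat_at g q) m' * ev (mat_at phi q) (F 0 m) =
    octa_mx (mat_at g q) m * ev (mat_at phi q) (F 0 m').
  exact: etrans (esym (ev_cross _ _ _ _ _)) (etrans (congr1 (ev q) (lift_cross L m' m)) (ev_cross _ _ _ _ _)).
rewrite !Eg !EF -!mulrA; congr (b * _).
move: (octa_mx _) (fun m => ev (mat_at phi q) (F 0 m)) X (subst6 _) => f G X T.
rewrite !mulr_suml.
under eq_bigr => m _ do rewrite mulr_sumr.
under [RHS]eq_bigr => m _ do rewrite mulr_sumr.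
rewrite exchange_big; apply: eq_bigr => m _; apply: eq_bigr => m' _ /=.
have aux (x y s t s' t' : K) : s' * t' = s * t -> x * s' * (y * t') = y * s * (x * t).
  by move=> e; rewrite mulrACA e [x * y]mulrC mulrACA.
exact: aux.
Qed.

Lemma curve4_homog phi : is_curve 4 phi -> forall i, (phi : 'cV[binform R]_2) i 0 \is 4.-homog.
Proof. by case=> h _ i; exact: h. Qed.

Lemma f1_octa_mx (M : 'M[K]_2) : f1 M != 0 <-> exists k, octa_mx M k != 0.
Proof.
rewrite f1E; split=> [h|[k hk]].
  apply/existsP; apply: contraT; rewrite negb_exists => /forallP H; case/eqP: h.
  by rewrite /sextic_of big1 // => k _; have := H k; rewrite negbK => /eqP->; rewrite scale0r.
by apply: contra_neq hk => h; rewrite -[LHS]sextic_coordE h /sextic_coord mcoeff0.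
Qed.

(** Where f_1 o g = 0 the minors vanish for trivial reasons, elsewhere by hypothesis. *)
Lemma lift_of_galois phi n F (g : 'M[binform R]_2) :
  is_curve 4 phi -> sextic_curve F -> is_curve n g -> galois_lift phi F g ->
  octa_lift phi n F g.
Proof.
move=> cphi [cF LF _ _] cg [dg H _]; split.
- by move=> k; case: cF => h _; exact: h.
- by move=> q q0; have [[i k] hk] := curve_nz cF q0; rewrite ord1 in hk; exists k.
- exact: LF.
- by case: cg.
- by move=> q q0; have [ij hij] := curve_nz cg q0; exists ij.
- exact: dg.
move=> k l.
have hF : forall k, F 0 k \is 6.-homog by case: cF => h _ k'; exact: h.
have hg : forall i j, g i j \is n.-homog by case: cg.
have hk (i j : 'I_7) : octa_g g i * pull phi (F 0 j) \is (n * 6 + 4 * 6).-homog.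
  apply: homM; first exact: octa_g_homog.
  by apply: pull_homog => //; exact: curve4_homog.
apply/eqP; rewrite -subr_eq0; apply/eqP; apply: (form_ext (homB (hk k l) (hk l k))) => q q0.
rewrite evB [X in X - _]ev_cross [X in _ - X]ev_cross.
have [f0|f0] := eqVneq (f1 (mat_at g q)) 0.
  have Z j : octa_mx (mat_at g q) j = 0.
    by rewrite -sextic_coordE -f1E f0 /sextic_coord mcoeff0.
  by rewrite !Z !mul0r subrr.
have [c c0 E] := H q q0 f0.
have {}E j : octa_mx (mat_at g q) j = c * ev (mat_at phi q) (F 0 j).
  rewrite -[LHS]sextic_coordE -f1E E /sextic_coord mcoeffZ; congr (_ * _).
  exact: sextic_coordE.
by rewrite !E mulrAC subrr.
Qed.

End LiftTransport.

(** * The octahedral group *)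

Section Octahedral.
Variable R : realType.
Notation K := R[i].
Implicit Types (N S A B M : 'M[K]_2) (e d : K).
Notation xi := (@xi1 R).

Lemma eqmx2 (T : Type) (A B : 'M[T]_2) : A 0 0 = B 0 0 -> A 0 1 = B 0 1 ->
  A 1 0 = B 1 0 -> A 1 1 = B 1 1 -> A = B.
Proof.
move=> h1 h2 h3 h4; apply/matrixP => i j.
by case: (ord2P i) => ->; case: (ord2P j) => ->.
Qed.

Definition mx22 (T : nmodType) (a b c d : T) : 'M[T]_2 := mx_of_rows 2 2 [:: [:: a; b]; [:: c; d]].
Lemma mx22E (T : nmodType) (a b c d : T) :
  ((mx22 a b c d 0 0 = a) * (mx22 a b c d 0 1 = b) * (mx22 a b c d 1 0 = c) * (mx22 a b c d 1 1 = d))%type.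
Proof. by rewrite /mx22 /mx_of_rows !mxE. Qed.

Lemma mx22_eta (T : nmodType) (A : 'M[T]_2) : A = mx22 (A 0 0) (A 0 1) (A 1 0) (A 1 1).
Proof. by apply: eqmx2; rewrite mx22E. Qed.

Lemma mul_mx22 (T : comNzRingType) (a b c d a' b' c' d' : T) :
  mx22 a b c d *m mx22 a' b' c' d' =
  mx22 (a * a' + b * c') (a * b' + b * d') (c * a' + d * c') (c * b' + d * d').
Proof. by apply: eqmx2; rewrite mulmx2E !mx22E. Qed.

Lemma scale_mx22 (T : comNzRingType) (k a b c d : T) :
  k *: mx22 a b c d = mx22 (k * a) (k * b) (k * c) (k * d).
Proof. by apply: eqmx2; rewrite [LHS]mxE !mx22E. Qed.

Lemma tr_mx22 (T : nmodType) (a b c d : T) : (mx22 a b c d)^T = mx22 a c b d.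
Proof. by apply: eqmx2; rewrite [LHS]mxE !mx22E. Qed.

Lemma det_mx22 (T : comNzRingType) (a b c d : T) : \det (mx22 a b c d) = a * d - b * c.
Proof. by rewrite det2 !mx22E. Qed.

Lemma scalar_mx22 (a : K) : a%:M = mx22 a 0 0 a.
Proof. by apply: eqmx2; rewrite [LHS]mxE !mx22E. Qed.

Lemma unit_det (A : 'M[K]_2) : (A \in unitmx) = (\det A != 0).
Proof. by rewrite unitmxE unitfE. Qed.

Lemma cexpiD (x y : R) : cexpi (x + y) = cexpi x * cexpi y.
Proof.
rewrite /cexpi trigo.cosD trigo.sinD; apply/eqP; rewrite eq_complex /=.
by rewrite !eqxx /= [X in X == _]addrC eqxx.
Qed.

Lemma cexpi0 : cexpi (0 : R) = 1.
Proof. by rewrite /cexpi trigo.cos0 trigo.sin0. Qed.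

Lemma xi4 : xi ^+ 4 = -1.
Proof.
rewrite /xi1 !exprS expr0 mulr1 -!cexpiD.
have -> : trigo.pi / 4 + (trigo.pi / 4 + (trigo.pi / 4 + trigo.pi / 4)) = trigo.pi :> R by field.
by rewrite /cexpi trigo.cospi trigo.sinpi; apply/eqP; rewrite eq_complex /= oppr0 !eqxx.
Qed.

Lemma xi_neq0 : xi != 0.
Proof. by apply/eqP => h; have /eqP := xi4; rewrite h expr0n eq_sym oppr_eq0 oner_eq0. Qed.

Lemma cexpiN : cexpi (- (trigo.pi / 4)) = xi^-1.
Proof.
by apply: (mulfI xi_neq0); rewrite mulfV ?xi_neq0 // /xi1 -cexpiD subrr cexpi0.
Qed.

Lemma octa_stab_mx22 a b c d : octa_stab (mx22 a b c d : 'M[K]_2) <-> exists2 k : K, k != 0 & forall u v,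
  octa (d * u - b * v) (a * v - c * u) = k * octa u v.
Proof.
split=> -[k k0 H]; exists k => // u v; have := H u v; rewrite !mx22E.
  by rewrite mulNr mulNr [- _ + _]addrC.
by rewrite mulNr mulNr [- _ + _]addrC.
Qed.

Lemma octa_stab_mul A B : octa_stab A -> octa_stab B -> octa_stab (A *m B).
Proof.
rewrite (mx22_eta A) (mx22_eta B) mul_mx22 !octa_stab_mx22 => -[k k0 H] [l l0 H'].
exists (k * l); first by rewrite mulf_neq0.
move=> u v; rewrite -mulrA mulrCA -H -H'; congr octa; ring.
Qed.

Lemma octa_stab_scale k A : k != 0 -> octa_stab A -> octa_stab (k *: A).
Proof.
move=> k0; rewrite (mx22_eta A) scale_mx22 !octa_stab_mx22 => -[l l0 H].
exists (k ^+ 6 * l); first by rewrite mulf_neq0 // expf_neq0.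
move=> u v; rewrite -mulrA -H /octa; ring.
Qed.

Lemma invmx22 A : A \in unitmx ->
  invmx A = (\det A)^-1 *: mx22 (A 1 1) (- A 0 1) (- A 1 0) (A 0 0).
Proof.
move=> uA; have dA : \det A != 0 by rewrite -unit_det.
have E : A *m ((\det A)^-1 *: mx22 (A 1 1) (- A 0 1) (- A 1 0) (A 0 0)) = 1%:M.
  rewrite -scalemxAr {2}(mx22_eta A) mul_mx22 scale_mx22 scalar_mx22; congr mx22.
  - by apply: (mulfI dA); rewrite mulrA mulfV // mul1r mulr1 det2; ring.
  - by rewrite (_ : _ + _ = 0) ?mulr0 //; ring.
  - by rewrite (_ : _ + _ = 0) ?mulr0 //; ring.
  - by apply: (mulfI dA); rewrite mulrA mulfV // mul1r mulr1 det2; ring.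
by rewrite -[LHS]mulmx1 -E mulmxA mulVmx // mul1mx.
Qed.

Lemma octa_stab_inv A : A \in unitmx -> octa_stab A -> octa_stab (invmx A).
Proof.
move=> uA; have dA : \det A != 0 by rewrite -unit_det.
rewrite {1}(mx22_eta A) octa_stab_mx22 => -[k k0 H].
rewrite invmx22 //; apply: octa_stab_scale; first by rewrite invr_eq0.
rewrite octa_stab_mx22; exists (\det A ^+ 6 / k).
  by rewrite mulf_neq0 ?invr_eq0 // expf_neq0.
move=> u v; apply: (mulfI k0); rewrite [RHS]mulrA [k * (_ / _)]mulrC divfK //.
transitivity (k * octa (A 0 0 * u + A 0 1 * v) (A 1 0 * u + A 1 1 * v)).
  by congr (_ * octa _ _); ring.
rewrite -H det2 /octa; ring.
Qed.

(** Up to scalars the octahedral group consists of the 24 matrices [Dm e], [Am e] and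
    [Mm e d] with e^4 = d^4 = 1. *)
Definition Dm e : 'M[K]_2 := mx22 1 0 0 e.
Definition Am e : 'M[K]_2 := mx22 0 1 e 0.
Definition Mm e d : 'M[K]_2 := mx22 1 d e (- e * d).

(** The group generated by the transposes of S_4^* and the scalars. The transposes appear
    because B acts as B^T on the right of g. *)
Definition octm B := exists2 k : K, k != 0 & exists2 B' : 'M[K]_2, S4star B' & B = k *: B'^T.

Lemma S4star_stab B : S4star B -> B^T \in unitmx /\ octa_stab B^T.
Proof.
elim=> {B} [|||A B _ [uA hA] _ [uB hB]|A _ [uA hA]].
- rewrite tr_scalar_mx unitmx1; split=> //; rewrite scalar_mx22 octa_stab_mx22.
  by exists 1; [exact: oner_neq0|move=> u v; rewrite /octa; ring].
- rewrite cexpiN -/(mx22 _ _ _ _) -/xi1 tr_mx22 unit_det det_mx22 mulr0 subr0 mulfV ?xi_neq0 //.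
  split; first exact: oner_neq0.
  rewrite octa_stab_mx22; exists (-1); first by rewrite oppr_eq0 oner_neq0.
  move=> u v; rewrite !mul0r subr0 subr0.
  have h := xi4; have xn := xi_neq0.
  have hi : (xi^-1) ^+ 4 = -1 by rewrite exprVn h invrN1.
  rewrite /octa !exprMn h hi mulrACA mulVf // mul1r; ring.
- set s := (_)%:C; rewrite -/(mx22 _ _ _ _) linearZ /= tr_mx22.
  have s2 : s ^+ 2 = 2^-1.
    rewrite /s -rmorphXn /= exprVn sqr_sqrtr ?ler0n // fmorphV rmorph_nat //.
  have s0 : s != 0.
    apply/eqP => h; move/eqP: s2; rewrite h expr0n /= eq_sym invr_eq0 pnatr_eq0 //.
  split.
    rewrite unitmxZ ?unitfE // unit_det det_mx22.
    by rewrite (_ : 1 * 1 - 1 * (-1) = 2) ?pnatr_eq0 //; ring.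
  apply: octa_stab_scale => //; rewrite octa_stab_mx22; exists (- 8).
    by rewrite oppr_eq0 pnatr_eq0.
  move=> u v; rewrite /octa; ring.
- rewrite trmx_mul unitmx_mul uA uB; split=> //; exact: octa_stab_mul.
by rewrite trmx_inv unitmx_inv uA; split=> //; exact: octa_stab_inv.
Qed.

Lemma octm_unit B : octm B -> B \in unitmx.
Proof. by case=> k k0 [B' /S4star_stab[u _] ->]; rewrite unitmxZ ?unitfE. Qed.

Lemma octm_stab B : octm B -> octa_stab B.
Proof. by case=> k k0 [B' /S4star_stab[_ h] ->]; exact: octa_stab_scale. Qed.

Lemma octm_mul A B : octm A -> octm B -> octm (A *m B).
Proof.
case=> k k0 [A' hA ->] [l l0 [B' hB ->]]; exists (k * l); first by rewrite mulf_neq0.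
exists (B' *m A'); first exact: S4star_mul.
by rewrite trmx_mul -scalemxAl -scalemxAr scalerA.
Qed.

Lemma octm_scale k B : k != 0 -> octm B -> octm (k *: B).
Proof.
move=> k0 [l l0 [B' hB ->]]; exists (k * l); first by rewrite mulf_neq0.
by exists B' => //; rewrite scalerA.
Qed.

Lemma octm1 : octm 1%:M.
Proof.
exists 1; first exact: oner_neq0.
by exists 1%:M; [exact: S4star_one|rewrite trmx1 scale1r].
Qed.

Lemma octm_D0 : octm (Dm (- xi ^+ 2)).
Proof.
exists (xi^-1); first by rewrite invr_eq0 xi_neq0.
exists (mx_of_rows 2 2 [:: [:: cexpi (trigo.pi / 4); 0]; [:: 0; cexpi (- (trigo.pi / 4))]]).
  exact: S4star_diag.
rewrite cexpiN -/xi1 -/(mx22 _ _ _ _) tr_mx22 scale_mx22 /Dm.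
rewrite mulVf ?xi_neq0 // !mulr0; congr mx22.
apply: (mulfI (expf_neq0 2 xi_neq0)); rewrite expr2 mulrACA mulfV ?xi_neq0 // mulr1.
by rewrite -expr2 mulrN -exprD xi4 opprK.
Qed.

Lemma Dm_mul e d : Dm e *m Dm d = Dm (e * d).
Proof. rewrite mul_mx22 /Dm; congr mx22; ring. Qed.

Lemma mu4P e : e ^+ 4 = 1 -> [\/ e = 1, e = -1, e = xi ^+ 2 | e = - xi ^+ 2].
Proof.
move=> h; have : (e - 1) * (e + 1) * (e - xi ^+ 2) * (e + xi ^+ 2) = 0.
  transitivity (e ^+ 4 - 1 - (e ^+ 2 - 1) * (xi ^+ 4 + 1)); first by ring.
  by rewrite h xi4 addNr mulr0 !subrr.
move/eqP; rewrite !mulf_eq0 !subr_eq0 !addr_eq0 => /orP[/orP[/orP[]|]|] /eqP ->.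
- exact: Or41.
- exact: Or42.
- exact: Or43.
exact: Or44.
Qed.

Lemma octm_D e : e ^+ 4 = 1 -> octm (Dm e).
Proof.
have h := xi4.
have h1 := octm_mul octm_D0 octm_D0; rewrite Dm_mul in h1.
have e1 : - xi ^+ 2 * - xi ^+ 2 = -1 by rewrite -h; ring.
rewrite e1 in h1.
case/mu4P=> ->.
- by have := octm_mul h1 h1; rewrite Dm_mul mulrNN mulr1.
- exact: h1.
- by have := octm_mul h1 octm_D0; rewrite Dm_mul mulN1r opprK.
exact: octm_D0.
Qed.

Lemma octm_rot : octm (Mm (-1) 1).
Proof.
pose s : K := (Num.sqrt (2 : R))^-1%:C.
have s0 : s != 0.
  by rewrite /s fmorph_eq0 invr_eq0 sqrtr_eq0 -ltNge ltr0n.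
exists s^-1; first by rewrite invr_eq0.
exists ((Num.sqrt (2 : R))^-1%:C *: mx_of_rows 2 2 [:: [:: 1; -1]; [:: 1; 1]]).
  exact: S4star_rot.
rewrite -/s -/(mx22 _ _ _ _) linearZ /= tr_mx22 scalerA mulVf // scale1r /Mm; congr mx22.
by rewrite opprK mulr1.
Qed.

Lemma octm_M11 : octm (Mm 1 1).
Proof.
have N1 : (-1 : K) ^+ 4 = 1 by ring.
have := octm_mul (octm_D N1) octm_rot; rewrite mul_mx22 /Mm.
by congr octm; congr mx22; ring.
Qed.

Lemma octm_Mi1 : octm (Mm (xi ^+ 2) 1).
Proof.
have := octm_mul octm_D0 octm_rot; rewrite mul_mx22 /Mm.
by congr octm; congr mx22; ring.
Qed.

Lemma octm_A : octm (Am (-1)).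
Proof.
have h2 : (2^-1 : K) != 0 by rewrite invr_eq0 pnatr_eq0.
have := octm_scale h2 (octm_mul octm_rot octm_rot); rewrite mul_mx22 scale_mx22 /Am.
by congr octm; congr mx22; field.
Qed.

Definition octa_types B := exists2 k : K, k != 0 & exists e d : K,
  [/\ e ^+ 4 = 1, d ^+ 4 = 1 & [\/ B = k *: Dm e, B = k *: Am e | B = k *: Mm e d]].

(** Comparing the coefficients of u^6, u^5 v, u^4 v^2 and u v^5. If r = 0 or p = 0 the matrix
    is monomial; otherwise p^4 = r^4 and (p q)^2 = (r s)^2, which with p s - q r != 0
    gives p s + q r = 0. *)
Lemma octa_classify p q r s c : p * s - q * r != 0 ->
  (forall u v, octa (p * u + q * v) (r * u + s * v) = c * octa u v) ->
  octa_types (mx22 p q r s).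
Proof.
move=> det H.
have E : (fun k : 'I_7 => octa_coef k p q r s) =1 (fun k : 'I_7 => c * octa_coef k 1 0 0 1).
  apply: sextval_inj => u v; rewrite /sextval -octa_coefE H.
  transitivity (c * octa (1 * u + 0 * v) (0 * u + 1 * v)); first by congr (_ * octa _ _); ring.
  by rewrite octa_coefE mulr_sumr; apply: eq_bigr => k _; exact: mulrA.
have E0 := E (inord 0); have E1 := E (inord 1); have E2 := E (inord 2); have E5 := E (inord 5).
rewrite !inordK //= in E0 E1 E2 E5.
have [r0|rn0] := eqVneq r 0.
- have pn0 : p != 0 by apply: contra_neq det => ->; rewrite r0 mul0r mulr0 subrr.
  have sn0 : s != 0 by apply: contra_neq det => ->; rewrite r0 mulr0 mulr0 subrr.
  have q0 : q = 0.
    have nz : 5 * p ^+ 4 * s != 0 by rewrite !mulf_neq0 ?expf_neq0 // pnatr_eq0.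
    apply: (mulfI nz); transitivity (octa_coef 2 p q r s); first by rewrite /= r0; ring.
    by rewrite /= E2; ring.
  exists p => //; exists (s / p), 1; rewrite expr1n; split=> //.
    rewrite expr_div_n; apply: (mulIf (expf_neq0 4 pn0)); rewrite divfK ?expf_neq0 // mul1r.
    apply: (mulfI (mulf_neq0 pn0 sn0)); apply/eqP; rewrite -subr_eq0 -oppr_eq0; apply/eqP.
    transitivity ((p ^+ 5 * s - c) + (q ^+ 5 * r + 5 * p * q ^+ 4 * s - s ^+ 5 * p - 5 * r * s ^+ 4 * q + c)).
      by rewrite q0 r0; ring.
    rewrite E5 (_ : p ^+ 5 * s = c); first by ring.
    transitivity (octa_coef 1 p q r s); first by rewrite /= q0 r0; ring.
    by rewrite /= E1; ring.
  apply: Or31; rewrite /Dm scale_mx22 !mulr0 mulr1 r0 q0; congr mx22.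
  by rewrite mulrC divfK.
have [p0|pn0] := eqVneq p 0.
- have qn0 : q != 0 by apply: contra_neq det => ->; rewrite p0 !mul0r subrr.
  have s0 : s = 0.
    have nz : 5 * r ^+ 4 * q != 0 by rewrite !mulf_neq0 ?expf_neq0 // pnatr_eq0.
    apply: (mulfI nz); transitivity (- octa_coef 2 p q r s); first by rewrite /= p0; ring.
    by rewrite /= E2; ring.
  exists q => //; exists (r / q), 1; rewrite expr1n; split=> //.
    rewrite expr_div_n; apply: (mulIf (expf_neq0 4 qn0)); rewrite divfK ?expf_neq0 // mul1r.
    apply: (mulfI (mulf_neq0 qn0 rn0)); apply/eqP; rewrite -subr_eq0 -oppr_eq0; apply/eqP.
    transitivity ((q ^+ 5 * r + 5 * p * q ^+ 4 * s - s ^+ 5 * p - 5 * r * s ^+ 4 * q + c) +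
       (5 * p ^+ 4 * q * r + p ^+ 5 * s - 5 * r ^+ 4 * s * p - r ^+ 5 * q - c)).
      by rewrite p0 s0; ring.
    by rewrite E5 E1; ring.
  apply: Or32; rewrite /Am scale_mx22 !mulr0 mulr1 p0 s0; congr mx22.
  by rewrite mulrC divfK.
have pr4 : p ^+ 4 = r ^+ 4.
  apply: (mulfI (mulf_neq0 pn0 rn0)); apply/eqP; rewrite -subr_eq0; apply/eqP.
  transitivity (p ^+ 5 * r - p * r ^+ 5); first by ring.
  by rewrite E0; ring.
have pqrs : (p * q) ^+ 2 = (r * s) ^+ 2.
  have ten : (10 : K) != 0 by rewrite pnatr_eq0.
  apply: (mulfI (mulf_neq0 ten (mulf_neq0 pn0 rn0))); apply/eqP; rewrite -subr_eq0; apply/eqP.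
  transitivity ((10 * p ^+ 3 * q ^+ 2 * r + 5 * p ^+ 4 * q * s - 10 * r ^+ 3 * s ^+ 2 * p
      - 5 * r ^+ 4 * s * q) - 5 * q * s * (p ^+ 4 - r ^+ 4)); first by ring.
  by rewrite E2 pr4; ring.
have key : r * q = - (p * s).
  have h1 : (p ^+ 2 - r ^+ 2) * (p ^+ 2 + r ^+ 2) = 0.
    by transitivity (p ^+ 4 - r ^+ 4); [ring|rewrite pr4 subrr].
  have h2 : (p * q - r * s) * (p * q + r * s) = 0.
    by transitivity ((p * q) ^+ 2 - (r * s) ^+ 2); [ring|rewrite pqrs subrr].
  have h3 : (r * q + p * s) * (p * s - q * r) = 0.
    apply: (mulfI (mulf_neq0 pn0 pn0)); rewrite mulr0.
    move/eqP: h1; rewrite mulf_eq0 => /orP[|] /eqP e1; move/eqP: h2; rewrite mulf_eq0 => /orP[|] /eqP e2.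
    - case/negP: det; apply/eqP; apply: (mulfI pn0); rewrite mulr0.
      transitivity (s * (p ^+ 2 - r ^+ 2) - r * (p * q - r * s)); first by ring.
      by rewrite e1 e2; ring.
    - transitivity (p * (p * s - q * r) * (s * (p ^+ 2 - r ^+ 2) + r * (p * q + r * s))); first by ring.
      by rewrite e1 e2; ring.
    - transitivity (p * (p * s - q * r) * (s * (p ^+ 2 + r ^+ 2) + r * (p * q - r * s))); first by ring.
      by rewrite e1 e2; ring.
    - case/negP: det; apply/eqP; apply: (mulfI pn0); rewrite mulr0.
      transitivity (s * (p ^+ 2 + r ^+ 2) - r * (p * q + r * s)); first by ring.
      by rewrite e1 e2; ring.
  by move/eqP: h3; rewrite mulf_eq0 (negbTE det) orbF addr_eq0 => /eqP.
have sE : s = - (r / p) * q.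
  by apply: (mulfI pn0); rewrite mulNr mulrN mulrA [p * (r / p)]mulrC divfK // key opprK.
exists p => //; exists (r / p), (q / p).
have rp4 : (r / p) ^+ 4 = 1 by rewrite expr_div_n -pr4 mulfV // expf_neq0.
split=> //; last first.
  apply: Or33; rewrite /Mm scale_mx22 mulr1; congr mx22.
  + by rewrite mulrC divfK.
  + by rewrite mulrC divfK.
  by rewrite sE mulrCA; congr (_ * _); rewrite mulrC divfK.
have s4 : s ^+ 4 = q ^+ 4.
  by transitivity ((r / p) ^+ 4 * q ^+ 4); [rewrite sE; ring|rewrite rp4 mul1r].
rewrite expr_div_n; apply: (mulIf (expf_neq0 4 pn0)); rewrite divfK ?expf_neq0 // mul1r.
have four : (4 : K) != 0 by rewrite pnatr_eq0.
apply: (mulfI (mulf_neq0 four det)); apply/eqP; rewrite -subr_eq0; apply/eqP.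
transitivity ((q ^+ 5 * r + 5 * p * q ^+ 4 * s - s ^+ 5 * p - 5 * r * s ^+ 4 * q + c)
  + (5 * p ^+ 4 * q * r + p ^+ 5 * s - 5 * r ^+ 4 * s * p - r ^+ 5 * q - c)
  + (s ^+ 4 - q ^+ 4) * (s * p + 5 * r * q) + (r ^+ 4 - p ^+ 4) * (5 * s * p + r * q)); first by ring.
by rewrite E5 E1 s4 pr4; ring.
Qed.

End Octahedral.

(** * Equivariance of a lift *)

Section Equivariance.
Variable R : realType.
Notation K := R[i].
Implicit Types (q : 'cV[K]_2) (N S A B M : 'M[K]_2) (e d : K).
Notation xi := (@xi1 R).

Definition mu4 : seq K := [:: 1; -1; xi ^+ 2; - xi ^+ 2].
Lemma mem_mu4 e : e ^+ 4 = 1 -> e \in mu4.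
Proof. by rewrite !inE => /mu4P[] ->; rewrite eqxx ?orbT. Qed.

Definition octa_list : seq 'M[K]_2 :=
  [seq Dm e | e <- mu4] ++ [seq Am e | e <- mu4] ++ [seq Mm e d | e <- mu4, d <- mu4].

Lemma mu4_pow e : e \in mu4 -> e ^+ 4 = 1.
Proof.
have h := @xi4 R; rewrite !inE => /or4P[] /eqP ->.
- by rewrite expr1n.
- by ring.
- by transitivity ((xi ^+ 4) ^+ 2); [ring|rewrite h; ring].
by transitivity ((xi ^+ 4) ^+ 2); [ring|rewrite h; ring].
Qed.

Lemma octa_types_list B : octa_types B -> exists2 k, k != 0 & exists2 B', B' \in octa_list & B = k *: B'.
Proof.
case=> k k0 [e [d [/mem_mu4 he /mem_mu4 hd H]]]; exists k => //.
case: H => ->; [exists (Dm e)|exists (Am e)|exists (Mm e d)] => //; rewrite 2!mem_cat.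
- by apply/orP; left; apply: map_f.
- by apply/orP; right; apply/orP; left; apply: map_f.
by apply/orP; right; apply/orP; right; apply/allpairsP; exists (e, d).
Qed.

Lemma octa_list_types B k : B \in octa_list -> k != 0 -> octa_types (k *: B).
Proof.
have one4 : (1 : K) ^+ 4 = 1 by exact: expr1n.
move=> hB k0; exists k => //; move: hB; rewrite 2!mem_cat.
case/orP => [/mapP[e /mu4_pow he ->]|/orP[/mapP[e /mu4_pow he ->]|]].
- by exists e, 1; split=> //; apply: Or31.
- by exists e, 1; split=> //; apply: Or32.
case/allpairsP=> -[e d] /= [/mu4_pow he /mu4_pow hd ->].
by exists e, d; split=> //; apply: Or33.
Qed.

Lemma octa_list_unit B : B \in octa_list -> B \in unitmx.
Proof.
have nz e : e ^+ 4 = 1 -> e != 0.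
  by move=> h; apply/eqP => e0; move/eqP: h; rewrite e0 expr0n /= eq_sym oner_eq0.
rewrite 2!mem_cat unit_det.
case/orP => [/mapP[e /mu4_pow/nz he ->]|/orP[/mapP[e /mu4_pow/nz he ->]|]].
- by rewrite det_mx22 mul1r mulr0 subr0.
- by rewrite det_mx22 mul1r mulr0 sub0r oppr_eq0.
case/allpairsP=> -[e d] /= [/mu4_pow/nz he /mu4_pow/nz hd ->].
rewrite det_mx22 (_ : _ - _ = - 2 * e * d); last by ring.
by rewrite !mulf_neq0 // oppr_eq0 pnatr_eq0.
Qed.

(** If for each B in a finite list the points with property P B lie on the zeros of a
    nonzero form, then a single nonzero form vanishes on all of them. *)
Lemma finite_form (P : 'M[K]_2 -> 'cV[K]_2 -> Prop) (s : seq 'M[K]_2) :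
  (forall B, B \in s -> exists n (p : binform R), [/\ p \is n.-homog, p != 0 &
     forall q, P B q -> ev q p = 0]) ->
  exists n (p : binform R), [/\ p \is n.-homog, p != 0 &
     forall B, B \in s -> forall q, P B q -> ev q p = 0].
Proof.
elim: s => [|B s IH] H.
  by exists 0%N, 1; split=> //; [exact: hom1|exact: oner_neq0].
have [n [p [hp p0 Hp]]] := H B (mem_head _ _).
have [|m [r [hr r0 Hr]]] := IH; first by move=> B' hB'; apply: H; rewrite inE hB' orbT.
exists (n + m)%N, (p * r); split; [exact: homM|by rewrite mulf_neq0|].
move=> B'; rewrite inE => /orP[/eqP->|hB'] q hq; rewrite evM.
  by rewrite (Hp q hq) mul0r.
by rewrite (Hr _ hB' q hq) mulr0.
Qed.

Section Lift.
Variables (n : nat) (F : 'rV[binform R]_7) (g : 'M[binform R]_2).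
Hypothesis L : octa_lift (phi0 R) n F g.

Lemma lift_octa_mx h : (forall k, octa_g g k = h * pull (phi0 R) (F 0 k)) ->
  forall q k, octa_mx (mat_at g q) k = ev q h * ev (mat_at (phi0 R) q) (F 0 k).
Proof.
move=> E q k.
exact: etrans (esym (ev_octa_g _ _ _)) (etrans (congr1 (ev q) (E k)) (etrans (evM _ _ _) (congr1 _ (ev_pull _ _ _)))).
Qed.

(** F o phi takes the same value at q and at S q, so the sextics f_1(g(q)) and f_1(g(S q)) are
    proportional and g(q)^-1 g(S q) is in the stabilizer of the octahedral form. *)
Lemma octa_types_at S c q : (forall q, mat_at (phi0 R) (S *m q) = c *: mat_at (phi0 R) q) ->
  c != 0 -> \det (mat_at g q) != 0 -> \det (mat_at g (S *m q)) != 0 ->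
  exists2 k, k != 0 & exists2 B, B \in octa_list & mat_at g (S *m q) = k *: (mat_at g q *m B).
Proof.
move=> HS c0 d1 d2; have [_ [h [_ _ E]]] := lift_factor L.
have E1 := lift_octa_mx E q; have E2 := lift_octa_mx E (S *m q).
set G := mat_at g q in d1 E1 *; set G' := mat_at g (S *m q) in d2 E2 *.
have h1 : ev q h != 0.
  by have [k] := octa_mx_nz d1; rewrite E1 mulf_eq0 negb_or => /andP[].
have h2 : ev (S *m q) h != 0.
  by have [k] := octa_mx_nz d2; rewrite E2 mulf_eq0 negb_or => /andP[].
pose kap := ev q h / (ev (S *m q) h * c ^+ 6).
have k0 : kap != 0 by rewrite !mulf_neq0 ?invr_eq0 ?mulf_neq0 ?expf_neq0.
have EG k : octa_mx G k = kap * octa_mx G' k.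
  rewrite E1 E2 HS (form_scale _ _ (lift_F L k)) /kap.
  have aux (x y z t : K) : y != 0 -> z != 0 -> x * t = x / (y * z) * (y * (z * t)).
    by move=> y0 z0; field; rewrite y0 z0.
  by apply: aux; rewrite ?expf_neq0.
have EO u v : octa (G 1 1 * u + - G 0 1 * v) (- G 1 0 * u + G 0 0 * v) =
   kap * octa (G' 1 1 * u + - G' 0 1 * v) (- G' 1 0 * u + G' 0 0 * v).
  by rewrite -!sextval_octa_mx /sextval mulr_sumr; apply: eq_bigr => k _; rewrite EG; exact: esym (mulrA _ _ _).
clear E1 E2 EG; clearbody G G'.
have := @octa_classify R (G 1 1 * G' 0 0 - G 0 1 * G' 1 0) (G 1 1 * G' 0 1 - G 0 1 * G' 1 1)
  (- G 1 0 * G' 0 0 + G 0 0 * G' 1 0) (- G 1 0 * G' 0 1 + G 0 0 * G' 1 1) (kap * \det G' ^+ 6).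
case.
- rewrite (_ : _ - _ = \det G * \det G'); first by rewrite mulf_neq0.
  by rewrite !det2; ring.
- move=> u v.
  transitivity (octa (G 1 1 * (G' 0 0 * u + G' 0 1 * v) + - G 0 1 * (G' 1 0 * u + G' 1 1 * v))
     (- G 1 0 * (G' 0 0 * u + G' 0 1 * v) + G 0 0 * (G' 1 0 * u + G' 1 1 * v))).
    by congr octa; ring.
  by rewrite EO det2 /octa; ring.
move=> k kn0 H.
have /octa_types_list[k' k'0 [B hB EB]] : octa_types (mx22
   (G 1 1 * G' 0 0 - G 0 1 * G' 1 0) (G 1 1 * G' 0 1 - G 0 1 * G' 1 1)
   (- G 1 0 * G' 0 0 + G 0 0 * G' 1 0) (- G 1 0 * G' 0 1 + G 0 0 * G' 1 1)) by exists k.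
exists (k' / \det G); first by rewrite mulf_neq0 ?invr_eq0.
exists B => //; apply: (can_inj (scalerK d1)); rewrite scalerA mulrC divfK //.
rewrite scalemxAr -EB.
by apply: eqmx2; rewrite [LHS]mxE mulmx2E !mx22E det2; ring.
Qed.

(** At each general point g(S q) is a multiple of g(q) B for one of the 24 matrices B, which
    could depend on q. If for no B the curves g o S and g B were equal, each B would occur
    on a finite set only ([finite_form]), but general points are not in a finite set. *)
Lemma equivariant S c : S \in unitmx ->
  (forall q, mat_at (phi0 R) (S *m q) = c *: mat_at (phi0 R) q) -> c != 0 ->
  exists2 B, octa_types B & forall q, mat_at g (S *m q) = mat_at g q *m B.
Proof.
move=> uS HS c0.
pose C : 'M[binform R]_2 := precomp g S; pose G B : 'M[binform R]_2 := g *m const_form B.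
have hC i j : C i j \is n.-homog by rewrite mxE; apply: lin_subst_homog; exact: (lift_g L).
have hG B i j : G B i j \is n.-homog.
  by rewrite mulmx2E ![const_form _ _ _]mxE; have := lift_g L => hg; hmgd.
have eC q i j : ev q (C i j) = mat_at g (S *m q) i j by rewrite -(mat_atE C) mat_at_precomp.
have eG B q i j : ev q (G B i j) = (mat_at g q *m B) i j.
  by rewrite -(mat_atE (G B)) /G mat_atM mat_at_const.
have [[B [hB Hpr]]|nB] := boolp.pselect (exists B, B \in octa_list /\
  forall i j k l, C i j * G B k l = C k l * G B i j); last first.
  exfalso.
  have [|m [p [hp p0 Hp]]] := @finite_form (fun B q => exists k, mat_at g (S *m q) = k *: (mat_at g q *m B)) octa_list.
    move=> B hB.
    have [[[i j] [[k l] ne]]|al] := boolp.pselect (exists ij kl : 'I_2 * 'I_2,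
      C ij.1 ij.2 * G B kl.1 kl.2 - C kl.1 kl.2 * G B ij.1 ij.2 != 0).
      exists (n + n)%N, (C i j * G B k l - C k l * G B i j); split.
      - by apply: homB; apply: homM.
      - exact: ne.
      move=> q [t E]; rewrite evB (evM q (C i j)) (evM q (C k l)) !eC !eG E.
      rewrite [X in X * _ - _]mxE [X in _ - X * _]mxE; ring.
    case: nB; exists B; split=> // i j k l; apply/eqP; rewrite -subr_eq0.
    by apply: contraT => ne; case: al; exists (i, j), (k, l).
  have dC : \det C != 0.
    have [q q0 dq] := form_nz (det_homog (lift_g L)) (lift_det L).
    have : ev (invmx S *m q) (\det C) != 0 by rewrite ev_det mat_at_precomp mulKVmx // -ev_det.
    by apply: contra_neq => ->; rewrite ev0.
  have hD : p * (\det g * \det C) \is (m + ((n + n) + (n + n))).-homog.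
    by apply: homM => //; apply: homM; apply: det_homog => //; exact: (lift_g L).
  have [|q q0] := form_nz hD; first by rewrite !mulf_neq0 // (lift_det L).
  rewrite (evM q p) (evM q (\det g)) !mulf_eq0 !negb_or !ev_det mat_at_precomp => /and3P[pq d1 d2].
  have [k kn0 [B hB E]] := octa_types_at HS c0 d1 d2.
  by case/eqP: pq; apply: (Hp B hB); exists k.
have uB := octa_list_unit hB.
have Gz q : q != 0 -> exists ij : 'I_2 * 'I_2, ev q (G B ij.1 ij.2) != 0.
  move=> q0; have [[i j] hij] := lift_gz L q0.
  apply/existsP; apply: contraT; rewrite negb_exists => /forallP z.
  case/negP: hij; apply/eqP => /=; rewrite -mat_atE.
  have -> : mat_at g q = 0; last by rewrite mxE.
  rewrite -(mulmxK uB (mat_at g q)) (_ : _ *m B = 0) ?mul0mx //.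
  by apply/matrixP => k l; rewrite -eG [RHS]mxE; have /negPn/eqP := z (k, l).
have q1 : pt 1 0 != 0 :> 'cV[K]_2 by rewrite pt_eq0 oner_eq0.
have [[i j] /= hij] := Gz _ q1.
have Gij : G B i j != 0 by apply: contra_neq hij => ->; rewrite ev0.
have Cij : C i j != 0.
  apply/eqP => C0; have [q q0 dq] := form_nz (det_homog (lift_g L)) (lift_det L).
  have : ev (invmx S *m q) (\det C) != 0 by rewrite ev_det mat_at_precomp mulKVmx // -ev_det.
  rewrite det2; suff Z k l : C k l = 0 by rewrite !Z !mul0r subrr ev0 eqxx.
  by apply: (mulIf Gij); rewrite Hpr C0 !mul0r.
have [||_ [r hr Er]] := @form_cancel R ('I_2 * 'I_2)%type (fun kl => G B kl.1 kl.2) n n _ _ (hG B i j) Gij (hC i j) Cij.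
- by move=> [k l]; exists (C k l); rewrite /= Hpr mulrC.
- by move=> q q0 _; exact: Gz.
rewrite subnn in hr; have rE := form0_const hr; set t := r@__ in rE.
have t0 : t != 0.
  by apply: contra_neq Cij => tz; rewrite Er rE tz mpolyC0 mulr0.
exists (t *: B); first exact: octa_list_types.
move=> q; apply/matrixP => k l; rewrite -eC -scalemxAr [RHS]mxE -eG.
have -> : C k l = t%:MP * G B k l.
  apply: (mulIf Gij); rewrite Hpr Er rE; ring.
by rewrite evM evC.
Qed.

End Lift.
End Equivariance.

(** * The action of the deck group on a lift *)

Section NormalForm.
Variable R : realType.
Notation K := R[i].
Implicit Types (q : 'cV[K]_2) (N S A B M X Y : 'M[K]_2) (e d : K).
Notation xi := (@xi1 R).

(** The deck transformations [x, y] -> [x, -y] and [x, y] -> [y, x] of [phi0]. *)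
Definition r0 : 'M[K]_2 := mx22 1 0 0 (-1).
Definition s0 : 'M[K]_2 := mx22 0 1 1 0.

Lemma mul_mx22_pt (a b c d x y : K) : mx22 a b c d *m pt x y = pt (a * x + b * y) (c * x + d * y).
Proof. by rewrite [LHS]ptE !mulmx2E !mx22E pt0 pt1. Qed.

Lemma al_pt (x y : K) : al (pt x y) = (x ^+ 2 - y ^+ 2) / 2.
Proof. by rewrite /al pt0 pt1. Qed.
Lemma be_pt (x y : K) : be (pt x y) = (x ^+ 2 + y ^+ 2) / 2.
Proof. by rewrite /be pt0 pt1. Qed.
Lemma ga_pt (x y : K) : ga (pt x y) = x * y.
Proof. by rewrite /ga pt0 pt1. Qed.

Lemma scale_pt (k x y : K) : k *: pt x y = pt (k * x) (k * y).
Proof. by rewrite [LHS]ptE !mxE. Qed.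

(** [normalizes], in terms of values; see [normalizesP]. *)
Definition normev (phi : 'cV[binform R]_2) (mu nu : 'M[K]_2) :=
  [/\ mu \in unitmx, nu \in unitmx & exists2 c : K, c != 0 &
    forall q, nu *m mat_at phi (mu *m q) = c *: mat_at (phi0 R) q].

Lemma phi0_r0 q : mat_at (phi0 R) (r0 *m q) = 1 *: mat_at (phi0 R) q.
Proof.
by rewrite (ptE q) scale1r mul_mx22_pt !mat_phi0 !al_pt !ga_pt; congr pt; field.
Qed.

Lemma phi0_s0 q : mat_at (phi0 R) (s0 *m q) = 1 *: mat_at (phi0 R) q.
Proof.
by rewrite (ptE q) scale1r mul_mx22_pt !mat_phi0 !al_pt !ga_pt; congr pt; field.
Qed.

Lemma normev_phi0 (a b c d a' b' c' d' k : K) : a * d - b * c != 0 -> a' * d' - b' * c' != 0 ->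
  k != 0 ->
  (forall x y, let x' := a * x + b * y in let y' := c * x + d * y in
    let u := - ((x' ^+ 2 - y' ^+ 2) / 2) ^+ 2 in let v := (x' * y') ^+ 2 in
    a' * u + b' * v = k * - ((x ^+ 2 - y ^+ 2) / 2) ^+ 2 /\ c' * u + d' * v = k * (x * y) ^+ 2) ->
  normev (phi0 R) (mx22 a b c d) (mx22 a' b' c' d').
Proof.
move=> h h' k0 H; split; rewrite ?unit_det ?det_mx22 //.
exists k => // q; rewrite (ptE q) mul_mx22_pt !mat_phi0 !al_pt !ga_pt mul_mx22_pt scale_pt.
by have [e1 e2] := H (q 0 0) (q 1 0); congr pt.
Qed.

(** Moebius transformations that normalize the deck group of [phi0]: conjugation by [mH]
    exchanges [r0] and [s0], by [mI] it permutes [r0], [s0] and their product cyclically,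
    and [mZ], which commutes with [r0], exchanges alpha_2 and beta_2 up to constants. *)
Definition mH : 'M[K]_2 := mx22 1 1 1 (-1).
Definition mI : 'M[K]_2 := mx22 1 1 (xi ^+ 2) (- xi ^+ 2).
Definition mZ : 'M[K]_2 := mx22 xi 0 0 xi^-1.

Lemma two_neq0 : (2 : K) != 0. Proof. by rewrite pnatr_eq0. Qed.
Lemma four_neq0 : (4 : K) != 0. Proof. by rewrite pnatr_eq0. Qed.

Lemma xi22 : (xi ^+ 2) ^+ 2 = -1.
Proof. by rewrite -exprM xi4. Qed.
Lemma xi2_neq0 : xi ^+ 2 != 0. Proof. by rewrite expf_neq0 // xi_neq0. Qed.

Lemma normev1 : normev (phi0 R) 1%:M 1%:M.
Proof.
split; rewrite ?unitmx1 //; exists 1; first exact: oner_neq0.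
by move=> q; rewrite !mul1mx scale1r.
Qed.

Lemma normevH : normev (phi0 R) mH (mx22 0 1 1 0).
Proof.
apply: (@normev_phi0 _ _ _ _ _ _ _ _ (-4)).
- by rewrite (_ : _ - _ = - 2) ?oppr_eq0 ?two_neq0 //; ring.
- by rewrite (_ : _ - _ = - 1) ?oppr_eq0 ?oner_neq0 //; ring.
- by rewrite oppr_eq0 four_neq0.
by move=> x y x' y' u v; rewrite /u /v /x' /y'; split; field.
Qed.

Lemma normevI : normev (phi0 R) mI (mx22 0 1 (-1) 1).
Proof.
have h := xi22; apply: (@normev_phi0 _ _ _ _ _ _ _ _ 4).
- have -> : 1 * - xi ^+ 2 - 1 * xi ^+ 2 = - (2 * xi ^+ 2) by ring.
  by rewrite oppr_eq0 mulf_neq0 ?two_neq0 ?xi2_neq0.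
- by rewrite (_ : _ - _ = 1) ?oner_neq0 //; ring.
- exact: four_neq0.
move=> x y x' y' u v.
have e2 : y' ^+ 2 = - (x - y) ^+ 2.
  by transitivity ((xi ^+ 2) ^+ 2 * (x - y) ^+ 2); [rewrite /y'; ring|rewrite h; ring].
have ev : v = - (x ^+ 2 - y ^+ 2) ^+ 2.
  by rewrite /v exprMn e2 /x'; ring.
by rewrite /u ev e2 /x'; split; field.
Qed.

Lemma normevZ : normev (phi0 R) mZ (mx22 (-1) 1 0 1).
Proof.
have h := xi22; apply: (@normev_phi0 _ _ _ _ _ _ _ _ 1).
- by rewrite mulr0 subr0 mulfV ?oner_neq0 // xi_neq0.
- by rewrite (_ : _ - _ = - 1) ?oppr_eq0 ?oner_neq0 //; ring.
- exact: oner_neq0.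
move=> x y x' y' u v; rewrite /u /v /x' /y' !mul0r addr0 add0r.
have i2 : (xi^-1 * y) ^+ 2 = - xi ^+ 2 * y ^+ 2.
  rewrite exprMn; congr (_ * _); apply: (mulfI xi2_neq0); rewrite -exprMn mulfV ?xi_neq0 // expr1n.
  by rewrite mulrN -expr2 h opprK.
have i1 : (xi * x) * (xi^-1 * y) = x * y by rewrite mulrACA mulfV ?xi_neq0 // mul1r.
rewrite i1 i2 exprMn; split; last by ring.
transitivity (- ((xi ^+ 2) ^+ 2 * ((x ^+ 2 + y ^+ 2) / 2) ^+ 2 * -1) + (x * y) ^+ 2); first by field.
by rewrite h; field.
Qed.

Lemma oppmxE B i j : (- B) i j = - B i j.
Proof. by rewrite mxE. Qed.

Lemma cayley2 A : A *m A = (A 0 0 + A 1 1) *: A - (\det A)%:M.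
Proof.
rewrite det2; apply: eqmx2; rewrite !mulmx2E !mxE /= ?mulr1n ?mulr0n; ring.
Qed.

Lemma square_scalar_traceless A : proj_eq (A *m A) 1%:M -> ~ proj_eq A 1%:M -> A \in unitmx -> A 0 0 + A 1 1 = 0.
Proof.
case=> c c0 E nA uA; apply/eqP; apply: contraT => t0; case: nA.
have E' : (A 0 0 + A 1 1) *: A = (c + \det A)%:M.
  by rewrite -[LHS](subrK (\det A)%:M) -cayley2 E scalemx1 -raddfD.
exists ((c + \det A) / (A 0 0 + A 1 1)).
  rewrite mulf_neq0 ?invr_eq0 //; apply/eqP => h; move: E'; rewrite h raddf0 => /eqP.
  rewrite scaler_eq0 (negbTE t0) => /eqP A0.
  by move: uA; rewrite A0 unit_det det2 !mxE mul0r subrr eqxx.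
by rewrite scalemx1 mulrC -scale_scalar_mx -E' scalerA mulVf // scale1r.
Qed.

(** The half turns about the three axes through opposite vertices of the octahedron, that is,
    the squares of the elements of order four of the octahedral group. *)
Definition axis X := exists2 k : K, k != 0 & [\/ X = k *: Dm (-1), X = k *: Am 1 | X = k *: Am (-1)].

Lemma axisP e : e ^+ 4 = 1 -> e ^+ 2 = 1 \/ e ^+ 2 = -1.
Proof.
move=> h; have : (e ^+ 2 - 1) * (e ^+ 2 + 1) = 0 by transitivity (e ^+ 4 - 1); [ring|rewrite h subrr].
by move/eqP; rewrite mulf_eq0 subr_eq0 addr_eq0 => /orP[] /eqP; [left|right].
Qed.

Lemma sqr1P e : e ^+ 2 = 1 -> e = 1 \/ e = -1.
Proof. by move/eqP; rewrite sqrf_eq1 => /orP[] /eqP; [left|right]. Qed.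

(** The images of X and Y generate a Klein four-group of rotations of the octahedron. Such a
    group contains a half turn about a coordinate axis: the half turns about axes through
    the midpoints of opposite edges do not form, with the identity, a four-group. *)
Lemma anticommuting_axis X Y : octa_types X -> octa_types Y ->
  X 0 0 + X 1 1 = 0 -> Y 0 0 + Y 1 1 = 0 -> X *m Y = - (Y *m X) ->
  [\/ axis X, axis Y | axis (Y *m X)].
Proof.
case=> k k0 [e [d [he hd HX]]] [l l0 [f [c [hf hc HY]]]] tX tY anti.
have tXY : (X *m Y) 0 0 + (X *m Y) 1 1 = 0.
  apply: (mulfI two_neq0); rewrite mulr0 mulr2n.
  have e0 := congr1 (fun M : 'M_2 => M 0 0 + M 1 1) anti; rewrite /= in e0.
  transitivity ((X *m Y) 0 0 + (X *m Y) 1 1 + ((Y *m X) 0 0 + (Y *m X) 1 1)).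
    by rewrite !mulmx2E; ring.
  by rewrite e0 !oppmxE; ring.
have edge_or_axis (Z : 'M[K]_2) (k' e' d' : K) : k' != 0 -> e' ^+ 4 = 1 -> Z 0 0 + Z 1 1 = 0 ->
   [\/ Z = k' *: Dm e', Z = k' *: Am e' | Z = k' *: Mm e' d'] ->
   [\/ axis Z, Z = k' *: Am e' /\ e' ^+ 2 = -1 | Z = k' *: Mm e' d' /\ e' * d' = 1].
  move=> k'0 he' tZ [] E.
  - apply: Or31; exists k' => //; apply: Or31; rewrite E; congr (_ *: Dm _).
    apply/eqP; rewrite -addr_eq0 addrC; apply/eqP; apply: (mulfI k'0).
    by rewrite mulr0 -[RHS]tZ E !mxE /=; ring.
  - have [/sqr1P[] h|h] := axisP he'.
    + by apply: Or31; exists k' => //; apply: Or32; rewrite E h.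
    + by apply: Or31; exists k' => //; apply: Or33; rewrite E h.
    by apply: Or32.
  apply: Or33; split=> //; apply/eqP; rewrite -subr_eq0; apply/eqP.
  apply: (mulfI k'0); rewrite mulr0 -[RHS]oppr0 -[in RHS]tZ E [X in - (X + _)]mxE [X in - (_ + X)]mxE !mx22E; ring.
case: (edge_or_axis X _ _ _ k0 he tX HX) => [|[EX e2]|[EX ed]]; first exact: Or31.
- case: (edge_or_axis Y _ _ _ l0 hf tY HY) => [|[EY f2]|[EY fc]]; first exact: Or32.
  + apply: Or33; have fe : f = - e.
      apply/eqP; rewrite -addr_eq0; apply/eqP; apply: (mulfI (mulf_neq0 k0 l0)).
      by rewrite mulr0 -[RHS]tXY EX EY -scalemxAl -scalemxAr scalerA mul_mx22 scale_mx22 !mx22E; ring.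
    exists (l * k * e).
      rewrite !mulf_neq0 //; apply/eqP => z; move/eqP: e2.
      by rewrite z expr0n /= eq_sym oppr_eq0 oner_eq0.
    apply: Or31; rewrite EX EY -scalemxAl -scalemxAr scalerA -[RHS]scalerA; congr (_ *: _).
    by rewrite mul_mx22 scale_mx22 fe; congr mx22; ring.
  exfalso; have fe : f ^+ 2 = - e.
    have fec : f + e * c = 0.
      apply: (mulfI (mulf_neq0 k0 l0)).
      by rewrite mulr0 -[RHS]tXY EX EY -scalemxAl -scalemxAr scalerA mul_mx22 scale_mx22 !mx22E; ring.
    transitivity (f * (f + e * c) - e * (f * c)); first by ring.
    by rewrite fec fc; ring.
  have : (1 : K) = -1.
    by transitivity ((f ^+ 2) ^+ 2); [rewrite -exprM hf|rewrite fe -e2; ring].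
  by move/eqP; rewrite -addr_eq0 (_ : 1 + 1 = 2) ?(negbTE two_neq0).
case: (edge_or_axis Y _ _ _ l0 hf tY HY) => [|[EY f2]|[EY fc]]; first exact: Or32.
- exfalso; have fe : e ^+ 2 = - f.
    have fec : d * f + e = 0.
      apply: (mulfI (mulf_neq0 k0 l0)).
      by rewrite mulr0 -[RHS]tXY EX EY -scalemxAl -scalemxAr scalerA mul_mx22 scale_mx22 !mx22E; ring.
    transitivity (e * (d * f + e) - f * (e * d)); first by ring.
    by rewrite fec ed; ring.
  have : (1 : K) = -1.
    by transitivity ((e ^+ 2) ^+ 2); [rewrite -exprM he|rewrite fe -f2; ring].
  by move/eqP; rewrite -addr_eq0 (_ : 1 + 1 = 2) ?(negbTE two_neq0).
apply: Or33.
have nz e' : e' ^+ 4 = 1 -> e' != 0.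
  by move=> h; apply/eqP => e0; move/eqP: h; rewrite e0 expr0n /= eq_sym oner_eq0.
have fe : f = - e.
  have h0 : 1 + d * f + (e * c + e * d * (f * c)) = 0.
    apply: (mulfI (mulf_neq0 k0 l0)).
    by rewrite mulr0 -[RHS]tXY EX EY -scalemxAl -scalemxAr scalerA mul_mx22 scale_mx22 !mx22E; ring.
  apply/eqP; rewrite -addr_eq0 -sqrf_eq0; apply/eqP.
  transitivity (e * f * (1 + d * f + (e * c + e * d * (f * c))) - (e * d - 1) * f ^+ 2
     - (f * c - 1) * e ^+ 2 - e * f * (e * d * (f * c) - 1)); first by ring.
  by rewrite h0 ed fc; ring.
have cd : c = - d by apply: (mulfI (nz f hf)); rewrite fc fe mulrNN ed.
have dz : d != 0 by exact: nz.
have BE : Y *m X = (l * k * (2 * d)) *: Am (- e ^+ 2).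
  rewrite EX EY -scalemxAl -scalemxAr scalerA -[RHS]scalerA; congr (_ *: _).
  rewrite mul_mx22 scale_mx22 fe cd; congr mx22.
  - by transitivity (1 - e * d); [ring|rewrite ed; ring].
  - by transitivity (d + d * (e * d)); [ring|rewrite ed; ring].
  - by transitivity (- e - (e * d) * e ); [ring|transitivity (- 2 * (e * d) * e); [rewrite ed; ring|ring]].
  by transitivity (- (e * d) + (e * d) ^+ 2); [ring|rewrite ed; ring].
exists (l * k * (2 * d)); first by rewrite !mulf_neq0 // two_neq0.
rewrite BE; have [h|h] := axisP he; rewrite h; first exact: Or33.
by rewrite opprK; apply: Or32.
Qed.

Lemma mat_atN m l n (g : 'M[binform R]_(m, l)) q : (forall i j, g i j \is n.-homog) ->
  forall k, mat_at g (k *: q) = k ^+ n *: mat_at g q.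
Proof.
move=> hg k; apply/matrixP=> i j; rewrite [RHS]mxE !mat_atE.
exact: (form_scale _ _ (hg i j)).
Qed.

Lemma r0s0 : r0 *m s0 = - (s0 *m r0).
Proof.
by rewrite /r0 /s0 !mul_mx22; apply: eqmx2; rewrite [RHS]mxE !mx22E; ring.
Qed.

Section Sym.
Variables (n : nat) (F : 'rV[binform R]_7) (g : 'M[binform R]_2).
Hypothesis L : octa_lift (phi0 R) n F g.
Hypothesis inj : forall S c, c != 0 -> S \in unitmx ->
  (forall q, mat_at (phi0 R) (S *m q) = 1 *: mat_at (phi0 R) q) ->
  (forall q, mat_at g (S *m q) = c *: mat_at g q) -> exists k : K, S = k%:M.

Lemma lift_eq X Y : (forall q, mat_at g q *m X = mat_at g q *m Y) -> X = Y.
Proof.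
move=> H; have [q _ dq] := form_nz (det_homog (lift_g L)) (lift_det L).
rewrite ev_det -unit_det in dq.
by rewrite -(mulKmx dq X) H mulKmx.
Qed.

Lemma r0_unit : r0 \in unitmx.
Proof. by rewrite unit_det det_mx22 mulr0 subr0 mul1r oppr_eq0 oner_neq0. Qed.
Lemma s0_unit : s0 \in unitmx.
Proof. by rewrite unit_det det_mx22 mulr1 mulr0 sub0r oppr_eq0 oner_neq0. Qed.

(** X and Y represent the deck transformations on the right of g. They are involutions, and
    not scalar by the injectivity of the homomorphism of the Galois lift. As [r0] and [s0]
    anticommute, X Y = (-1)^n Y X; for even n the commuting involutions X and Y of trace zero
    would have a scalar product, against injectivity. So n is odd, and 4 <= n <= 6. *)
Lemma lift_rep : exists X Y, [/\ octa_types X, octa_types Y,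
   (forall q, mat_at g (r0 *m q) = mat_at g q *m X),
   (forall q, mat_at g (s0 *m q) = mat_at g q *m Y) &
   [/\ X *m X = 1%:M, Y *m Y = 1%:M, X *m Y = - (Y *m X),
   X 0 0 + X 1 1 = 0 /\ Y 0 0 + Y 1 1 = 0 & n = 5%N]].
Proof.
have [X hX EX] := equivariant L r0_unit phi0_r0 (oner_neq0 _).
have [Y hY EY] := equivariant L s0_unit phi0_s0 (oner_neq0 _).
have r02 : r0 *m r0 = 1%:M by rewrite mul_mx22 scalar_mx22; congr mx22; ring.
have s02 : s0 *m s0 = 1%:M by rewrite mul_mx22 scalar_mx22; congr mx22; ring.
have XX : X *m X = 1%:M.
  by apply: lift_eq => q; rewrite mulmxA -EX -EX mulmxA r02 mul1mx mulmx1.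
have YY : Y *m Y = 1%:M.
  by apply: lift_eq => q; rewrite mulmxA -EY -EY mulmxA s02 mul1mx mulmx1.
have XY : X *m Y = (-1) ^+ n *: (Y *m X).
  apply: lift_eq => q.
  have e1 : mat_at g q *m (X *m Y) = mat_at g (s0 *m (r0 *m q)) by rewrite (EY (r0 *m q)) EX mulmxA.
  have e2 : mat_at g q *m (Y *m X) = mat_at g (r0 *m (s0 *m q)) by rewrite (EX (s0 *m q)) EY mulmxA.
  rewrite e1 -scalemxAr e2 -(mat_atN _ (lift_g L)); congr (mat_at g _).
  by rewrite !mulmxA r0s0 scaleN1r mulNmx opprK.
have not_scalar S Z : S \in unitmx -> (forall q, mat_at (phi0 R) (S *m q) = 1 *: mat_at (phi0 R) q) ->
    (forall q, mat_at g (S *m q) = mat_at g q *m Z) -> (forall k : K, S != k%:M) ->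
    forall c, c != 0 -> Z != c *: 1%:M.
  move=> uS HS EZ nS c c0; apply/eqP => ZE.
  have [k Sk] : exists k : K, S = k%:M.
    by apply: (inj c0 uS HS) => q; rewrite EZ ZE -scalemxAr mulmx1.
  by have := nS k; rewrite Sk eqxx.
have r0n k : r0 != k%:M.
  apply/eqP; rewrite scalar_mx22 => E.
  have h1 := congr1 (fun M : 'M_2 => M 0 0) E; have h2 := congr1 (fun M : 'M_2 => M 1 1) E.
  rewrite !mx22E in h1 h2; move: h2; rewrite -h1 => /eqP; rewrite eq_sym -addr_eq0.
  by rewrite (_ : 1 + 1 = 2) ?(negbTE two_neq0).
have s0n k : s0 != k%:M.
  apply/eqP; rewrite scalar_mx22 => E.
  have h1 := congr1 (fun M : 'M_2 => M 0 1) E.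
  by rewrite !mx22E in h1; move/eqP: h1; rewrite oner_eq0.
have rs0n k : r0 *m s0 != k%:M.
  apply/eqP; rewrite scalar_mx22 mul_mx22 => E.
  have h1 := congr1 (fun M : 'M_2 => M 0 1) E.
  by rewrite !mx22E in h1; move/eqP: h1; rewrite mulr1 mul0r addr0 oner_eq0.
have traceless S Z : S \in unitmx -> (forall q, mat_at (phi0 R) (S *m q) = 1 *: mat_at (phi0 R) q) ->
    (forall q, mat_at g (S *m q) = mat_at g q *m Z) -> (forall k : K, S != k%:M) ->
    Z *m Z = 1%:M -> Z 0 0 + Z 1 1 = 0.
  move=> uS HS EZ nS ZZ; apply: square_scalar_traceless.
  - by exists 1; [exact: oner_neq0|rewrite ZZ scale1r].
  - by case=> c c0 E; have := not_scalar _ _ uS HS EZ nS c c0; rewrite E eqxx.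
  by have [] := mulmx1_unit ZZ.
have tX := traceless _ _ r0_unit phi0_r0 EX r0n XX.
have tY := traceless _ _ s0_unit phi0_s0 EY s0n YY.
(* Commuting involutions of trace zero have a scalar product. *)
have nodd : odd n.
  apply: contraT => ev_n; exfalso.
  rewrite -signr_odd (negbTE ev_n) expr0 scale1r in XY.
  pose t := (Y 0 0 * X 0 0 + Y 0 1 * X 1 0).
  have YXt : Y *m X = t *: 1%:M.
    have x1 : X 1 1 = - X 0 0 by apply/eqP; rewrite -addr_eq0 addrC tX.
    have y1 : Y 1 1 = - Y 0 0 by apply/eqP; rewrite -addr_eq0 addrC tY.
    have e01 := congr1 (fun M : 'M_2 => M 0 1) XY; have e10 := congr1 (fun M : 'M_2 => M 1 0) XY.
    have e00 := congr1 (fun M : 'M_2 => M 0 0) XY.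
    rewrite !mulmx2E x1 y1 in e01 e10 e00.
    rewrite scalar_mx22 scale_mx22 mulr1 mulr0; apply: eqmx2; rewrite mulmx2E mx22E ?x1 ?y1.
    - by [].
    - apply: (mulfI two_neq0); rewrite mulr0.
      transitivity ((Y 0 0 * X 0 1 + Y 0 1 * - X 0 0) + (X 0 0 * Y 0 1 + X 0 1 * - Y 0 0)); last by ring.
      by rewrite e01; ring.
    - apply: (mulfI two_neq0); rewrite mulr0.
      transitivity ((Y 1 0 * X 0 0 + - Y 0 0 * X 1 0) + (X 1 0 * Y 0 0 + - X 0 0 * Y 1 0)); last by ring.
      by rewrite e10; ring.
    by rewrite /t -e00; ring.
  have t0 : t != 0.
    apply/eqP => tz; rewrite tz scale0r in YXt.
    have : X = 0 by rewrite -(mul1mx X) -YY -mulmxA YXt mulmx0.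
    move=> X0; have := congr1 (fun M : 'M_2 => M 0 0) XX.
    by rewrite X0 mulmx0 !mxE /= => /eqP; rewrite eq_sym oner_eq0.
  have ph q : mat_at (phi0 R) (r0 *m s0 *m q) = 1 *: mat_at (phi0 R) q.
    by rewrite -mulmxA phi0_r0 scale1r phi0_s0.
  have EYX q : mat_at g (r0 *m s0 *m q) = mat_at g q *m (Y *m X).
    by rewrite -mulmxA EX EY mulmxA.
  have urs : r0 *m s0 \in unitmx by rewrite unitmx_mul r0_unit s0_unit.
  by have /negP := not_scalar _ _ urs ph EYX rs0n t t0; rewrite YXt eqxx.
exists X, Y; split=> //; split=> //.
  by rewrite XY -signr_odd nodd expr1 scaleN1r.
have := lift_deg_le L; have [le _] := lift_factor L; move: le nodd.
by case: n => [|[|[|[|[|[|[|]]]]]]].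
Qed.

End Sym.

End NormalForm.

(** * Normal forms of lifts *)

Section Covariants.
Variable R : realType.
Notation K := R[i].
Implicit Types (q : 'cV[K]_2) (N S A B M X Y C : 'M[K]_2) (e d : K).
Notation xi := (@xi1 R).

Lemma types_octm B : octa_types B -> octm B.
Proof.
have N4 e : e ^+ 4 = 1 -> (- e) ^+ 4 = 1 by move=> h; rewrite -[RHS]h; ring.
case=> k k0 [e [d [he hd H]]]; case: H => ->; apply: octm_scale => //.
- exact: octm_D.
- have := octm_mul (octm_D (N4 _ he)) (@octm_A R); rewrite mul_mx22.
  by congr octm; congr mx22; ring.
have := octm_mul (octm_mul (octm_D (N4 _ he)) (@octm_rot R)) (octm_D hd); rewrite !mul_mx22.
by congr octm; congr mx22; ring.
Qed.

Lemma normev_comp (phi : 'cV[binform R]_2) mu nu m n : normev phi mu nu -> normev (phi0 R) m n ->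
  normev phi (mu *m m) (n *m nu).
Proof.
case=> u1 u2 [c c0 H] [u3 u4 [d d0 H']]; split; rewrite ?unitmx_mul ?u1 ?u2 ?u3 ?u4 //.
exists (c * d); first by rewrite mulf_neq0.
by move=> q; rewrite -!mulmxA H -scalemxAr H' scalerA.
Qed.

(** The normal form of a lift that is equivariant for X = diag(1,-1). In each row the first
    entry is x times a quartic even in y, and the second is z times the image of the first
    under [x, y] -> [y, x], which changes the sign of alpha_2. *)
Definition covar (z u0 u1 u2 v0 v1 v2 : K) q : 'M[K]_2 :=
  mx22 (q 0 0 * (u0 * al q ^+ 2 + u1 * ga q ^+ 2 - u2 * (al q * be q)))
       (z * q 1 0 * (u0 * al q ^+ 2 + u1 * ga q ^+ 2 + u2 * (al q * be q)))
       (q 0 0 * (v0 * al q ^+ 2 + v1 * ga q ^+ 2 - v2 * (al q * be q)))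
       (z * q 1 0 * (v0 * al q ^+ 2 + v1 * ga q ^+ 2 + v2 * (al q * be q))).

Lemma covar_mull (a b c d z u0 u1 u2 v0 v1 v2 : K) q :
  mx22 a b c d *m covar z u0 u1 u2 v0 v1 v2 q =
  covar z (a * u0 + b * v0) (a * u1 + b * v1) (a * u2 + b * v2)
          (c * u0 + d * v0) (c * u1 + d * v1) (c * u2 + d * v2) q.
Proof.
rewrite /covar mul_mx22.
move: (q 0 0) (q 1 0) (al q) (be q) (ga q) => x y s t r.
by congr mx22; ring.
Qed.

Lemma det_covar (z u0 u1 u2 v0 v1 v2 : K) q : \det (covar z u0 u1 u2 v0 v1 v2 q) =
  2 * z * (ga q * al q * be q) *
  ((u0 * v2 - u2 * v0) * al q ^+ 2 + (u1 * v2 - u2 * v1) * ga q ^+ 2).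
Proof.
rewrite /covar det_mx22 /al /be /ga.
by move: (q 0 0) (q 1 0) => x y; field.
Qed.

Lemma al_mZ q : al (mZ R *m q) = xi ^+ 2 * be q.
Proof.
rewrite (ptE q) mul_mx22_pt al_pt be_pt !mul0r addr0 add0r exprMn.
have -> : (xi^-1 * q 1 0) ^+ 2 = - xi ^+ 2 * q 1 0 ^+ 2.
  rewrite exprMn; congr (_ * _); apply: (mulfI (xi2_neq0 R)); rewrite -exprMn mulfV ?xi_neq0 // expr1n.
  by rewrite mulrN -expr2 xi22 opprK.
by field.
Qed.

Lemma be_mZ q : be (mZ R *m q) = xi ^+ 2 * al q.
Proof.
rewrite (ptE q) mul_mx22_pt al_pt be_pt !mul0r addr0 add0r exprMn.
have -> : (xi^-1 * q 1 0) ^+ 2 = - xi ^+ 2 * q 1 0 ^+ 2.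
  rewrite exprMn; congr (_ * _); apply: (mulfI (xi2_neq0 R)); rewrite -exprMn mulfV ?xi_neq0 // expr1n.
  by rewrite mulrN -expr2 xi22 opprK.
by field.
Qed.

Lemma ga_mZ q : ga (mZ R *m q) = ga q.
Proof.
by rewrite (ptE q) mul_mx22_pt !ga_pt !mul0r addr0 add0r mulrACA mulfV ?xi_neq0 // mul1r.
Qed.

(** Exchanging alpha_2 and beta_2 replaces u_0 by -u_0 and u_1 by u_1 - u_0; this is used when
    the last two columns of the coefficients of the rows are dependent. *)
Lemma covar_mZ (z u0 u1 u2 v0 v1 v2 : K) q :
  covar z u0 u1 u2 v0 v1 v2 (mZ R *m q) *m mx22 xi^-1 0 0 xi =
  covar z (- u0) (u1 - u0) (- u2) (- v0) (v1 - v0) (- v2) q.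
Proof.
have q0 : (mZ R *m q) 0 0 = xi * q 0 0 by rewrite mulmx2E !mx22E mul0r addr0.
have q1 : (mZ R *m q) 1 0 = xi^-1 * q 1 0 by rewrite mulmx2E !mx22E mul0r add0r.
rewrite /covar al_mZ be_mZ ga_mZ q0 q1 mul_mx22 !mulr0 !addr0 !add0r.
have h := xi22 R; have xn := xi_neq0 R.
have ab : xi ^+ 2 * be q * (xi ^+ 2 * al q) = - (al q * be q).
  by transitivity ((xi ^+ 2) ^+ 2 * (al q * be q)); [ring|rewrite h; ring].
have b2 : (xi ^+ 2 * be q) ^+ 2 = - (al q ^+ 2 + ga q ^+ 2).
  by rewrite exprMn h be2E; ring.
rewrite ab b2.
have c0 (a : K) : xi * q 0 0 * a * xi^-1 = q 0 0 * a.
  by rewrite mulrC mulrA mulrA mulVf // mul1r.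
have c1 (a : K) : z * (xi^-1 * q 1 0) * a * xi = z * q 1 0 * a.
  transitivity (xi^-1 * xi * (z * q 1 0 * a)); [by ring|by rewrite mulVf // mul1r].
rewrite !c0 !c1; congr mx22; congr (_ * _); ring.
Qed.

Lemma octmZ : octm (mx22 xi^-1 0 0 xi).
Proof.
have x4 : (xi ^+ 2) ^+ 4 = 1.
  by transitivity (((xi ^+ 2) ^+ 2) ^+ 2); [ring|rewrite xi22; ring].
have := octm_scale (invr_neq0 (xi_neq0 R)) (octm_D x4); rewrite /Dm scale_mx22 !mulr0 mulr1.
by congr octm; congr mx22; rewrite expr2 mulrA mulVf ?xi_neq0 // mul1r.
Qed.

Lemma mat_lift_form (z a b : K) q : mat_at (lift_form z a b) q = covar z a 1 0 b 0 1 q.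
Proof.
rewrite /lift_form mat_atM mat_at_const.
have sum3 (f : 'I_3 -> K) : \sum_i f i = f 0 + f 1 + f (inord 2).
  rewrite !big_ord_recl big_ord0 addr0 addrA; congr (f _ + f _ + f _); apply/val_inj => //.
  by rewrite /= inordK.
apply: eqmx2; rewrite [LHS]mxE sum3 !mxE /= ?inordK //= !evE /covar ?mx22E /al /be /ga; ring.
Qed.

Lemma mH_r0 : mH R *m r0 R = s0 R *m mH R.
Proof. by rewrite !mul_mx22; congr mx22; ring. Qed.
Lemma mH_s0 : mH R *m s0 R = r0 R *m mH R.
Proof. by rewrite !mul_mx22; congr mx22; ring. Qed.
Lemma mI_r0 : mI R *m r0 R = (- xi ^+ 2) *: (r0 R *m (s0 R *m mI R)).
Proof.
have h := xi22 R; rewrite !mul_mx22 scale_mx22; congr mx22; try ring.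
- by transitivity (- (xi ^+ 2) ^+ 2); [rewrite h; ring|ring].
by transitivity ((xi ^+ 2) ^+ 2); [rewrite h; ring|ring].
Qed.
Lemma mI_s0 : mI R *m s0 R = r0 R *m mI R.
Proof. by rewrite !mul_mx22; congr mx22; ring. Qed.

Section Sym.
Variables (n : nat) (F : 'rV[binform R]_7) (g : 'M[binform R]_2).
Hypothesis L : octa_lift (phi0 R) n F g.
Hypothesis inj : forall S (c : K), c != 0 -> S \in unitmx ->
  (forall q, mat_at (phi0 R) (S *m q) = 1 *: mat_at (phi0 R) q) ->
  (forall q, mat_at g (S *m q) = c *: mat_at g q) -> exists k : K, S = k%:M.

Lemma lift_rep_axis : n = 5%N /\ exists m nu X Y, [/\ normev (phi0 R) m nu, axis X /\ octm Y,
   (forall q, mat_at g (m *m (r0 R *m q)) = mat_at g (m *m q) *m X),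
   (forall q, mat_at g (m *m (s0 R *m q)) = mat_at g (m *m q) *m Y) &
   [/\ X *m X = 1%:M, Y *m Y = 1%:M & X *m Y = - (Y *m X)]].
Proof.
have [X [Y [hX hY EX EY [XX YY XY [tX tY] n5]]]] := lift_rep L inj; split=> //.
have [oX oY] := (types_octm hX, types_octm hY).
have YX : Y *m X = - (X *m Y) by rewrite XY opprK.
case: (anticommuting_axis hX hY tX tY XY) => a.
- exists 1%:M, 1%:M, X, Y; split=> //; first exact: normev1.
  + by move=> q; rewrite !mul1mx.
  by move=> q; rewrite !mul1mx.
- exists (mH R), (mx22 0 1 1 0), Y, X; split=> //; first exact: normevH.
  + by move=> q; rewrite mulmxA mH_r0 -mulmxA EY.
  by move=> q; rewrite mulmxA mH_s0 -mulmxA EX.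
have k0 : (- xi ^+ 2) ^+ 5 != 0 by rewrite expf_neq0 // oppr_eq0 xi2_neq0.
exists (mI R), (mx22 0 1 (-1) 1), ((- xi ^+ 2) ^+ 5 *: (Y *m X)), X; split=> //; first exact: normevI.
- split=> //; case: a => l l0 H; exists ((- xi ^+ 2) ^+ 5 * l); first by rewrite mulf_neq0.
  by case: H => ->; rewrite scalerA; [exact: Or31|exact: Or32|exact: Or33].
- move=> q; rewrite mulmxA mI_r0 -scalemxAl (mat_atN _ (lift_g L)) n5 -!mulmxA EX EY -scalemxAr.
  by rewrite -!mulmxA.
- by move=> q; rewrite mulmxA mI_s0 -mulmxA EX.
split=> //.
- rewrite -scalemxAl -scalemxAr scalerA {1}YX mulNmx -mulmxA (mulmxA Y) YY mul1mx XX.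
  rewrite scalerN -scaleNr (_ : - _ = 1) ?scale1r //.
  transitivity (- ((xi ^+ 2) ^+ 2) ^+ 5); first by ring.
  by rewrite xi22; ring.
rewrite -scalemxAl -scalemxAr -scalerN; congr (_ *: _).
by rewrite (mulmxA X) XY mulNmx opprK.
Qed.

Lemma axis_diag X : axis X -> X *m X = 1%:M -> exists2 C, octm C & X *m C = C *m Dm (-1).
Proof.
move=> aX XX; suff [C oC [k EX]] : exists2 C, octm C & exists k, X *m C = k *: (C *m Dm (-1)).
  have uC := octm_unit oC.
  have k2 : k ^+ 2 = 1.
    have E : C = k ^+ 2 *: C.
      rewrite -{1}(mul1mx C) -XX -mulmxA EX -scalemxAr mulmxA EX -scalemxAl -mulmxA Dm_mul scalerA.
      rewrite mulrNN mulr1 (_ : Dm 1 = 1%:M) ?mulmx1 //.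
      by rewrite scalar_mx22.
    have : (k ^+ 2 - 1) *: C = 0 by rewrite scalerBl -E scale1r subrr.
    move/(congr1 (mulmx (invmx C))); rewrite mulmx0 -scalemxAr mulVmx // => /(congr1 (fun M : 'M_2 => M 0 0)).
    by rewrite !mxE /= mulr1 => /eqP; rewrite subr_eq0 => /eqP.
  have [k1|kN] := sqr1P k2; first by exists C; rewrite // EX k1 scale1r.
  exists (C *m Am (-1)); first exact: octm_mul (octm_A R).
  rewrite mulmxA EX kN scaleN1r -mulmxN -!mulmxA; congr (C *m _).
  by rewrite mulNmx !mul_mx22; apply: eqmx2; rewrite !oppmxE !mx22E; ring.
case: aX => k k0 [] ->.
- exists 1%:M; first exact: octm1.
  by exists k; rewrite mulmx1 mul1mx.
- exists (Mm 1 1); first exact: octm_M11.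
  exists k; rewrite -scalemxAl; congr (_ *: _).
  by rewrite !mul_mx22; congr mx22; ring.
exists (Mm (xi ^+ 2) 1); first exact: octm_Mi1.
have h := xi22 R; exists (k * xi ^+ 2); rewrite -scalemxAl -scalerA; congr (_ *: _).
rewrite !mul_mx22 scale_mx22; congr mx22; try ring.
- by transitivity ((xi ^+ 2) ^+ 2); [rewrite h; ring|ring].
by transitivity ((xi ^+ 2) ^+ 2); [rewrite h; ring|ring].
Qed.

(** A matrix that anticommutes with diag(1,-1) is antidiagonal; being octahedral, its entries
    p and p' = 1/p satisfy p^4 = p'^4. *)
Lemma antidiag Y : Y *m Dm (-1) = - (Dm (-1) *m Y) -> Y *m Y = 1%:M -> octa_stab Y ->
  exists p p', [/\ Y = mx22 0 p p' 0, p * p' = 1 & p ^+ 8 = 1].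
Proof.
move=> H YY; have e00 := congr1 (fun M : 'M_2 => M 0 0) H; have e11 := congr1 (fun M : 'M_2 => M 1 1) H.
rewrite !oppmxE !mulmx2E !mx22E in e00 e11.
have y0 : Y 0 0 = 0.
  apply: (mulfI (two_neq0 R)); rewrite mulr0.
  transitivity ((Y 0 0 * 1 + Y 0 1 * 0) + (1 * Y 0 0 + 0 * Y 1 0)); first by ring.
  by rewrite e00 addNr.
have y1 : Y 1 1 = 0.
  apply: (mulfI (two_neq0 R)); rewrite mulr0.
  transitivity (- ((Y 1 0 * 0 + Y 1 1 * -1) + (0 * Y 0 1 + -1 * Y 1 1))); first by ring.
  by rewrite e11 addNr oppr0.
move=> st; exists (Y 0 1), (Y 1 0).
have YE : Y = mx22 0 (Y 0 1) (Y 1 0) 0 by rewrite {1}(mx22_eta Y) y0 y1.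
have pp : Y 0 1 * Y 1 0 = 1.
  by have := congr1 (fun M : 'M_2 => M 0 0) YY; rewrite mulmx2E y0 mul0r add0r mxE.
split=> //; move: st; rewrite {1}YE octa_stab_mx22 => -[k k0].
move: (Y 0 1) (Y 1 0) pp => p r pr st.
have st11 : octa (0 * 1 - p * 1) (0 * 1 - r * 1) = k * octa 1 (1 : K) by [].
have : p ^+ 4 = r ^+ 4.
  apply: (mulfI (mulf_neq0 (oner_neq0 K) (oner_neq0 K))).
  apply/eqP; rewrite -subr_eq0; apply/eqP.
  transitivity (p * r * (p ^+ 4 - r ^+ 4)); first by rewrite pr; ring.
  transitivity (octa (0 * 1 - p * 1) (0 * 1 - r * 1)); first by rewrite /octa; ring.
  by rewrite st11 /octa; ring.
move=> p4; transitivity ((p * r) ^+ 4); first by rewrite exprMn -p4 -exprD.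
by rewrite pr expr1n.
Qed.

Lemma odd_form (p : binform R) : p \is 5.-homog ->
  (forall x y, ev (pt x (- y)) p = ev (pt x y) p) ->
  exists a0 a2 a4, forall x y, ev (pt x y) p = x * (a0 * x ^+ 4 + a2 * (x ^+ 2 * y ^+ 2) + a4 * y ^+ 4).
Proof.
move=> hp H; exists p@_(M2 5 0), p@_(M2 3 2), p@_(M2 1 4) => x y.
apply: (mulfI (two_neq0 R)).
transitivity (ev (pt x y) p + ev (pt x (- y)) p); first by rewrite H; ring.
rewrite !(form_ev _ _ hp) !big_ord_recl !big_ord0 /= /bump /= !subn0 ?subSS ?subn0.
ring.
Qed.

(** After an octahedral change of basis X = diag(1,-1), and Y is antidiagonal with entry p,
    p^8 = 1. The diagonal octahedral matrices multiply p by a fourth root of unity, which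
    leaves p = 1 and p = xi_1. *)
Lemma lift_covar : n = 5%N /\ exists m nu C z u0 u1 u2 v0 v1 v2,
  [/\ normev (phi0 R) m nu, octm C, z = 1 \/ z = xi &
   forall q, mat_at g (m *m q) *m C = covar z u0 u1 u2 v0 v1 v2 q].
Proof.
have [n5 [m [nu [X [Y [Nm [aX oY] EX EY [XX YY XY]]]]]]] := lift_rep_axis; split=> //.
have [C oC XC] := axis_diag aX XX; have uC := octm_unit oC.
pose Y' := invmx C *m Y *m C.
have CY : C *m Y' = Y *m C by rewrite /Y' !mulmxA mulmxV // mul1mx.
have XE : X = C *m Dm (-1) *m invmx C by rewrite -XC mulmxK.
have [p [p' [YE pp p8]]] : exists p p', [/\ Y' = mx22 0 p p' 0, p * p' = 1 & p ^+ 8 = 1].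
  apply: antidiag.
  - apply: (can_inj (mulKmx uC)); rewrite mulmxA CY -mulmxA -XC mulmxA.
    by rewrite mulmxN (mulmxA C) -XC -(mulmxA X) CY (mulmxA X) XY mulNmx opprK.
  - by apply: (can_inj (mulKmx uC)); rewrite mulmxA CY -mulmxA CY mulmxA YY mul1mx mulmx1.
  - by apply: octa_stab_mul (octm_stab oC); apply: octa_stab_mul (octm_stab oY); apply: octa_stab_inv uC (octm_stab oC).
pose g1 : 'M[binform R]_2 := precomp g m *m const_form C.
have G1 q : mat_at g1 q = mat_at g (m *m q) *m C.
  by rewrite mat_atM mat_at_const mat_at_precomp.
have h1 i j : g1 i j \is 5.-homog.
  rewrite mulmx2E; have H k l : precomp g m k l \is 5.-homog.
    by rewrite mxE -n5; apply: lin_subst_homog; exact: (lift_g L).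
  by rewrite ![const_form _ _ _]mxE; hmgd.
have Gr q : mat_at g1 (r0 R *m q) = mat_at g1 q *m Dm (-1).
  by rewrite !G1 EX -!mulmxA XC.
have Gs q : mat_at g1 (s0 R *m q) = mat_at g1 q *m mx22 0 p p' 0.
  by rewrite !G1 EY -!mulmxA -YE CY.
have c0 i : exists a0 a2 a4, forall x y, ev (pt x y) (g1 i 0) =
    x * (a0 * x ^+ 4 + a2 * (x ^+ 2 * y ^+ 2) + a4 * y ^+ 4).
  apply: odd_form => // x y.
  have := congr1 (fun M : 'M_2 => M i 0) (Gr (pt x y)).
  by rewrite mulmx2E !mx22E mulr1 mulr0 addr0 !mat_atE mul_mx22_pt mul1r !mul0r addr0 add0r mulN1r.
have c1 i x y : ev (pt x y) (g1 i 1) = p * ev (pt y x) (g1 i 0).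
  have := congr1 (fun M : 'M_2 => M i 0) (Gs (pt x y)).
  rewrite mulmx2E !mx22E mulr0 add0r !mat_atE mul_mx22_pt !mul0r !mul1r add0r addr0 => ->.
  by rewrite mulrCA pp mulr1.
have [a0 [a2 [a4 Ha]]] := c0 0; have [b0 [b2 [b4 Hb]]] := c0 1.
have pn0 : p != 0 by apply/eqP => p0; move/eqP: pp; rewrite p0 mul0r eq_sym oner_eq0.
(* p^4 = 1 or p^4 = -1; a fourth root of unity d takes p to 1 or to xi. *)
have [z [d [d4 zE hz]]] : exists z d, [/\ d ^+ 4 = 1, z = d * p & z = 1 \/ z = xi].
  have : (p ^+ 4 - 1) * (p ^+ 4 + 1) = 0 by transitivity (p ^+ 8 - 1); [ring|rewrite p8 subrr].
  move/eqP; rewrite mulf_eq0 subr_eq0 addr_eq0 => /orP[] /eqP p4.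
    by exists 1, p^-1; rewrite exprVn p4 invr1 mulVf //; split=> //; left.
  exists xi, (xi / p); rewrite divfK // expr_div_n p4 xi4 divff ?oppr_eq0 ?oner_neq0 //.
  by split=> //; right.
exists m, nu, (C *m Dm d), z, (2 * (a0 + a4)), (a0 + a4 + a2), (- (2 * (a0 - a4))),
  (2 * (b0 + b4)), (b0 + b4 + b2), (- (2 * (b0 - b4))); split=> //.
  by apply: octm_mul => //; exact: octm_D.
move=> q; rewrite mulmxA -G1 (ptE q) (mx22_eta (mat_at g1 _)) mul_mx22 !mat_atE !c1 !Ha !Hb /covar.
rewrite al_pt be_pt ga_pt pt0 pt1 zE.
by move: (q 0 0) (q 1 0) => x y; congr mx22; field.
Qed.

(** Row operations bring the 2 x 3 matrix of coefficients of [lift_covar] to the shape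
    ( a 1 0 ; b 0 1 ), provided that its last two columns are independent. If they are not,
    [covar_mZ] makes them so, because the determinant of g is not zero. *)
Lemma lift_normal_form : n = 5%N /\ exists m nu A C z a b,
  [/\ normev (phi0 R) m nu, A \in unitmx, octm C, z = 1 \/ z = xi &
   forall q, A *m mat_at g (m *m q) *m C = covar z a 1 0 b 0 1 q].
Proof.
have [n5 [m [nu [C [z [u0 [u1 [u2 [v0 [v1 [v2 [Nm oC hz H]]]]]]]]]]]] := lift_covar; split=> //.
have [uC um] : C \in unitmx /\ m \in unitmx by split; [exact: octm_unit|case: Nm].
suff [m' [nu' [C' [w0 [w1 [w2 [t0 [t1 [t2 [Nm' oC' H' d0]]]]]]]]]] :
   exists m' nu' C' w0 w1 w2 t0 t1 t2, [/\ normev (phi0 R) m' nu', octm C',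
     forall q, mat_at g (m' *m q) *m C' = covar z w0 w1 w2 t0 t1 t2 q & w1 * t2 - w2 * t1 != 0].
  set D := w1 * t2 - w2 * t1 in d0.
  exists m', nu', (D^-1 *: mx22 t2 (- w2) (- t1) w1), C', z,
    (D^-1 * (t2 * w0 - w2 * t0)), (D^-1 * (w1 * t0 - t1 * w0)); split=> //.
    rewrite unitmxZ ?unitfE ?invr_eq0 // unit_det det_mx22.
    by rewrite (_ : _ - _ = D) // /D; ring.
  move=> q; rewrite -mulmxA H' scale_mx22 covar_mull; congr covar.
  - by ring.
  - by apply: (mulfI d0); rewrite mulrDr !mulrA !divff // /D; ring.
  - by ring.
  - by ring.
  - by ring.
  by apply: (mulfI d0); rewrite mulrDr !mulrA !divff // /D; ring.
have [D0|D0] := eqVneq (u1 * v2 - u2 * v1) 0; last by exists m, nu, C, u0, u1, u2, v0, v1, v2.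
exists (m *m mZ R), (mx22 (-1) 1 0 1 *m nu), (C *m mx22 xi^-1 0 0 xi).
exists (- u0), (u1 - u0), (- u2), (- v0), (v1 - v0), (- v2); split.
- exact: normev_comp (normevZ R).
- exact: octm_mul octmZ.
- by move=> q; rewrite -(mulmxA m) mulmxA H covar_mZ.
apply/eqP => D1.
have D2 : u0 * v2 - u2 * v0 = 0.
  transitivity (((u1 - u0) * (- v2) - (- u2) * (v1 - v0)) + (u1 * v2 - u2 * v1)); first by ring.
  by rewrite D0 D1 addr0.
have [q _ dq] := form_nz (det_homog (lift_g L)) (lift_det L).
have := congr1 determinant (H (invmx m *m q)).
rewrite mulKVmx // det_mulmx det_covar D0 D2 !mul0r addr0 mulr0 -ev_det => /eqP.
by rewrite mulf_eq0 (negbTE dq) /=; move: uC; rewrite unit_det => /negbTE ->.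
Qed.

End Sym.

End Covariants.

(** * The curves of the two families *)

Section NormalFormCurves.
Variable R : realType.
Notation K := R[i].
Implicit Types (q p : 'cV[K]_2) (z a b : K).
Notation xi := (@xi1 R).

Lemma six_coef_homog d (c : nat -> binform R) A1 A2 k :
  (forall j, (j < 7)%N -> c j \is (d + j).-homog) -> A1 \is 1.-homog -> A2 \is 1.-homog ->
  (k < 7)%N -> six_coef c A1 A2 k \is (d + 6).-homog.
Proof.
move=> hc h1 h2.
have [c0 c1 c2 c3] : [/\ c 0%N \is (d + 0).-homog, c 1%N \is (d + 1).-homog,
  c 2%N \is (d + 2).-homog & c 3%N \is (d + 3).-homog] by split; apply: hc.
have [c4 c5 c6] : [/\ c 4%N \is (d + 4).-homog, c 5%N \is (d + 5).-homog &
  c 6%N \is (d + 6).-homog] by split; apply: hc.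
case: k => [|[|[|[|[|[|[|//]]]]]]] _; rewrite /six_coef; hmgd.
Qed.

Lemma ev_six_coef p (c : nat -> binform R) A1 A2 k :
  ev p (six_coef c A1 A2 k) = six_coef (fun j => ev p (c j)) (ev p A1) (ev p A2) k.
Proof. exact: (six_coef_rmorph (meval (fun k => p k 0))). Qed.

Lemma six_coef_ext (c c' : nat -> K) A1 A2 k : c =1 c' -> six_coef c A1 A2 k = six_coef c' A1 A2 k.
Proof. by move=> h; rewrite /six_coef !h. Qed.

(** With [X, Y] = [-alpha_2^2, gamma^2] the quantities entering [octa_ram] and [octa_exc] are
    forms on the target of the covering: A1 = Y - a X and A2 = - b X from the entries of g,
    S = (alpha_2 beta_2)^2 = X^2 - X Y and W = alpha_2^2 + beta_2^2 = Y - 2 X. *)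
Definition A1f a : binform R := X1 - a%:MP * X0.
Definition A2f b : binform R := - (b%:MP * X0).
Definition Sf : binform R := X0 ^+ 2 - X0 * X1.
Definition Wf : binform R := X1 - 2 * X0.
Definition ram_form a b (k : nat) := six_coef (ram_coef Sf Wf) (A1f a) (A2f b) k.
(** The coordinates of F in the second family, up to the linear factor that makes their
    degree 7 instead of 6. *)
Definition exc_form a b (k : nat) := six_coef (exc_coef Sf Wf) (A1f a) (A2f b) k.

Lemma A1f_homog a : A1f a \is 1.-homog. Proof. by rewrite /A1f; hmgd. Qed.
Lemma A2f_homog b : A2f b \is 1.-homog. Proof. by rewrite /A2f; hmgd. Qed.
Lemma Sf_homog : Sf \is 2.-homog. Proof. by rewrite /Sf; hmgd. Qed.
Lemma Wf_homog : Wf \is 1.-homog. Proof. by rewrite /Wf; hmgd. Qed.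

Lemma ram_form_homog a b k : (k < 7)%N -> ram_form a b k \is 6.-homog.
Proof.
move=> k7; apply: (@six_coef_homog 0 _ _ _ k _ (A1f_homog a) (A2f_homog b) k7) => j.
move: Sf_homog Wf_homog; move: Sf Wf => S W hS hW.
case: j => [|[|[|[|[|[|[|//]]]]]]] _; rewrite /ram_coef; try hmgd.
exact: rpred0.
Qed.

Lemma exc_form_homog a b k : (k < 7)%N -> exc_form a b k \is 7.-homog.
Proof.
move=> k7; apply: (@six_coef_homog 1 _ _ _ k _ (A1f_homog a) (A2f_homog b) k7) => j.
move: Sf_homog Wf_homog; move: Sf Wf => S W hS hW.
case: j => [|[|[|[|[|[|[|//]]]]]]] _; rewrite /exc_coef; try hmgd.
exact: rpred0.
Qed.

Lemma ev_A1f p a : ev p (A1f a) = p 1 0 - a * p 0 0. Proof. by rewrite /A1f !evE. Qed.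
Lemma ev_A2f p b : ev p (A2f b) = - (b * p 0 0). Proof. by rewrite /A2f !evE. Qed.
Lemma ev_Sf p : ev p Sf = p 0 0 ^+ 2 - p 0 0 * p 1 0. Proof. by rewrite /Sf !evE. Qed.
Lemma ev_Wf p : ev p Wf = p 1 0 - 2 * p 0 0. Proof. by rewrite /Wf !evE. Qed.

Lemma ev_ram_form p a b k : ev p (ram_form a b k) =
  six_coef (ram_coef (p 0 0 ^+ 2 - p 0 0 * p 1 0) (p 1 0 - 2 * p 0 0))
    (p 1 0 - a * p 0 0) (- (b * p 0 0)) k.
Proof.
rewrite /ram_form ev_six_coef ev_A1f ev_A2f; apply: six_coef_ext => j.
rewrite -ev_Sf -ev_Wf; exact: (ram_coef_rmorph (meval (fun k => p k 0))).
Qed.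

Lemma ev_exc_form p a b k : ev p (exc_form a b k) =
  six_coef (exc_coef (p 0 0 ^+ 2 - p 0 0 * p 1 0) (p 1 0 - 2 * p 0 0))
    (p 1 0 - a * p 0 0) (- (b * p 0 0)) k.
Proof.
rewrite /exc_form ev_six_coef ev_A1f ev_A2f; apply: six_coef_ext => j.
rewrite -ev_Sf -ev_Wf; exact: (exc_coef_rmorph (meval (fun k => p k 0))).
Qed.

Lemma x4E q : q 0 0 ^+ 4 = (al q ^+ 2 + be q ^+ 2) + 2 * (al q * be q).
Proof. by rewrite /al /be; field. Qed.
Lemma y4E q : q 1 0 ^+ 4 = (al q ^+ 2 + be q ^+ 2) - 2 * (al q * be q).
Proof. by rewrite /al /be; field. Qed.

Lemma octa_mx_covar z a b q (k : 'I_7) : octa_mx (covar z a 1 0 b 0 1 q) k =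
  octa_coef k (z * q 1 0 * (b * al q ^+ 2 + al q * be q)) (- (z * q 1 0 * (a * al q ^+ 2 + ga q ^+ 2)))
    (- (q 0 0 * (b * al q ^+ 2 - al q * be q))) (q 0 0 * (a * al q ^+ 2 + ga q ^+ 2)).
Proof.
by rewrite /octa_mx /covar !mx22E; congr octa_coef; ring.
Qed.

Lemma octa_mx_ram a b q (k : 'I_7) : octa_mx (covar 1 a 1 0 b 0 1 q) k =
  - 4 * (ga q * al q * be q) * ev (mat_at (phi0 R) q) (ram_form a b k).
Proof.
rewrite octa_mx_covar !mul1r (octa_ram _ _ (x4E q) (y4E q) (ltn_ord k)) ev_ram_form mat_phi0 pt0 pt1.
rewrite (_ : ga q * al q * be q = q 0 0 * q 1 0 * (al q * be q)); last by rewrite /ga mulrA.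
have h := be2E q; congr (_ * _).
have e1 : (al q * be q) ^+ 2 = (- al q ^+ 2) ^+ 2 - - al q ^+ 2 * ga q ^+ 2 by rewrite exprMn h; ring.
have e2 : al q ^+ 2 + be q ^+ 2 = ga q ^+ 2 - 2 * - al q ^+ 2 by rewrite h; ring.
have e3 : a * al q ^+ 2 + ga q ^+ 2 = ga q ^+ 2 - a * - al q ^+ 2 by ring.
have e4 : b * al q ^+ 2 = - (b * - al q ^+ 2) by ring.
by rewrite e1 e2 e3 e4.
Qed.

Lemma octa_mx_exc z a b q (k : 'I_7) : z ^+ 4 = -1 -> octa_mx (covar z a 1 0 b 0 1 q) k =
  2 * z * ga q * ev (mat_at (phi0 R) q) (exc_form a b k).
Proof.
move=> hz; rewrite octa_mx_covar (octa_exc _ _ hz (x4E q) (y4E q) (ltn_ord k)) ev_exc_form mat_phi0 pt0 pt1.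
have h := be2E q; congr (_ * _).
have e1 : (al q * be q) ^+ 2 = (- al q ^+ 2) ^+ 2 - - al q ^+ 2 * ga q ^+ 2 by rewrite exprMn h; ring.
have e2 : al q ^+ 2 + be q ^+ 2 = ga q ^+ 2 - 2 * - al q ^+ 2 by rewrite h; ring.
have e3 : a * al q ^+ 2 + ga q ^+ 2 = ga q ^+ 2 - a * - al q ^+ 2 by ring.
have e4 : b * al q ^+ 2 = - (b * - al q ^+ 2) by ring.
by rewrite e1 e2 e3 e4.
Qed.

Lemma phi0_surj p : p != 0 -> exists2 q, q != 0 & exists2 k : K, k != 0 & mat_at (phi0 R) q = k *: p.
Proof.
move=> p0; have hl : pull (phi0 R) (lin p) \is (4 * 1).-homog by apply: pull_phi0_homog; exact: lin_homog.
have [q q0 hq] := form_zero (isT : (0 < 4 * 1)%N) hl; exists q => //.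
rewrite ev_pull ev_lin in hq; have nz := mat_phi0_nz q0.
set r := mat_at (phi0 R) q in nz hq *.
have [k kE] : exists k : K, r = k *: p.
  have [p1|p1] := eqVneq (p 1 0) 0.
    have p00 : p 0 0 != 0.
      by apply: contra_neq p0 => h; rewrite (ptE p) h p1; apply/eqP; rewrite pt_eq0 eqxx.
    exists (r 0 0 / p 0 0); rewrite [LHS]ptE [X in _ *: X]ptE scale_pt p1 mulr0 divfK //; congr pt.
    apply: (mulfI p00); rewrite mulr0; apply/eqP; rewrite -oppr_eq0; apply/eqP.
    by rewrite -[RHS]hq p1 mul0r sub0r.
  exists (r 1 0 / p 1 0); rewrite [LHS]ptE [X in _ *: X]ptE scale_pt divfK //; congr pt.
  apply: (mulfI p1); apply/eqP; rewrite -subr_eq0; apply/eqP; rewrite -[RHS]hq; field.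
  exact: p1.
exists k => //; apply: contra_neq nz => k0; by rewrite kE k0 scale0r.
Qed.

(** The covering is surjective, so a form that vanishes on its image is zero. *)
Lemma form_phi0_ext d (s : binform R) : s \is d.-homog ->
  (forall q, q != 0 -> ev (mat_at (phi0 R) q) s = 0) -> s = 0.
Proof.
move=> hs H; apply: (form_ext hs) => p p0; have [q q0 [k k0 E]] := phi0_surj p0.
have := H q q0; rewrite E (form_scale _ _ hs) => /eqP.
by rewrite mulf_eq0 expf_eq0 (negbTE k0) andbF /= => /eqP.
Qed.

End NormalFormCurves.

(** * Tangency in the first family, Hessians of tangent curves *)

Section Tangency.
Variable R : realType.
Notation K := R[i].
Implicit Types (q p : 'cV[K]_2) (z a b : K).
Notation xi := (@xi1 R).

Lemma pt_neq0 (x y : K) : (x != 0) || (y != 0) -> pt x y != 0.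
Proof. by rewrite pt_eq0 negb_and. Qed.

Lemma alpha2_neq0 : alpha2 != 0 :> binform R.
Proof.
suff : ev (pt 1 0) alpha2 != 0 :> K by apply: contra_neq => ->; rewrite ev0.
by rewrite ev_alpha2 al_pt expr1n expr0n subr0 mul1r invr_eq0 two_neq0.
Qed.
Lemma beta2_neq0 : beta2 != 0 :> binform R.
Proof.
suff : ev (pt 1 0) beta2 != 0 :> K by apply: contra_neq => ->; rewrite ev0.
by rewrite ev_beta2 be_pt expr1n expr0n addr0 mul1r invr_eq0 two_neq0.
Qed.
Lemma gamma_neq0 : gamma != 0 :> binform R.
Proof.
suff : ev (pt 1 1) gamma != 0 :> K by apply: contra_neq => ->; rewrite ev0.
by rewrite ev_gamma ga_pt mulr1 oner_eq0.
Qed.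

Section Lift.
Variables (F : 'rV[binform R]_7) (g : 'M[binform R]_2).
Hypothesis L : octa_lift (phi0 R) 5 F g.

(** If f_1 o g is P times E o phi, with E of degree 6, then F and E agree: the factor of
    [lift_factor] has the same degree as P, and the coordinates of F have no common zero. *)
Lemma lift_unique (P : binform R) (E : 'I_7 -> binform R) : P \is 6.-homog -> P != 0 ->
  (forall k, E k \is 6.-homog) ->
  (forall q k, octa_mx (mat_at g q) k = ev q P * ev (mat_at (phi0 R) q) (E k)) ->
  exists2 c : K, c != 0 & (forall k, F 0 k = c *: E k) /\
    forall k, octa_g g k = c^-1%:MP * P * pull (phi0 R) (F 0 k).
Proof.
move=> hP P0 hE H; have [_ [h [hh h0 Eh]]] := lift_factor L.
have PE k : h * pull (phi0 R) (F 0 k) = P * pull (phi0 R) (E k).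
  rewrite -Eh; apply: (@form_eq _ (6 + 4 * 6)).
  - exact: (octa_g_homog k (lift_g L)).
  - by apply: homM => //; exact: pull_phi0_homog.
  by move=> u v; rewrite ev_octa_g H (evM _ P) ev_pull.
have [|_ [r hr hE']] := form_cancel hP P0 hh h0 (fun k => ex_intro _ _ (PE k)).
  by move=> q q0 _; exact: (lift_pullz L).
have rE := form0_const hr; move: rE; set c := r@__ => rE.
have c0 : c != 0.
  by apply: contra_neq h0 => z; rewrite hE' rE z mpolyC0 mulr0.
exists c^-1; first by rewrite invr_eq0.
split=> k; last by rewrite Eh hE' rE invrK [P * _]mulrC.
apply/eqP; rewrite -subr_eq0; apply/eqP.
apply: (form_phi0_ext (homB (lift_F L k) (homZ _ (hE k)))) => q q0.
have e1 : ev q (c%:MP * pull (phi0 R) (F 0 k)) = c * ev (mat_at (phi0 R) q) (F 0 k).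
  exact: etrans (evM _ _ _) (f_equal2 *%R (evC _ _) (ev_pull _ _ _)).
have := PE k; rewrite hE' rE -mulrA => /(mulfI P0) /(congr1 (ev q)).
move=> e2; have {e1 e2} e : c * ev (mat_at (phi0 R) q) (F 0 k) = ev (mat_at (phi0 R) q) (E k).
  by rewrite -e1 -[RHS]ev_pull; exact: e2.
by rewrite evB evZ -e mulrA mulVf // mul1r subrr.
Qed.

Lemma sextval_split (f : 'I_7 -> K) (u v : K) : (forall k : 'I_7, (1 < k)%N -> f k = 0) ->
  sextval f u v = f 0 * u ^+ 6 + f 1 * (u ^+ 5 * v).
Proof.
move=> H; rewrite /sextval (bigD1 0) //= (bigD1 1) //= big1 => [|k /andP[k0 k1]].
  by rewrite expr0 mulr1 addr0.
rewrite H ?mul0r //; case: k k0 k1 => -[|[|k]] //= Hk; rewrite -?val_eqE //.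
Qed.

(** In the first family the coordinate F_k is divisible by (Y - a X)^k. At the point [1, a]
    only u^6 is left, and of the derivatives only u^6 and u^5 v. *)
Lemma ram_tangent a b : (forall q, mat_at g q = covar 1 a 1 0 b 0 1 q) -> tangent6 F.
Proof.
move=> Hg; pose P : binform R := (-4)%:MP * (gamma * alpha2 * beta2).
have hP : P \is 6.-homog.
  have := homog_alpha2 R; have := homog_beta2 R; have := homog_gamma R.
  rewrite /P; move: alpha2 beta2 gamma => s t r hr ht hs; hmgd.
have P0 : P != 0.
  apply: mulf_neq0; first by rewrite mpolyC_eq0 oppr_eq0 four_neq0.
  exact: mulf_neq0 (mulf_neq0 gamma_neq0 alpha2_neq0) beta2_neq0.
have [|c c0 [Ec _]] := @lift_unique P (fun k => ram_form a b k) hP P0 (fun k => ram_form_homog a b (ltn_ord k)).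
  by move=> q k; rewrite Hg octa_mx_ram; congr (_ * _); rewrite !(evM, ev_gamma, ev_alpha2, ev_beta2) evC.
pose p : 'cV[K]_2 := pt 1 a.
have p0 : p != 0 by rewrite pt_neq0 // oner_neq0.
have pA : ev p (A1f a) = 0 by rewrite ev_A1f pt0 pt1 mulr1 subrr.
have Fp (k : 'I_7) : (0 < k)%N -> ev p (F 0 k) = 0.
  move=> k0; rewrite Ec evZ /ram_form ev_six_coef pA /six_coef oppr0 expr0n.
  by case: (nat_of_ord k) k0 => // ? _; rewrite mul0r mulr0.
have F0 : ev p (F 0 0) != 0.
  have [k hk] := lift_Fz L p0; have [k0|k0] := posnP k; last by rewrite Fp ?eqxx in hk.
  by rewrite (_ : 0 = k) //; apply/val_inj.
have dF i (k : 'I_7) : (1 < k)%N -> ev p (mderiv i (F 0 k)) = 0.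
  move=> k1; have [r Er] : exists r, F 0 k = A1f a * (A1f a * r).
    rewrite Ec /ram_form /six_coef; case: (nat_of_ord k) k1 => [|[|m]] // _.
    rewrite -mul_mpolyC exprS exprS.
    have aux (x A s t : binform R) : x * (- A * (- A * t) * s) = A * (A * (x * (t * s))) by ring.
    exact: ex_intro _ _ (aux _ _ _ _).
  rewrite Er; have -> : mderiv i (A1f a * (A1f a * r)) =
     A1f a * (mderiv i (A1f a) * r + mderiv i (A1f a * r)).
    by rewrite mderivM mulrDr; congr (_ + _); rewrite mulrCA.
  by rewrite evM pA mul0r.
exists p, 1, 0, (ev p (F 0 0)); split=> //; first by rewrite oner_neq0.
  move=> u v; rewrite sextval_split => [|k k1]; last by apply: Fp; exact: ltnW.
  by rewrite (Fp 1) // mul0r addr0 mul1r mul0r addr0.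
move=> i; exists (ev p (mderiv i (F 0 0))), (ev p (mderiv i (F 0 1))) => u v.
rewrite sextval_split => [|k k1]; last exact: dF.
by rewrite mul1r mul0r addr0; move: (ev _ _) (ev _ _) => x y; ring.
Qed.

End Lift.

(** The coefficients of (l_0 u + l_1 v)^6, and below of (l_0 u + l_1 v)^5 (m_0 u + m_1 v). *)
Definition bin6 (l0 l1 : K) (k : nat) : K := 'C(6, k)%:R * (l0 ^+ (6 - k) * l1 ^+ k).

Lemma sextval_pow6 c l0 l1 u v : sextval (fun k : 'I_7 => c * bin6 l0 l1 k) u v = c * (l0 * u + l1 * v) ^+ 6.
Proof.
rewrite /sextval !big_ord_recl big_ord0 /bin6 /= /bump /= !subn0 ?subSS ?subn0.
rewrite (_ : 'C(6, 0) = 1%N) // (_ : 'C(6, 1) = 6%N) // (_ : 'C(6, 2) = 15%N) //.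
rewrite (_ : 'C(6, 3) = 20%N) // (_ : 'C(6, 4) = 15%N) // (_ : 'C(6, 5) = 6%N) // (_ : 'C(6, 6) = 1%N) //.
ring.
Qed.

Definition bin51 (l0 l1 m0 m1 : K) (k : nat) : K :=
  match k with
  | 0 => l0 ^+ 5 * m0 | 1 => 5 * l0 ^+ 4 * l1 * m0 + l0 ^+ 5 * m1
  | 2 => 10 * l0 ^+ 3 * l1 ^+ 2 * m0 + 5 * l0 ^+ 4 * l1 * m1
  | 3 => 10 * l0 ^+ 2 * l1 ^+ 3 * m0 + 10 * l0 ^+ 3 * l1 ^+ 2 * m1
  | 4 => 5 * l0 * l1 ^+ 4 * m0 + 10 * l0 ^+ 2 * l1 ^+ 3 * m1
  | 5 => l1 ^+ 5 * m0 + 5 * l0 * l1 ^+ 4 * m1 | _ => l1 ^+ 5 * m1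
  end.

Lemma sextval_bin51 l0 l1 m0 m1 u v : sextval (fun k : 'I_7 => bin51 l0 l1 m0 m1 k) u v =
  (l0 * u + l1 * v) ^+ 5 * (m0 * u + m1 * v).
Proof.
rewrite /sextval !big_ord_recl big_ord0 /bin51 /= /bump /= !subn0 ?subSS ?subn0.
ring.
Qed.

Lemma hess_homog d (f : 'I_7 -> binform R) u v : (forall k, f k \is d.-homog) ->
  hess f u%:MP v%:MP \is (d + d).-homog.
Proof.
move=> hf; have hi j : f (inord j) \is d.-homog by exact: hf.
rewrite /hess /hess_uu /hess_vv /hess_uv; hmgd.
Qed.

Lemma ev_hess q (f : 'I_7 -> binform R) u v :
  ev q (hess f u%:MP v%:MP) = hess (fun k => ev q (f k)) u v.
Proof.
exact: etrans (hess_rmorph (meval (fun k => q k 0)) f u%:MP v%:MP)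
  (f_equal2 (hess _) (mevalC _ _) (mevalC _ _)).
Qed.

Lemma mderiv_hess i (f : 'I_7 -> binform R) u v :
  mderiv i (hess f u%:MP v%:MP) = hess_polar f (fun k => mderiv i (f k)) u%:MP v%:MP.
Proof.
exact: (hess_derivation f (mderivD i) (mderivM i) (mderivC i u) (mderivC i v)).
Qed.

Lemma ev_hess_polar q (f d : 'I_7 -> binform R) u v :
  ev q (hess_polar f d u%:MP v%:MP) = hess_polar (fun k => ev q (f k)) (fun k => ev q (d k)) u v.
Proof.
exact: etrans (hess_polar_rmorph (meval (fun k => q k 0)) f d u%:MP v%:MP)
  (f_equal2 (hess_polar _ _) (mevalC _ _) (mevalC _ _)).
Qed.

Lemma double_zero d p (f : binform R) : p != 0 -> f \is d.+2.-homog -> ev p f = 0 ->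
  (forall i, ev p (mderiv i f) = 0) -> exists r, f = lin p ^+ 2 * r.
Proof.
move=> p0 hf fp df; have [f' hf' E] := form_factor p0 hf fp.
have dl0 : mderiv 0 (lin p) = (p 1 0)%:MP.
  rewrite /lin mderivB !mderiv_mulC !mderivX !mnm1E /= scale0r mulr0 subr0 scale1r.
  by rewrite (_ : (_ - _)%MM = 0%MM) ?mpolyX0 ?mulr1 //; apply/mnmP => m; rewrite mnmBE subnn mnm0E.
have dl1 : mderiv 1 (lin p) = - (p 0 0)%:MP.
  rewrite /lin mderivB !mderiv_mulC !mderivX !mnm1E /= scale0r mulr0 sub0r scale1r.
  by rewrite (_ : (_ - _)%MM = 0%MM) ?mpolyX0 ?mulr1 //; apply/mnmP => m; rewrite mnmBE subnn mnm0E.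
have lp : ev p (lin p) = 0 by rewrite ev_lin mulrC subrr.
have dE i : ev p (mderiv i (lin p)) * ev p f' = 0.
  have := df i; rewrite E mderivM evD (evM p (mderiv i (lin p))) (evM p (lin p)) lp mul0r addr0; exact.
have f'p : ev p f' = 0.
  have := dE 0; have := dE 1; rewrite dl0 dl1 evN !evC => /eqP h1 /eqP h0.
  apply/eqP; apply: contraT => nz; rewrite mulf_eq0 (negbTE nz) orbF in h0.
  rewrite mulf_eq0 (negbTE nz) orbF oppr_eq0 in h1.
  by case/negP: p0; rewrite (ptE p) (eqP h0) (eqP h1) pt_eq0 eqxx.
have [r _ E'] := form_factor p0 hf' f'p; exists r.
by rewrite E E' expr2 mulrA.
Qed.

(** The Hessian of a sixth power is zero, and so is its differential in the direction of
    l^5 m, because the Hessian of l^5 (c l + e m) is a multiple of e^2: a curve tangent to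
    the one-dimensional orbit has a Hessian with a double zero at the point of tangency. *)
Lemma tangent6_hess (F : 'rV[binform R]_7) : (forall k, F 0 k \is 6.-homog) -> tangent6 F ->
  exists2 p, p != 0 & forall u v, exists r, hess (fun k => F 0 k) u%:MP v%:MP = lin p ^+ 2 * r.
Proof.
move=> hF [p [l0 [l1 [c [p0 _ _ E H]]]]]; exists p => // u v.
have cE : (fun k => ev p (F 0 k)) =1 (fun k : 'I_7 => c * bin6 l0 l1 k).
  by apply: sextval_inj => x y; rewrite E sextval_pow6.
apply: (double_zero p0 (hess_homog u v hF : _ \is 12.-homog)).
  rewrite ev_hess /hess /hess_uu /hess_vv /hess_uv !cE !inordK // /bin6 /=.
  rewrite (_ : 'C(6, 0) = 1%N) // (_ : 'C(6, 1) = 6%N) // (_ : 'C(6, 2) = 15%N) //.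
  rewrite (_ : 'C(6, 3) = 20%N) // (_ : 'C(6, 4) = 15%N) // (_ : 'C(6, 5) = 6%N) // (_ : 'C(6, 6) = 1%N) //.
  ring.
move=> i; have [m0 [m1 Hi]] := H i.
have dE : (fun k => ev p (mderiv i (F 0 k))) =1 (fun k : 'I_7 => bin51 l0 l1 m0 m1 k).
  by apply: sextval_inj => x y; rewrite Hi sextval_bin51.
rewrite mderiv_hess ev_hess_polar /hess_polar /hess_uu /hess_vv /hess_uv !cE !dE !inordK // /bin6 /bin51 /=.
rewrite (_ : 'C(6, 0) = 1%N) // (_ : 'C(6, 1) = 6%N) // (_ : 'C(6, 2) = 15%N) //.
rewrite (_ : 'C(6, 3) = 20%N) // (_ : 'C(6, 4) = 15%N) // (_ : 'C(6, 5) = 6%N) // (_ : 'C(6, 6) = 1%N) //.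
ring.
Qed.

End Tangency.

(** * The second family *)

Section Exceptional.
Variable R : realType.
Notation K := R[i].
Implicit Types (q p : 'cV[K]_2) (a b : K).
Notation xi := (@xi1 R).

(** The plane curve on which the parameters of the second family lie. *)
Definition exc_rel a b : K :=
  (2 - a) * (b ^+ 4 + 6 * b ^+ 2 * (1 - a) + (1 - a) ^+ 2) - 8 * b * (1 - a) * (b ^+ 2 + (1 - a)).

(** For k > 0 the form [exc_form] has the factor (Y - a X)^k. *)
Lemma exc_root a b k : (0 < k)%N -> ev (pt 1 a) (exc_form a b k) = 0.
Proof.
move=> k0; rewrite ev_exc_form pt0 pt1 !mulr1 subrr /six_coef oppr0 expr0n.
by case: k k0 => // ? _; rewrite mul0r.
Qed.

Lemma exc_root0 a b : ev (pt 1 a) (exc_form a b 0) = (1 - a - b ^+ 2) * exc_rel a b.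
Proof. rewrite ev_exc_form pt0 pt1 /six_coef /exc_coef /exc_rel; ring. Qed.

Lemma exc_div a b : exc_rel a b = 0 -> exists e : 'I_7 -> binform R,
  forall k : 'I_7, e k \is 6.-homog /\ exc_form a b k = lin (pt 1 a) * e k.
Proof.
move=> E; suff /fin_all_exists[e he] : forall k : 'I_7, exists e : binform R,
  e \is 6.-homog /\ exc_form a b k = lin (pt 1 a) * e by exists e.
move=> k.
have p0 : pt 1 a != 0 :> 'cV[K]_2 by rewrite pt_neq0 // oner_neq0.
have [|e he Ee] := form_factor p0 (exc_form_homog a b (ltn_ord k)); last by exists e.
by case: (nat_of_ord k) => [|m]; [rewrite exc_root0 E mulr0|exact: exc_root].
Qed.

Definition wform a : binform R := a%:MP * alpha2 ^+ 2 + gamma ^+ 2.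

Lemma ev_wform q a : ev q (wform a) = a * al q ^+ 2 + ga q ^+ 2.
Proof. by rewrite /wform evD evM evC !evX ev_alpha2 ev_gamma. Qed.

Lemma wform_homog a : wform a \is 4.-homog.
Proof.
rewrite /wform; have := homog_alpha2 R; have := homog_gamma R.
move: alpha2 gamma => s r hr hs; hmgd.
Qed.

Lemma wform_neq0 a : wform a != 0.
Proof.
suff : ev (pt 1 1) (wform a) != 0 by apply: contra_neq => ->; rewrite ev0.
rewrite ev_wform al_pt ga_pt !expr1n subrr mul0r expr0n mulr0 add0r mulr1 expr1n.
exact: oner_neq0.
Qed.

Lemma pull_hess (phi : 'cV[binform R]_2) (f : 'I_7 -> binform R) u v :
  pull phi (hess f u%:MP v%:MP) = hess (fun k => pull phi (f k)) u%:MP v%:MP.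
Proof.
exact: etrans (hess_rmorph (comp_mpoly [tuple phi i 0 | i < 2]) f u%:MP v%:MP)
  (f_equal2 (hess _) (comp_mpolyC _ _) (comp_mpolyC _ _)).
Qed.

Lemma x4_y4 q : al q * be q = 0 -> q 0 0 ^+ 4 = q 1 0 ^+ 4.
Proof. by move=> h; rewrite x4E y4E h mulr0 addr0 subr0. Qed.

Lemma x4_y4_nz q : q != 0 -> al q * be q = 0 -> q 0 0 != 0 /\ q 1 0 != 0.
Proof.
move=> q0 /x4_y4 E; have : (q 0 0 == 0) = (q 1 0 == 0).
  by have := congr1 (eq_op^~ 0) E; rewrite /= !expf_eq0.
by move: q0; rewrite {1}(ptE q) pt_eq0 => + e; rewrite e; case: (q 1 0 == 0).
Qed.

(** F is linearly full, and so is the curve f_1 o g. *)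
Lemma lift_octa_full n (F : 'rV[binform R]_7) (g : 'M[binform R]_2) (c : 'cV[K]_7) :
  octa_lift (phi0 R) n F g ->
  (forall q, \sum_(k < 7) octa_mx (mat_at g q) k * c k 0 = 0) -> c = 0.
Proof.
move=> L H; have [_ [h [hh h0 Eh]]] := lift_factor L.
apply: (lift_full L); apply/rowP => j; rewrite [RHS]mxE.
have -> : j = 0 by apply/val_inj; case: j => -[].
have TE : (F *m const_form c) 0 0 = \sum_k F 0 k * (c k 0)%:MP.
  by rewrite mxE; apply: eq_bigr => k _; rewrite [const_form _ _ _]mxE.
rewrite TE; set T := \sum_k _.
have hT : T \is 6.-homog.
  by apply: rpred_sum => k _; rewrite mulrC; apply: homCM; exact: (lift_F L).
have evT p : ev p T = \sum_k ev p (F 0 k) * c k 0.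
  rewrite /T; exact: etrans (rmorph_sum (meval (fun k => p k 0)) _ _ _)
    (eq_bigr _ (fun k _ => etrans (evM _ _ _) (congr1 _ (evC _ _)))).
have : h * pull (phi0 R) T = 0.
  apply: (form_ext (homM hh (pull_phi0_homog hT))) => q _.
  rewrite (evM q h) ev_pull evT mulr_sumr -[RHS](H q); apply: eq_bigr => k _.
  by rewrite mulrA -ev_octa_g Eh (evM q h) ev_pull.
move/eqP; rewrite mulf_eq0 (negbTE h0) => /eqP E.
by apply: (form_phi0_ext hT) => q _; rewrite -ev_pull E ev0.
Qed.

Lemma covar_det (g : 'M[binform R]_2) z a b : (forall i j, g i j \is 5.-homog) ->
  (forall q, mat_at g q = covar z a 1 0 b 0 1 q) ->
  \det g = (2 * z)%:MP * (gamma * wform a) * (alpha2 * beta2).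
Proof.
move=> hg Hg; apply: (form_eq (det_homog hg)) => [|x y].
  have := homog_alpha2 R; have := homog_beta2 R; have := homog_gamma R; have := wform_homog a.
  move: alpha2 beta2 gamma (wform a) => s t r w hw hr ht hs; hmgd.
rewrite ev_det Hg det_covar !(ev_wform, ev_gamma, ev_alpha2, ev_beta2, evC, evM).
by move: (al _) (be _) (ga _) => s t r; ring.
Qed.

Section Lift.
Variables (F : 'rV[binform R]_7) (g : 'M[binform R]_2) (z a b : K).
Hypotheses (L : octa_lift (phi0 R) 5 F g) (Hg : forall q, mat_at g q = covar z a 1 0 b 0 1 q).
Hypothesis hz : z ^+ 4 = -1.

Let z0 : z != 0.
Proof. by apply: contra_eq_neq hz => ->; rewrite expr0n eq_sym oppr_eq0 oner_eq0. Qed.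

(** At the zeros of alpha_2 beta_2 the two rows, as linear forms in u and v, are
    proportional, with ratio z y : - x, where x^4 = y^4. *)
Lemma exc_rows q : q != 0 -> al q * be q = 0 -> exists u v t, t != 0 /\
   ev q (octa_row1 g u v) = z * q 1 0 * t /\ ev q (octa_row2 g u v) = - q 0 0 * t.
Proof.
move=> q0 h; have [u [v uv]] := row_nz L q0.
pose t := (b * al q ^+ 2) * u - (a * al q ^+ 2 + ga q ^+ 2) * v.
have E1 : ev q (octa_row1 g u v) = z * q 1 0 * t.
  rewrite /octa_row1 evD !evM !evC evN -!mat_atE Hg /covar !mx22E.
  by rewrite /t; move: (al q) (be q) (ga q) h => s s' r h'; ring: h'.
have E2 : ev q (octa_row2 g u v) = - q 0 0 * t.
  rewrite /octa_row2 evD !evM !evC evN -!mat_atE Hg /covar !mx22E.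
  by rewrite /t; move: (al q) (be q) (ga q) h => s s' r h'; ring: h'.
exists u, v, t; split=> //; apply/eqP => t0; move: uv.
by rewrite E1 E2 t0 !mulr0 eqxx; case.
Qed.

Lemma exc_oct_nz q : q != 0 -> al q * be q = 0 -> exists k, ev q (octa_g g k) != 0.
Proof.
move=> q0 h; have [x0 y0] := x4_y4_nz q0 h; have [u [v [t [t0 [E1 E2]]]]] := exc_rows q0 h.
apply/existsP; apply: contraT; rewrite negb_exists => /forallP H.
have := ev_octa_row g q u v; rewrite ev_octa E1 E2 big1 => [|k _]; last first.
  by have := H k; rewrite negbK => /eqP->; rewrite mul0r.
have hx := x4_y4 h; have -> : octa (z * q 1 0 * t) (- q 0 0 * t) = 2 * z * q 1 0 * q 0 0 * (q 0 0 ^+ 4 * t ^+ 6).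
  by rewrite /octa; ring: hx hz.
by move/eqP; apply: contraLR => _; rewrite !mulf_neq0 ?expf_neq0 ?pnatr_eq0.
Qed.

(** Where det g is not zero this holds for any lift. At the zeros of alpha_2 beta_2 the
    rows are z y t and - x t with x^4 = y^4 and z^4 = -1, so octa8 is (1 - 14 + 1) (x t)^8; at
    the other zeros of det g it follows from the hypothesis by [octa8_nz]. *)
Lemma exc_octa8_nz q :
  (forall q, ga q * (a * al q ^+ 2 + ga q ^+ 2) = 0 -> forall k, ev q (octa_g g k) = 0) ->
  q != 0 -> exists u v, ev q (octa8 (octa_row1 g u v) (octa_row2 g u v)) != 0.
Proof.
move=> H q0; have [h|h] := eqVneq (al q * be q) 0.
  have [x0 y0] := x4_y4_nz q0 h; have [u [v [t [t0 [E1 E2]]]]] := exc_rows q0 h.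
  exists u, v; rewrite ev_octa8 E1 E2.
  have hx := x4_y4 h; have -> : octa8 (z * q 1 0 * t) (- q 0 0 * t) = - 12 * (q 0 0 ^+ 8 * t ^+ 8).
    by rewrite /octa8; ring: hx hz.
  by rewrite !mulf_neq0 ?expf_neq0 ?oppr_eq0 ?pnatr_eq0.
have [d0|d0] := eqVneq (ev q (\det g)) 0.
  apply: (octa8_nz L q0); apply: H.
  move: d0; rewrite (covar_det (lift_g L) Hg) !(ev_wform, ev_gamma, ev_alpha2, ev_beta2, evC, evM) => /eqP.
  rewrite mulf_eq0 (negbTE h) orbF mulf_eq0 => /orP[|/eqP//].
  by rewrite mulf_eq0 pnatr_eq0 /= (negbTE z0).
exists (mat_at g q 0 0), (mat_at g q 1 0).
have E1 : ev q (octa_row1 g (mat_at g q 0 0) (mat_at g q 1 0)) = ev q (\det g).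
  by rewrite /octa_row1 evD !evM !evC evN -!mat_atE ev_det det2; ring.
have E2 : ev q (octa_row2 g (mat_at g q 0 0) (mat_at g q 1 0)) = 0.
  by rewrite /octa_row2 evD !evM !evC evN -!mat_atE; ring.
by rewrite ev_octa8 E1 E2 /octa8 !expr0n /= mulr0 !addr0 expf_eq0 /=.
Qed.

(** If F were tangent to the one-dimensional orbit at p, its Hessian would be divisible by
    (lin p)^2. By [lift_hess] the Hessian of F o phi is, up to a constant,
    (alpha_2 beta_2)^2 octa8 of the rows, and octa8 has no zero common to all u and v. So
    (lin p o phi)^2 is a multiple of (alpha_2 beta_2)^2; but phi maps the zeros of alpha_2 and
    of beta_2 to two different points. *)
Lemma exc_not_tangent : exc_rel a b = 0 -> ~ tangent6 F.
Proof.
move=> rel T; have [e he] := exc_div rel.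
pose P : binform R := (- (2 * z))%:MP * (gamma * wform a).
have hP : P \is 6.-homog.
  rewrite /P; have := homog_gamma R; have := wform_homog a.
  move: gamma (wform a) => r w hw hr; hmgd.
have P0 : P != 0.
  apply: mulf_neq0; first by rewrite mpolyC_eq0 oppr_eq0 mulf_neq0 // two_neq0.
  exact: mulf_neq0 (gamma_neq0 R) (wform_neq0 a).
have evP q : ev q P = - (2 * z) * (ga q * (a * al q ^+ 2 + ga q ^+ 2)).
  by rewrite /P !(ev_wform, ev_gamma, evC, evM).
have PE q k : octa_mx (mat_at g q) k = ev q P * ev (mat_at (phi0 R) q) (e k).
  rewrite Hg octa_mx_exc // (he k).2 evM ev_lin mat_phi0 evP !pt0 !pt1.
  by rewrite mulrA; congr (_ * _); ring.
have [c c0 [_ cE]] := lift_unique L hP P0 (fun k => (he k).1) PE.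
have [p p0 hp] := tangent6_hess (lift_F L) T.
pose l := pull (phi0 R) (lin p).
have hl : l \is 4.-homog by have := pull_phi0_homog (lin_homog p); rewrite muln1.
have l0 : l != 0.
  apply: contra_neq (lin_ne0 p0) => E; apply: (form_phi0_ext (lin_homog p)) => q _.
  by rewrite -ev_pull -/l E ev0.
have hAB : (alpha2 * beta2 : binform R) \is 4.-homog.
  by have := homog_alpha2 R; have := homog_beta2 R; move: alpha2 beta2 => s t ht hs; hmgd.
have AB0 : alpha2 * beta2 != 0 :> binform R := mulf_neq0 (alpha2_neq0 R) (beta2_neq0 R).
have [|||||q q0 _|le [r hr E]] := @form_cancel R (K * K)%type
   (fun w => octa8 (octa_row1 g w.1 w.2) (octa_row2 g w.1 w.2))
   (4 * 2)%N (4 * 2)%N (l ^+ 2) ((alpha2 * beta2) ^+ 2).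
- exact: homX.
- by rewrite expf_neq0.
- exact: homX.
- by rewrite expf_neq0.
- move=> [u v] /=; have H := lift_hess cE u v.
  have [r Er] := hp u v; have := pull_hess (phi0 R) (fun k => F 0 k) u v.
  have Ep : pull (phi0 R) (lin p ^+ 2 * r) = l ^+ 2 * pull (phi0 R) r.
    exact: etrans (rmorphM (comp_mpoly _) _ _) (congr1 ( *%R^~ _) (rmorphXn (comp_mpoly _) _ _)).
  rewrite Er Ep => {}Ep; rewrite -Ep (covar_det (lift_g L) Hg) in H.
  move: (octa8 _ _) (pull _ _) H => o s; rewrite /P.
  move: (gamma * wform a) (mulf_neq0 (gamma_neq0 R) (wform_neq0 a)) => w w0 H.
  exists ((- 25 * c ^+ 2)^-1%:MP * s).
  have nz : - 25 * c ^+ 2 != 0 :> K by rewrite mulf_neq0 ?expf_neq0 // oppr_eq0 pnatr_eq0.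
  apply: (mulfI (_ : (2 * z)%:MP * w != 0)).
    by rewrite mulf_neq0 // mpolyC_eq0 mulf_neq0 // two_neq0.
  apply: (mulfI (_ : (2 * z)%:MP * w != 0)).
    by rewrite mulf_neq0 // mpolyC_eq0 mulf_neq0 // two_neq0.
  apply: (mulfI (_ : (- 25 : K)%:MP != 0)); first by rewrite mpolyC_eq0 oppr_eq0 pnatr_eq0.
  have E25 : - 25 = (- 25 : K)%:MP :> binform R.
    by rewrite mpolyCN; congr (- _); exact: esym (rmorph_nat _ _).
  have Ec : (- 25 : K)%:MP * (- 25 * c ^+ 2)^-1%:MP = c^-1%:MP ^+ 2 :> binform R.
    rewrite -mpolyCM -rmorphXn; congr (_%:MP); field.
    by rewrite c0.
  have := H; rewrite E25 mpolyCN => {}H; move: Ec H.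
  move: (_%:MP) (_%:MP) (_%:MP) (_%:MP) => k1 k2 k3 k4 Ec H.
  ring: Ec H.
- have [q' h k|u [v uv]] := exc_octa8_nz _ q0; last by exists (u, v).
  by rewrite ev_octa_g PE evP h mulr0 mul0r.
have rE := form0_const hr; move: rE E; set k := r@__ => -> E.
have evE q : (al q * be q) ^+ 2 = ev (mat_at (phi0 R) q) (lin p) ^+ 2 * k.
  by have := congr1 (ev q) E; rewrite evM !evX evC ev_pull evM ev_alpha2 ev_beta2.
have k0 : k != 0.
  apply/eqP => y; have /eqP : (alpha2 * beta2 : binform R) ^+ 2 = 0 by rewrite E y mpolyC0 mulr0.
  by rewrite expf_eq0 (negbTE AB0).
have zero q : al q * be q = 0 -> ev (mat_at (phi0 R) q) (lin p) = 0.
  move=> h; have := evE q; rewrite h expr0n /= => /esym/eqP.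
  by rewrite mulf_eq0 (negbTE k0) orbF expf_eq0 => /eqP.
(* phi maps the zero [1, 1] of alpha_2 to [0, 1] and the zero [1, i] of beta_2 to [1, 1]. *)
have p1 : p 0 0 = 0.
  have := zero (pt 1 1); rewrite mat_phi0 ev_lin al_pt be_pt ga_pt !pt0 !pt1 !expr1n subrr !mul0r.
  by rewrite expr0n oppr0 mulr0 sub0r mulr1 expr1n mulr1 => /(_ erefl) /eqP; rewrite oppr_eq0 => /eqP.
have p2 : p 1 0 = 0.
  have := zero (pt 1 (xi ^+ 2)); rewrite mat_phi0 ev_lin al_pt be_pt ga_pt !pt0 !pt1 p1 xi22.
  rewrite !expr1n subrr mul0r mulr0 mul0r subr0 opprK => /(_ erefl) /eqP.
  by rewrite mulf_eq0 oppr_eq0 expf_eq0 (_ : (1 + 1) / 2 = 1) ?oner_eq0 ?orbF; [move/eqP|field].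
by move: p0; rewrite (ptE p) p1 p2 pt_eq0 eqxx.
Qed.

(** For b^2 = 1 - a the curve F lies in the hyperplane
    20 b^3 F_0 - 10 b^2 F_1 + 4 b F_2 - F_3 = 0, so it is not linearly full. *)
Lemma exc_not_square : b ^+ 2 <> 1 - a.
Proof.
move=> hb; have Ea : a = 1 - b ^+ 2 by rewrite hb opprB addrC subrK.
pose c : 'cV[K]_7 := \col_k nth 0 [:: 20 * b ^+ 3; - 10 * b ^+ 2; 4 * b; -1] k.
have c3 : c (inord 3) 0 = -1 by rewrite mxE inordK.
suff c0 : c = 0 by move/eqP: c3; rewrite c0 mxE eq_sym oppr_eq0 oner_eq0.
apply: (lift_octa_full L) => q.
transitivity (\sum_(k < 7) 2 * z * ga q * (ev (mat_at (phi0 R) q) (exc_form a b k) *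
    nth 0 [:: 20 * b ^+ 3; - 10 * b ^+ 2; 4 * b; -1] k)).
  by apply: eq_bigr => k _; rewrite mxE Hg octa_mx_exc // -[LHS]mulrA.
rewrite -mulr_sumr; apply/eqP; rewrite mulf_eq0; apply/orP; right; apply/eqP.
move: (mat_at _ _) => p.
transitivity (\sum_(k < 7) six_coef (exc_coef (p 0 0 ^+ 2 - p 0 0 * p 1 0) (p 1 0 - 2 * p 0 0))
  (p 1 0 - a * p 0 0) (- (b * p 0 0)) k * nth 0 [:: 20 * b ^+ 3; - 10 * b ^+ 2; 4 * b; -1] k).
  by apply: eq_bigr => k _; rewrite ev_exc_form.
rewrite !big_ord_recl big_ord0 /= /bump /= !add1n /= Ea /six_coef /exc_coef; ring.
Qed.

(** As in [lift_deg_le], h^2 divides (det g)^2. At the zeros of alpha_2 beta_2 the curve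
    f_1 o g does not vanish, hence h does not, and h^2 divides (gamma w)^2 where
    w = a alpha_2^2 + gamma^2; both have degree 12, so they are proportional. Therefore the
    coordinates [exc_form] of f_1 o g / gamma, composed with phi, are divisible by w = (Y - a X) o phi,
    and [exc_form] 0 vanishes at [1, a]. *)
Lemma exc_necessary : exc_rel a b = 0.
Proof.
have [_ [h [hh h0 Eh]]] := lift_factor L.
have [|||||q q0|_ [r hr E]] := @form_cancel R (K * K)%type
   (fun w => octa8 (octa_row1 g w.1 w.2) (octa_row2 g w.1 w.2))
   ((5 * 6 - 24) * 2)%N ((5 + 5) * 2)%N (h ^+ 2) ((\det g) ^+ 2).
- exact: homX.
- by rewrite expf_neq0.
- by apply: homX; exact: (det_homog (lift_g L)).
- by rewrite expf_neq0 // (lift_det L).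
- by move=> w; exact: (lift_hess_dvd Eh).
- rewrite evX => /eqP; rewrite expf_eq0 /= => /eqP hq.
  have [|u [v uv]] := octa8_nz L q0; last by exists (u, v).
  by move=> k; rewrite Eh evM hq mul0r.
pose W : binform R := (2 * z)%:MP * (gamma * wform a).
have W0 : W != 0.
  apply: mulf_neq0; first by rewrite mpolyC_eq0 mulf_neq0 // two_neq0.
  exact: mulf_neq0 (gamma_neq0 R) (wform_neq0 a).
have hW : W \is 6.-homog.
  by have := homog_gamma R; have := wform_homog a; rewrite /W; move: gamma (wform a) => s w hw hs; hmgd.
have [|||||q q0|_ [k hk Ek]] := @form_cancel R unit (fun=> (alpha2 * beta2) ^+ 2)
   (6 * 2)%N (6 * 2)%N (h ^+ 2) (W ^+ 2).
- exact: homX.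
- by rewrite expf_neq0.
- exact: homX.
- by rewrite expf_neq0.
- by move=> _; exists r; rewrite -E (covar_det (lift_g L) Hg) -exprMn.
- rewrite evX => /eqP; rewrite expf_eq0 /= => /eqP hq; exists tt.
  rewrite evX expf_neq0 // evM ev_alpha2 ev_beta2; apply/eqP => h'.
  have [k] := exc_oct_nz q0 h'.
  by rewrite Eh evM hq mul0r eqxx.
have kE := form0_const hk; move: kE Ek; set k' := k@__ => -> E'.
have k0 : k' != 0.
  apply/eqP => y; have /eqP : W ^+ 2 = 0 by rewrite E' y mpolyC0 mulr0.
  by rewrite expf_eq0 (negbTE W0).
have [q q0 hq] := form_zero (isT : (0 < 4)%N) (wform_homog a).
rewrite ev_wform in hq.
have a0 : al q != 0.
  apply/eqP => h'; apply: (al_ga q0 h').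
  by move: hq; rewrite h' expr0n mulr0 add0r => /eqP; rewrite expf_eq0 => /eqP.
have Eq : mat_at (phi0 R) q = (- al q ^+ 2) *: pt 1 a.
  by rewrite mat_phi0 scale_pt mulr1; congr pt; apply/eqP; rewrite -subr_eq0 -hq; apply/eqP; ring.
have G0 : octa_g g 0 = (2 * z)%:MP * gamma * pull (phi0 R) (exc_form a b 0).
  apply: (form_eq (octa_g_homog 0 (lift_g L))) => [|x y].
    have hx := pull_phi0_homog (exc_form_homog a b (isT : (0 < 7)%N)).
    exact: homM (homCM _ (homog_gamma R)) hx.
  by rewrite ev_octa_g Hg octa_mx_exc // !(evC, evM _ _ (pull _ _), ev_gamma, ev_pull, evM).
have ez : ev (pt 1 a) (exc_form a b 0) = 0.
  have e0 : W ^+ 2 * pull (phi0 R) (F 0 0) ^+ 2 = k'%:MP * octa_g g 0 ^+ 2.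
    by rewrite Eh E'; move: (_%:MP) (pull _ _) => s t; ring.
  have e1 : wform a ^+ 2 * pull (phi0 R) (F 0 0) ^+ 2 = k'%:MP * pull (phi0 R) (exc_form a b 0) ^+ 2.
    apply: (mulfI (_ : ((2 * z)%:MP * gamma) ^+ 2 != 0)).
      by rewrite expf_neq0 // mulf_neq0 ?gamma_neq0 // mpolyC_eq0 mulf_neq0 // two_neq0.
    have := e0; rewrite G0 /W; move: (pull _ _) (pull _ _) (_%:MP) (_%:MP) => s t m n H'; ring: H'.
  have : k' * (ev (mat_at (phi0 R) q) (exc_form a b 0)) ^+ 2 = 0.
    rewrite -ev_pull -evX -[k'](evC q) -evM -e1 evM !evX ev_wform hq expr0n mul0r //.
  move/eqP; rewrite mulf_eq0 (negbTE k0) expf_eq0 /= Eq (form_scale _ _ (exc_form_homog a b (isT : (0 < 7)%N))).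
  by rewrite mulf_eq0 expf_eq0 oppr_eq0 expf_eq0 (negbTE a0) /= => /eqP.
move: ez; rewrite exc_root0 => /eqP; rewrite mulf_eq0 => /orP[|/eqP//].
by rewrite subr_eq0 => /eqP e; case: exc_not_square.
Qed.

End Lift.
End Exceptional.

(** * The parameter t *)

Lemma eq_of_multiple (T : pzRingType) (c l r x y : T) : l = r -> x - y = c * (l - r) -> x = y.
Proof. by move=> -> H; apply/eqP; rewrite -subr_eq0 H subrr mulr0. Qed.

Section Planes.
Variable R : realType.
Notation K := R[i].
Implicit Types (q p : 'cV[K]_2) (a b t : K).
Notation xi := (@xi1 R).

Definition nv0 t : K := (t ^+ 2 - 1) ^+ 2 * (xi - t).
Definition nv1 t : K := 4 * (xi - t) * t ^+ 2.
Definition nv2 t : K := (t ^+ 4 - 1) * (xi + t).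

Lemma sum3E (V : nmodType) (f : 'I_3 -> V) : \sum_i f i = f (inord 0) + f (inord 1) + f (inord 2).
Proof.
rewrite !big_ord_recl big_ord0 addr0 addrA; congr (f _ + f _ + f _); apply/val_inj;
by rewrite /= inordK.
Qed.

Lemma plane_mul a b t : (plane a b *m (normal_vec t)^T == 0) =
  (a * nv0 t + nv1 t == 0) && (b * nv0 t + nv2 t == 0).
Proof.
have E0 : (plane a b *m (normal_vec t)^T) 0 0 = a * nv0 t + nv1 t.
  by rewrite mxE sum3E !mxE /= ?inordK //= mul1r mul0r addr0.
have E1 : (plane a b *m (normal_vec t)^T) 1 0 = b * nv0 t + nv2 t.
  by rewrite mxE sum3E !mxE /= ?inordK //= mul1r mul0r addr0.
apply/eqP/andP => [E|[/eqP e0 /eqP e1]].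
  by rewrite -E0 -E1 E !mxE.
apply/colP => i; rewrite [RHS]mxE; have [->|->] := ord2P i; last by rewrite E1.
by rewrite E0.
Qed.

Lemma rank_plane a b : \rank (plane a b) = 2%N.
Proof.
apply/eqP; rewrite -/(row_free _); apply/row_freeP.
exists (\matrix_(i < 3, j < 2) (i == j.+1 :> nat)%:R); apply: eqmx2;
by rewrite [LHS]mxE sum3E !mxE /= !inordK //= !(mulr0, mulr1, addr0, add0r).
Qed.

Lemma rank_normal t : \rank (kermx (normal_vec t)^T) = (3 - (normal_vec t != 0%R))%N.
Proof. by rewrite mxrank_ker mxrank_tr rank_rV. Qed.

(** Perpendicularity determines a and b as soon as the first coordinate of the normal vector is
    not zero; it is not, since otherwise the whole normal vector would vanish. *)
Lemma plane_perpP t a b : plane_perp t a b <->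
  [/\ nv0 t != 0, a * nv0 t + nv1 t = 0 & b * nv0 t + nv2 t = 0].
Proof.
rewrite /plane_perp; split=> [E|[n0 /eqP e1 /eqP e2]].
  have : (plane a b <= kermx (normal_vec t)^T)%MS by rewrite E.
  move/sub_kermxP/eqP; rewrite plane_mul => /andP[/eqP e1 /eqP e2]; split=> //.
  apply/eqP => n0; move: e1 e2; rewrite n0 !mulr0 !add0r => n1 n2.
  have := rank_plane a b; rewrite E rank_normal (_ : normal_vec t = 0) ?eqxx //.
  move: n0 n1 n2; rewrite /nv0 /nv1 /nv2 => n0 n1 n2.
  apply/rowP => j; rewrite !mxE /=.
  by case: j => -[|[|[|//]]].
have S : (plane a b <= kermx (normal_vec t)^T)%MS.
  by apply/sub_kermxP/eqP; rewrite plane_mul e1 e2.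
apply/eqmxP; rewrite -(geq_leqif (mxrank_leqif_eq S)) rank_plane rank_normal.
suff -> : normal_vec t != 0 by [].
by apply: contraNneq n0 => E; have := congr1 (fun M : 'rV_3 => M 0 0) E; rewrite !mxE /= => <-.
Qed.

(** Put P = t^2 - 1, Q = t^2 + 1, s = xi - t and r = xi + t. Then 1 - a = (Q/P)^2 and
    b = - Q r / (P s), and up to a factor the relation is
    (P^2 + Q^2) (r^4 + 6 r^2 s^2 + s^4) + P Q (8 r s (r^2 + s^2)) = 0. Here the second factors are
    half the sum and the difference of (r + s)^4 = 16 xi^4 and (r - s)^4 = 16 t^4, that is,
    8 P Q and - 8 (P^2 + Q^2). *)
Lemma perp_exc_rel t a b : plane_perp t a b -> exc_rel a b = 0.
Proof.
case/plane_perpP => n0 e1 e2.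
have : (t ^+ 2 - 1) ^+ 2 * (xi - t) != 0 by [].
rewrite mulf_eq0 negb_or expf_eq0 /= => /andP[P0 s0].
have Ea : (1 - a) * (t ^+ 2 - 1) ^+ 2 = (t ^+ 2 + 1) ^+ 2.
  by apply: (mulfI s0); apply: (eq_of_multiple (c := -1) e1); rewrite /nv0 /nv1; ring.
have Eb : b * (t ^+ 2 - 1) * (xi - t) = - (t ^+ 2 + 1) * (xi + t).
  by apply: (mulfI P0); apply: (eq_of_multiple (c := 1) e2); rewrite /nv0 /nv2; ring.
have hx := xi4 R; set P := t ^+ 2 - 1 in Ea Eb P0; set Q := t ^+ 2 + 1 in Ea Eb.
set m := 1 - a in Ea.
have am : 2 - a = 1 + m by rewrite /m; ring.
apply: (mulfI (_ : P ^+ 6 * (xi - t) ^+ 4 != 0)); first by rewrite mulf_neq0 ?expf_neq0.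
rewrite mulr0 /exc_rel am -/m.
transitivity ((P ^+ 2 + m * P ^+ 2) * ((b * P * (xi - t)) ^+ 4 + 6 * (b * P * (xi - t)) ^+ 2 * (m * P ^+ 2) * (xi - t) ^+ 2
   + (m * P ^+ 2) ^+ 2 * (xi - t) ^+ 4) - 8 * P * (b * P * (xi - t)) * (m * P ^+ 2) *
     ((b * P * (xi - t)) ^+ 2 * (xi - t) + (m * P ^+ 2) * (xi - t) ^+ 3)).
  by ring.
rewrite Eb Ea /P /Q; move: hx; move: (xi) => x hx; ring: hx.
Qed.

(** The equation of the plane when t = x / y; the last hypothesis is b = - (Q r) / (P s) with
    denominators cleared. *)
Lemma exc_param (x y a b : K) : y != 0 -> x ^+ 2 - y ^+ 2 != 0 -> x ^+ 2 + y ^+ 2 != 0 ->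
  a * (x ^+ 2 - y ^+ 2) ^+ 2 = - 4 * (x * y) ^+ 2 ->
  xi * y * (b * (x ^+ 2 - y ^+ 2) + (x ^+ 2 + y ^+ 2)) = x * (b * (x ^+ 2 - y ^+ 2) - (x ^+ 2 + y ^+ 2)) ->
  plane_perp (x / y) a b.
Proof.
move=> y0 s0 t0 ha hb; set t := x / y; have Ex : x = t * y by rewrite divfK.
rewrite {}Ex in ha hb s0 t0.
have P0 : t ^+ 2 - 1 != 0.
  by move: s0; rewrite exprMn -{2}[y ^+ 2]mul1r -mulrBl mulf_eq0 negb_or => /andP[].
have Q0 : t ^+ 2 + 1 != 0.
  by move: t0; rewrite exprMn -{2}[y ^+ 2]mul1r -mulrDl mulf_eq0 negb_or => /andP[].
have {}ha : a * (t ^+ 2 - 1) ^+ 2 = - 4 * t ^+ 2.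
  by apply: (mulIf (expf_neq0 4 y0)); apply: (eq_of_multiple (c := 1) ha); ring.
have {}hb : b * (t ^+ 2 - 1) * (xi - t) = - (t ^+ 2 + 1) * (xi + t).
  by apply: (mulIf (expf_neq0 3 y0)); apply: (eq_of_multiple (c := 1) hb); ring.
have tx : xi - t != 0.
  apply/eqP => e; have h : t = xi by rewrite -[t]add0r -e subrK.
  move/eqP: hb; rewrite e mulr0 eq_sym mulNr oppr_eq0 mulf_eq0 (negbTE Q0) /= h -mulr2n mulrn_eq0 /=.
  by apply/negP; exact: xi_neq0.
apply/plane_perpP; split; rewrite /nv0 /nv1 /nv2; first by rewrite mulf_neq0 ?expf_neq0.
  by rewrite mulrA ha; ring.
by apply: (eq_of_multiple (c := t ^+ 2 - 1) hb); ring.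
Qed.

(** Take a point [x, y] with a alpha_2^2 + gamma^2 = 0, so that 1 - a = (beta_2 / alpha_2)^2.
    The relation becomes x^4 (b alpha_2 - beta_2)^4 + y^4 (b alpha_2 + beta_2)^4 = 0. A fourth
    root of it is a linear relation with one of four constants, for which t is x/y, - x/y,
    y/x or - y/x. *)
Lemma exc_exists_t a b : exc_rel a b = 0 -> b ^+ 2 <> 1 - a -> exists t, plane_perp t a b.
Proof.
move=> rel hb; have [q q0 hq] := form_zero (isT : (0 < 4)%N) (wform_homog a).
rewrite ev_wform in hq.
have a0 : al q != 0.
  apply/eqP => h'; apply: (al_ga q0 h').
  by move: hq; rewrite h' expr0n mulr0 add0r => /eqP; rewrite expf_eq0 => /eqP.
have Em : (1 - a) * al q ^+ 2 = be q ^+ 2.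
  by rewrite be2E -[LHS]addr0 -hq; ring.
have b0 : be q != 0.
  apply/eqP => h; have a1 : 1 - a = 0.
    by apply/eqP; move/eqP: Em; rewrite h expr0n mulf_eq0 expf_eq0 /= (negbTE a0) orbF.
  case: hb; rewrite a1; apply/eqP; rewrite expf_eq0 /=.
  move/eqP: rel; rewrite /exc_rel a1 !mulr0 mul0r expr0n !addr0 subr0 mulf_eq0 expf_eq0 /= => /orP[|//].
  by rewrite -[2]/(1 + 1) -addrA a1 addr0 oner_eq0.
have Bm : b * al q - be q != 0.
  apply/eqP => /eqP; rewrite subr_eq0 => /eqP h; case: hb; apply: (mulIf (expf_neq0 2 a0)).
  by rewrite Em -exprMn h.
have Bp : b * al q + be q != 0.
  apply/eqP => /eqP; rewrite addr_eq0 => /eqP h; case: hb; apply: (mulIf (expf_neq0 2 a0)).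
  by rewrite Em -exprMn h sqrrN.
have key : q 0 0 ^+ 4 * (b * al q - be q) ^+ 4 + q 1 0 ^+ 4 * (b * al q + be q) ^+ 4 = 0.
  rewrite x4E y4E.
  transitivity (2 * al q ^+ 6 * exc_rel a b); last by rewrite rel mulr0.
  rewrite /exc_rel; have -> : 2 - a = 1 + (1 - a) by ring.
  move: (1 - a) Em => m Em; move: (al q) (be q) Em => s t Em; ring: Em.
have y0 : q 1 0 != 0.
  apply: contraNneq q0 => y; move/eqP: key; rewrite y expr0n mul0r addr0 mulf_eq0 !expf_eq0 /= (negbTE Bm) orbF.
  by move=> x; rewrite (ptE q) pt_eq0 x y eqxx.
have x0 : q 0 0 != 0.
  apply: contraNneq q0 => x; move/eqP: key; rewrite x expr0n mul0r add0r mulf_eq0 !expf_eq0 /= (negbTE Bp) orbF.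
  by move=> y; rewrite (ptE q) pt_eq0 x y eqxx.
move: key hq a0 b0 Bm Bp; rewrite /al /be /ga.
move: (q 0 0) (q 1 0) x0 y0 => x y x0 y0 key hq.
rewrite mulf_eq0 invr_eq0 (negbTE (two_neq0 R)) orbF => s0.
rewrite mulf_eq0 invr_eq0 (negbTE (two_neq0 R)) orbF => t0.
rewrite mulrA -mulrBl mulf_eq0 invr_eq0 (negbTE (two_neq0 R)) orbF => Bm.
rewrite -mulrDl mulf_eq0 invr_eq0 (negbTE (two_neq0 R)) orbF => Bp.
set s := x ^+ 2 - y ^+ 2 in key hq s0 Bm Bp; set r := x ^+ 2 + y ^+ 2 in key t0 Bm Bp.
have ha : a * s ^+ 2 = - 4 * (x * y) ^+ 2.
  by apply: (eq_of_multiple (c := 4) hq); field.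
have {}key : (xi * y * (b * s + r) / (x * (b * s - r))) ^+ 4 = 1.
  have hx := xi4 R; rewrite expr_div_n; apply: (canLR (mulfK _)); first by rewrite expf_neq0 // mulf_neq0.
  by apply: (eq_of_multiple (c := - 16) key); field: hx.
have nz : x * (b * s - r) != 0 by rewrite mulf_neq0.
have sN : (y ^+ 2 - x ^+ 2) = - s by rewrite opprB.
have rC : (y ^+ 2 + x ^+ 2) = r by rewrite addrC.
case: (mu4P key) => /(canRL (divfK nz)) E.
- exists (x / y); apply: exc_param => //; rewrite -/s -/r E mul1r //.
- exists (- x / y); apply: exc_param => //; rewrite ?sqrrN -/s -/r // ?E.
    by rewrite ha; ring.
  by ring.
- exists (y / x); apply: exc_param => //; rewrite ?sN ?rC ?oppr_eq0 // ?sqrrN ?ha; first by ring.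
  apply: (mulfI (xi_neq0 R)); apply: (eq_of_multiple (c := 1) E); ring.
- exists (- y / x); apply: exc_param => //; rewrite ?sqrrN ?sN ?rC ?oppr_eq0 // ?sqrrN ?ha; first by ring.
  apply: (mulfI (xi_neq0 R)); apply: (eq_of_multiple (c := -1) E); ring.
Qed.

End Planes.

(** * Normal form of the covering *)

Section Normalization.
Variable R : realType.
Notation K := R[i].
Implicit Types (q p : 'cV[K]_2) (phi : 'cV[binform R]_2) (A B S T mu nu : 'M[K]_2).

Lemma mat_eq_form d m n (F G : 'M[binform R]_(m, n)) :
  (forall i j, F i j \is d.-homog) -> (forall i j, G i j \is d.-homog) ->
  (forall q, mat_at F q = mat_at G q) -> F = G.
Proof.
move=> hF hG H; apply/matrixP => i j; apply: (form_eq (hF i j) (hG i j)) => u v.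
by rewrite -!mat_atE H.
Qed.

Lemma mulmx_homog d m n k (A : 'M[K]_(m, n)) (F : 'M[binform R]_(n, k)) :
  (forall i j, F i j \is d.-homog) -> forall i j, (const_form A *m F) i j \is d.-homog.
Proof.
by move=> hF i j; rewrite mxE; apply: rpred_sum => l _; rewrite mxE; exact: homCM.
Qed.

Lemma mulmxr_homog d m n k (A : 'M[K]_(n, k)) (F : 'M[binform R]_(m, n)) :
  (forall i j, F i j \is d.-homog) -> forall i j, (F *m const_form A) i j \is d.-homog.
Proof.
by move=> hF i j; rewrite mxE; apply: rpred_sum => l _; rewrite mulrC mxE; exact: homCM.
Qed.

Lemma precomp_homog d m n S (F : 'M[binform R]_(m, n)) :
  (forall i j, F i j \is d.-homog) -> forall i j, precomp F S i j \is d.-homog.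
Proof. by move=> hF i j; rewrite mxE; exact: lin_subst_homog. Qed.

Lemma scale_homog d m n c (F : 'M[binform R]_(m, n)) :
  (forall i j, F i j \is d.-homog) -> forall i j, (c%:MP *: F) i j \is d.-homog.
Proof. by move=> hF i j; rewrite mxE; exact: homCM. Qed.

Lemma phi0_homog2 i j : phi0 R i j \is 4.-homog.
Proof. by rewrite (ord1 j); exact: phi0_homog. Qed.

Lemma normalizesP phi mu nu : is_curve 4 phi -> normalizes phi mu nu <-> normev phi mu nu.
Proof.
move=> [hp _]; split=> -[um un H]; split=> //.
  have [c c0 E] := curve_eqE H; exists c => // q.
  by rewrite -E mat_atM mat_at_const mat_at_precomp.
have [c c0 E] := H; exists c => //; apply: (@mat_eq_form 4).
- by apply: mulmx_homog; exact: precomp_homog.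
- by apply: scale_homog; exact: phi0_homog2.
by move=> q; rewrite mat_atZ mat_atM mat_at_const mat_at_precomp.
Qed.

Lemma deckP phi S : is_curve 4 phi -> deck phi S <-> S \in unitmx /\
  exists2 c : K, c != 0 & forall q, mat_at phi (S *m q) = c *: mat_at phi q.
Proof.
move=> [hp _]; split=> -[uS H]; split=> //.
  have [c c0 E] := curve_eqE H; exists c => // q.
  by rewrite -E mat_at_precomp.
have [c c0 E] := H; exists c => //; apply: (@mat_eq_form 4).
- exact: precomp_homog.
- exact: scale_homog.
by move=> q; rewrite mat_atZ mat_at_precomp.
Qed.

Lemma proj_eq_sym (V : lmodType K) (x y : V) : proj_eq x y -> proj_eq y x.
Proof.
by case=> c c0 ->; exists c^-1; [rewrite invr_eq0|rewrite scalerA mulVf // scale1r].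
Qed.

Lemma proj_eq_trans (V : lmodType K) (x y z : V) : proj_eq x y -> proj_eq y z -> proj_eq x z.
Proof. by case=> c c0 -> [d d0 ->]; exists (c * d); [rewrite mulf_neq0|rewrite scalerA]. Qed.

Lemma proj_eq_mull n A (B C : 'M[K]_(2, n)) : proj_eq B C -> proj_eq (A *m B) (A *m C).
Proof. by case=> c c0 ->; exists c => //; rewrite -scalemxAr. Qed.

Lemma proj_eq_mulr n A (B C : 'M[K]_(n, 2)) : proj_eq B C -> proj_eq (B *m A) (C *m A).
Proof. by case=> c c0 ->; exists c => //; rewrite -scalemxAl. Qed.

(** A group of order four is not covered by three classes. *)
Lemma deck_order_pigeon phi (f : 'I_3 -> 'M[K]_2) : deck_order phi 4 ->
  ~ (forall S, deck phi S -> exists i, proj_eq S (f i)).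
Proof.
case=> s [ds inj _] H.
have /fin_all_exists[c hc] : forall i, exists j, proj_eq (s i) (f j) by move=> i; exact: H.
have: injective c.
  move=> i j e; apply: inj; apply: proj_eq_trans (hc i) _; rewrite e.
  exact: proj_eq_sym.
by move/leq_card; rewrite !card_ord.
Qed.

(** Take an eigenvector v of r for the eigenvalue 1 and w = s v, which has the eigenvalue
    -1. In the basis v, w the matrices are [r0] and [s0]. *)
Lemma klein_coordinates r s : r *m r = 1%:M -> s *m s = 1%:M ->
  r 0 0 + r 1 1 = 0 -> r *m s = - (s *m r) ->
  exists mu, [/\ mu \in unitmx, r *m mu = mu *m r0 R & s *m mu = mu *m s0 R].
Proof.
move=> r2 s2 tr anti.
have [v v0 rv] : exists2 v : 'cV[K]_2, v != 0 & r *m v = v.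
  have E (w : 'cV[K]_2) : r *m (w + r *m w) = w + r *m w.
    by rewrite mulmxDr mulmxA r2 mul1mx addrC.
  have [e0|] := eqVneq (pt 1 0 + r *m pt 1 0) 0; last by exists (pt 1 0 + r *m pt 1 0).
  exists (pt 0 1 + r *m pt 0 1) => //; apply/eqP => e1.
  move/(congr1 (fun M : 'cV_2 => M 0 0)): e0; move/(congr1 (fun M : 'cV_2 => M 1 0)): e1.
  rewrite !mxE !sum2 !pt0 !pt1 !(mulr0, mulr1, add0r, addr0) => h1 h0.
  by move/eqP: tr; rewrite -[r 0 0](addKr 1) h0 -[r 1 1](addKr 1) h1 !addr0 -opprD oppr_eq0 (negbTE (two_neq0 R)).
pose w := s *m v; have rw : r *m w = - w by rewrite mulmxA anti mulNmx -mulmxA rv.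
have sw : s *m w = v by rewrite mulmxA s2 mul1mx.
have w0 : w != 0 by apply: contra_neq v0 => h; rewrite -sw h mulmx0.
pose mu := mx22 (v 0 0) (w 0 0) (v 1 0) (w 1 0).
have muE x y : mu *m pt x y = x *: v + y *: w.
  apply/colP => i; rewrite mulmx2E [RHS]mxE [(x *: v) i 0]mxE [(y *: w) i 0]mxE pt0 pt1.
  by rewrite [x * _]mulrC [y * _]mulrC; have [->|->] := ord2P i; rewrite !mx22E.
have ker (q : 'cV[K]_2) : mu *m q = 0 -> q = 0.
  rewrite (ptE q) muE => h; move: (q 0 0) (q 1 0) h => x y h.
  have := congr1 (mulmx r) h; rewrite mulmxDr -!scalemxAr rv rw mulmx0 => h'.
  have hx : x *: v = 0.
    have := congr2 +%R h h'; rewrite scalerN addrACA subrr !addr0 -mulr2n => /eqP.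
    by rewrite -scaler_nat scaler_eq0 (negbTE (two_neq0 R)) => /eqP.
  move: h; rewrite hx add0r => /eqP; rewrite scaler_eq0 (negbTE w0) orbF => /eqP ->.
  by move/eqP: hx; rewrite scaler_eq0 (negbTE v0) orbF => /eqP ->; apply/eqP; rewrite pt_eq0 eqxx.
have umu : mu \in unitmx.
  rewrite unit_det -det_tr; apply/det0P => -[u u0 hu]; case/negP: u0.
  have := ker u^T; rewrite -[mu]trmxK -trmx_mul hu trmx0 => /(_ erefl)/(congr1 trmx).
  by rewrite trmxK trmx0 => ->.
have colE (B C : 'M[K]_2) : (forall x y, B *m pt x y = C *m pt x y) -> B = C.
  move=> H; apply/matrixP => i j; have := congr1 (fun M : 'cV_2 => M i 0) (H (j == 0)%:R (j == 1)%:R).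
  rewrite !mxE !sum2 !pt0 !pt1; have [->|->] := ord2P j; by rewrite /= !(mulr1, mulr0, addr0, add0r).
clearbody mu.
exists mu; split=> //; apply: colE => x y; rewrite -!mulmxA mul_mx22_pt !muE.
  by rewrite mulmxDr -!scalemxAr rv rw !mul0r mul1r add0r addr0 mulN1r scalerN scaleNr.
by rewrite mulmxDr -!scalemxAr -/w sw !mul0r !mul1r add0r addr0 addrC.
Qed.

(** The even quartics symmetric under exchange of x and y are spanned by x^4 + y^4 and x^2 y^2,
    or by alpha_2^2 and gamma^2. *)
Lemma klein_quartic (p : binform R) : p \is 4.-homog -> (forall q, ev (r0 R *m q) p = ev q p) ->
  (forall q, ev (s0 R *m q) p = ev q p) ->
  exists a b : K, forall q, ev q p = a * - al q ^+ 2 + b * ga q ^+ 2.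
Proof.
move=> hp hr hs; have E x y := form_ev x y hp.
pose c k := p@_(M2 (4 - k) k).
have {}E x y : ev (pt x y) p = c 0%N * x ^+ 4 + c 1%N * (x ^+ 3 * y) + c 2%N * (x ^+ 2 * y ^+ 2) +
  c 3%N * (x * y ^+ 3) + c 4%N * y ^+ 4.
  rewrite E !big_ord_recl big_ord0 /= /bump /= !add1n -!/(c _) /=.
  rewrite !subSS !subn0 !expr0 !expr1 mulr1 mul1r; ring.
have hr' x y : ev (pt x (- y)) p = ev (pt x y) p.
  by rewrite -[RHS]hr mul_mx22_pt; congr ev; congr pt; ring.
have hs' x y : ev (pt y x) p = ev (pt x y) p.
  by rewrite -[RHS]hs mul_mx22_pt; congr ev; congr pt; ring.
have e1 := hr' 1 1; have e2 := hr' 1 2; have e3 := hs' 1 0.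
rewrite !E in e1 e2 e3.
have c4 : c 4%N = c 0%N by apply: (eq_of_multiple (c := 1) e3); ring.
have c3 : c 3%N = 0.
  apply: (mulfI (_ : 12 != 0)); first by rewrite pnatr_eq0.
  have c1 : c 1%N = - c 3%N.
    apply: (mulfI (_ : 2 != 0)); first exact: two_neq0.
    by apply: (eq_of_multiple (c := -1) e1); ring.
  by apply: (eq_of_multiple (c := -1) e2); rewrite c1; ring.
have c1 : c 1%N = 0.
  apply: (mulfI (_ : 2 != 0)); first exact: two_neq0.
  by apply: (eq_of_multiple (c := -1) e1); rewrite c3; ring.
exists (- 4 * c 0%N), (2 * c 0%N + c 2%N) => q.
by rewrite (ptE q) E c1 c3 c4 al_pt ga_pt; field.
Qed.

(** The three nontrivial deck transformations have trace zero by [square_scalar_traceless], so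
    the two generators anticommute. In the coordinates of [klein_coordinates] both components of
    phi are multiplied by the same sign under [r0], and under [s0]; the sign is 1 since phi
    does not vanish at their fixed points [1, 0] and [1, 1]. So the
    components are combinations of those of [phi0] by [klein_quartic], independent because
    [phi0] is surjective and phi has no common zero. *)
Lemma d2_normalizes phi : is_curve 4 phi -> deck_group_D2 phi -> exists mu nu, normalizes phi mu nu.
Proof.
move=> cphi [ord [r [s [dr ds [hr hs hrs] H]]]].
have [ur [cr cr0 Er]] := (deckP r cphi).1 dr; have [us [cs cs0 Es]] := (deckP s cphi).1 ds.
pose f3 (A B C : 'M[K]_2) (i : 'I_3) := nth 0 [:: A; B; C] i.
have nr : ~ proj_eq r 1%:M.
  move=> h; apply: (@deck_order_pigeon phi (f3 1%:M s s) ord) => S /H[] hS.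
  - by exists (inord 0); rewrite /f3 inordK.
  - by exists (inord 0); rewrite /f3 inordK //; exact: proj_eq_trans hS h.
  - by exists (inord 1); rewrite /f3 inordK.
  - exists (inord 1); rewrite /f3 inordK //; apply: proj_eq_trans hS _.
    by rewrite -[X in proj_eq _ X]mul1mx; exact: proj_eq_mulr.
have ns : ~ proj_eq s 1%:M.
  move=> h; apply: (@deck_order_pigeon phi (f3 1%:M r r) ord) => S /H[] hS.
  - by exists (inord 0); rewrite /f3 inordK.
  - by exists (inord 1); rewrite /f3 inordK.
  - by exists (inord 0); rewrite /f3 inordK //; exact: proj_eq_trans hS h.
  - exists (inord 1); rewrite /f3 inordK //; apply: proj_eq_trans hS _.
    by rewrite -[X in proj_eq _ X]mulmx1; exact: proj_eq_mull.
have nrs : ~ proj_eq (r *m s) 1%:M.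
  move=> h; apply: (@deck_order_pigeon phi (f3 1%:M r s) ord) => S /H[] hS.
  - by exists (inord 0); rewrite /f3 inordK.
  - by exists (inord 1); rewrite /f3 inordK.
  - by exists (inord 2); rewrite /f3 inordK.
  - by exists (inord 0); rewrite /f3 inordK //; exact: proj_eq_trans hS h.
have tr := square_scalar_traceless hr nr ur; have ts := square_scalar_traceless hs ns us.
have trs : (r *m s) 0 0 + (r *m s) 1 1 = 0.
  by apply: square_scalar_traceless => //; rewrite unitmx_mul ur.
have anti : r *m s = - (s *m r).
  have r11 : r 1 1 = - r 0 0 by apply/eqP; rewrite -addr_eq0 addrC tr.
  have s11 : s 1 1 = - s 0 0 by apply/eqP; rewrite -addr_eq0 addrC ts.
  move: trs; rewrite !mulmx2E r11 s11 => trs.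
  by apply: eqmx2; rewrite [RHS]oppmxE !mulmx2E ?r11 ?s11; [apply: (eq_of_multiple (c := 1) trs)| | |apply: (eq_of_multiple (c := 1) trs)]; ring.
have scale_sq A : proj_eq (A *m A) 1%:M -> exists2 k : K, k != 0 & (k *: A) *m (k *: A) = 1%:M.
  case=> c c0 E; exists (sqrtC c)^-1; first by rewrite invr_eq0 sqrtC_eq0.
  rewrite -scalemxAl -scalemxAr scalerA E scalerA -expr2 exprVn sqrtCK mulVf // scale1r //.
have [k k0 r2] := scale_sq r hr; have [l l0 s2] := scale_sq s hs.
have [||mu [umu mr ms]] := klein_coordinates r2 s2.
- by rewrite !mxE -mulrDr tr mulr0.
- by rewrite -!scalemxAl -!scalemxAr anti !scalerN !scalerA mulrC.
have hphi i : phi i 0 \is 4.-homog := curve4_homog cphi i.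
have homs c q : mat_at phi (c *: q) = c ^+ 4 *: mat_at phi q.
  by apply/matrixP => i j; rewrite (ord1 j) [RHS]mxE !mat_atE (form_scale _ _ (hphi i)).
pose G q := mat_at phi (mu *m q).
have Gr q : G (r0 R *m q) = (k ^+ 4 * cr) *: G q.
  by rewrite /G mulmxA -mr -mulmxA -scalemxAl homs Er scalerA.
have Gs q : G (s0 R *m q) = (l ^+ 4 * cs) *: G q.
  by rewrite /G mulmxA -ms -mulmxA -scalemxAl homs Es scalerA.
have G0 q : q != 0 -> G q != 0.
  move=> q0; have [[i j]] := curve_nz cphi (unit_nz umu q0); rewrite (ord1 j) /= => h.
  by apply: contra_neq h => e; rewrite -mat_atE -/(G q) e mxE.
have fix1 c q : q != 0 -> G q = c *: G q -> c = 1.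
  move=> q0 /eqP; rewrite -{1}[G q]scale1r -subr_eq0 -scalerBl scaler_eq0 (negbTE (G0 q q0)) orbF.
  by rewrite subr_eq0 => /eqP.
(* [1, 0] is fixed by r0 and [1, 1] by s0. *)
have {}Gr q : G (r0 R *m q) = G q.
  rewrite Gr (fix1 _ (pt 1 0) _ (etrans _ (Gr _))) ?scale1r ?pt_eq0 ?oner_eq0 //.
  by rewrite mul_mx22_pt; congr G; congr pt; ring.
have {}Gs q : G (s0 R *m q) = G q.
  rewrite Gs (fix1 _ (pt 1 1) _ (etrans _ (Gs _))) ?scale1r ?pt_eq0 ?oner_eq0 //.
  by rewrite mul_mx22_pt; congr G; congr pt; ring.
pose phi1 := precomp phi mu.
have mat1 q : mat_at phi1 q = G q by rewrite mat_at_precomp.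
have /fin_all_exists[a /fin_all_exists[b hab]] : forall i : 'I_2, exists a b : K, forall q,
    ev q (phi1 i 0) = a * - al q ^+ 2 + b * ga q ^+ 2.
  move=> i; apply: klein_quartic => [|q|q].
  - exact: precomp_homog (fun i j => cphi.1 i j) i 0.
  - by rewrite -!mat_atE !mat1 Gr.
  - by rewrite -!mat_atE !mat1 Gs.
pose N := mx22 (a 0) (b 0) (a 1) (b 1).
have NG q : N *m mat_at (phi0 R) q = G q.
  apply/colP => i; rewrite -mat1 mat_atE hab mulmx2E mat_phi0 pt0 pt1.
  by have [->|->] := ord2P i; rewrite !mx22E.
have uN : N \in unitmx.
  rewrite unit_det -det_tr; apply/det0P => -[u u0 hu].
  have p0 : u^T != 0 by apply: contra_neq u0 => h; rewrite -[u]trmxK h trmx0.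
  have Np : N *m u^T = 0 by rewrite -[N]trmxK -trmx_mul hu trmx0.
  have [q q0 [k' _ Ek]] := phi0_surj p0.
  by case/negP: (G0 q q0); rewrite -NG Ek -scalemxAr Np scaler0.
exists mu, (invmx N); apply/(normalizesP _ _ cphi); split=> //; first by rewrite unitmx_inv.
exists 1; first exact: oner_neq0.
by move=> q; rewrite scale1r -/(G q) -NG mulKmx.
Qed.

End Normalization.

(** * Classification *)

Section Classification.
Variable R : realType.
Notation K := R[i].
Implicit Types (q p : 'cV[K]_2) (phi : 'cV[binform R]_2) (A B S T mu nu : 'M[K]_2).
Notation xi := (@xi1 R).

Lemma lift_form_homog (z a b : K) i j : lift_form z a b i j \is 5.-homog.
Proof.
apply: mulmx_homog => {}i {}j; rewrite 2!mxE; have := homog_alpha2 R; have := homog_beta2 R; have := homog_gamma R.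
by case: i j => -[|[|[|//]]] ? -[[|[|//]] ?] /=; move: alpha2 beta2 gamma => s t r hr ht hs; hmgd.
Qed.

Section Lift.
Variables (phi : 'cV[binform R]_2) (n : nat) (F : 'rV[binform R]_7) (g : 'M[binform R]_2).
Hypotheses (cphi : is_curve 4 phi) (cg : is_curve n g) (L : octa_lift phi n F g).

(** A lift equivalent to a normal form yields a lift that is equal to it. *)
Lemma equiv_lift z a b : equiv_mod_moebius phi g (lift_form z a b) ->
  exists F' g', [/\ octa_lift (phi0 R) n F' g', tangent6 F <-> tangent6 F' &
    forall q, mat_at g' q = covar z a 1 0 b 0 1 q].
Proof.
case=> mu [nu [N [A [B [dA sB /curve_eqE[c c0 E]]]]]]; have [uB oB] := S4star_stab sB.
have uA : c^-1 *: A \in unitmx.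
  by rewrite unitmxZ ?unitfE ?invr_eq0 // unit_det dA oner_neq0.
have [F' [L' T]] := lift_transport L N uA uB oB.
exists F', (const_form (c^-1 *: A) *m precomp g mu *m const_form B^T); split; [exact: L'|exact: T|move=> q].
rewrite !mat_atM !mat_at_const mat_at_precomp -!scalemxAl.
have := E q; rewrite mat_lift_form !mat_atM mat_at_const mat_at_precomp.
have -> : mat_at (const_form B)^T q = B^T by rewrite -[RHS](mat_at_const _ q) /const_form map_trmx.
by move=> ->; rewrite scalerA mulVf // scale1r.
Qed.

(** The scalars in A and C are absorbed by the projective equality and a square root of
    det A. *)
Lemma lift_equiv z a b m nu A C : normev phi m nu -> A \in unitmx -> octm C -> n = 5%N ->
  (forall q, A *m mat_at g (m *m q) *m C = covar z a 1 0 b 0 1 q) ->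
  equiv_mod_moebius phi g (lift_form z a b).
Proof.
move=> N uA [k k0 [B sB ->]] n5 H; exists m, nu; split; first exact/(normalizesP _ _ cphi).
have dA : \det A != 0 by rewrite -unit_det.
have s0 : sqrtC (\det A) != 0 by rewrite sqrtC_eq0.
exists ((sqrtC (\det A))^-1 *: A), B; split=> //.
  by rewrite detZ exprVn sqrtCK mulVf.
exists (sqrtC (\det A) * k)^-1; first by rewrite invr_eq0 mulf_neq0.
have BT : (const_form B)^T = const_form B^T by rewrite /const_form map_trmx.
rewrite BT; apply: (@mat_eq_form _ 5).
- apply: mulmxr_homog; apply: mulmx_homog; apply: precomp_homog => i j; rewrite -n5; exact: cg.1.
- by apply: scale_homog; exact: lift_form_homog.
move=> q; rewrite mat_atZ mat_lift_form -H !mat_atM !mat_at_const mat_at_precomp.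
rewrite -!scalemxAl -!scalemxAr scalerA invfM -mulrA mulVf // mulr1 //.
Qed.

End Lift.

(** A deck transformation that multiplies g by a constant has the same image as the identity
    under the homomorphism of the lift. *)
Lemma galois_inj phi F (g : 'M[binform R]_2) mu nu : is_curve 4 phi -> galois_lift phi F g ->
  normev phi mu nu -> forall S (c : K), c != 0 -> S \in unitmx ->
  (forall q, mat_at (phi0 R) (S *m q) = 1 *: mat_at (phi0 R) q) ->
  (forall q, mat_at g (mu *m (S *m q)) = c *: mat_at g (mu *m q)) -> exists k, S = k%:M.
Proof.
move=> cphi [_ _ inj] [umu unu [e e0 N]] S c c0 uS HS Hg.
have d1 : deck phi 1%:M.
  apply/(deckP _ cphi); rewrite unitmx1; split=> //; exists 1; first exact: oner_neq0.
  by move=> q; rewrite mul1mx scale1r.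
have dS : deck phi (mu *m S *m invmx mu).
  apply/(deckP _ cphi); split; first by rewrite !unitmx_mul umu uS unitmx_inv.
  exists 1; first exact: oner_neq0.
  move=> q; rewrite scale1r -!mulmxA; apply: (can_inj (mulKmx unu)).
  by rewrite N HS scale1r -N mulKVmx.
have [|k _ E] := inj _ _ dS d1.
  move=> q uq _ _; rewrite mul1mx mulVmx //.
  have -> : mat_at g (mu *m S *m invmx mu *m q) = c *: mat_at g q.
    by rewrite -!mulmxA Hg mulKVmx.
  exists c^-1; first by rewrite invr_eq0.
  have uc : c *: mat_at g q \in unitmx by rewrite unitmxZ ?unitfE.
  by apply: (can_inj (mulKmx uc)); rewrite mulKVmx // -scalemxAr mulmx1 scalerA mulVf // scale1r.
exists k; have := congr1 (fun M => invmx mu *m M *m mu) E.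
by rewrite !mulmxA mulVmx // mul1mx mulmxKV // -scalemxAr mulmx1 -scalemxAl mulVmx // scalemx1.
Qed.

Theorem lift_classification phi n (F : 'rV[binform R]_7) (g : 'M[binform R]_2) :
  galois_covering 4 phi -> deck_group_D2 phi ->
  sextic_curve F -> is_curve n g -> galois_lift phi F g ->
  [/\ n = 5%N,
      (exists a1 b1 : K, equiv_mod_moebius phi g (g_ram a1 b1)) \/
      (exists t a1 b1 : K, plane_perp t a1 b1 /\ equiv_mod_moebius phi g (g_exc a1 b1)),
      (forall a1 b1 : K, equiv_mod_moebius phi g (g_ram a1 b1) -> generally_ramified F) &
      (forall t a1 b1 : K, plane_perp t a1 b1 ->
         equiv_mod_moebius phi g (g_exc a1 b1) -> exceptional_transversal F)].
Proof.
move=> [cphi _] d2 sF cg gl; have L := lift_of_galois cphi sF cg gl.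
have [mu [nu N]] := d2_normalizes cphi d2; have NV := (normalizesP _ _ cphi).1 N.
have s1 : octa_stab (1%:M : 'M[K]_2) := octm_stab (octm1 R).
have [F1 [L1 _]] := lift_transport L N (unitmx1 _ _) (unitmx1 _ _) s1.
have G1 q : mat_at (const_form 1%:M *m precomp g mu *m const_form 1%:M) q = mat_at g (mu *m q).
  by rewrite !mat_atM !mat_at_const mat_at_precomp mul1mx mulmx1.
have [|n5 [m [nu' [A [C [z [a [b [N' uA oC hz H]]]]]]]]] := lift_normal_form L1.
  move=> S c c0 uS HS Hg; apply: (galois_inj cphi gl NV c0 uS HS) => q.
  by have := Hg q; rewrite !G1.
rewrite n5 in cg L; have N2 : normev phi (mu *m m) (nu' *m nu).
  exact: normev_comp.
have {}H q : A *m mat_at g (mu *m m *m q) *m C = covar z a 1 0 b 0 1 q.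
  by rewrite -H G1 mulmxA.
have eqv : equiv_mod_moebius phi g (lift_form z a b) := lift_equiv cphi cg N2 uA oC erefl H.
have hxi := xi4 R.
split=> //.
- case: hz => zE; rewrite zE in eqv H; first by left; exists a, b.
  right; have [F2 [g2 [L2 _ E2]]] := equiv_lift L eqv.
  have [t ht] := exc_exists_t (exc_necessary L2 E2 hxi) (exc_not_square L2 E2 hxi).
  by exists t, a, b.
- move=> a1 b1 e1; have [F2 [g2 [L2 T E2]]] := equiv_lift L e1.
  by apply/ramified_tangent6; apply/T; exact: (@ram_tangent _ F2 g2 L2 a1 b1 E2).
move=> t a1 b1 ht e1 /ramified_tangent6 tF; have [F2 [g2 [L2 T E2]]] := equiv_lift L e1.
by apply: (exc_not_tangent L2 E2 hxi (perp_exc_rel ht)); exact/T.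
Qed.

End Classification.

(** * Curves from independent sextics *)

Section Zeros.
Variable R : realType.
Notation K := R[i].
Implicit Types (q p : 'cV[K]_2) (h : binform R).

Lemma line_poly h (x0 x1 y0 y1 : K) :
  exists P : {poly K}, forall s, P.[s] = ev (pt (x0 + s * x1) (y0 + s * y1)) h.
Proof.
pose l (i : 'I_2) : {poly K} := if i == 0 then x0%:P + 'X * x1%:P else y0%:P + 'X * y1%:P.
elim/mpolyind: h => [|c m h _ _ [P HP]]; first by exists 0 => s; rewrite horner0 ev0.
exists (c%:P * \prod_i l i ^+ m i + P) => s.
rewrite hornerD hornerM hornerC HP evD evZ; congr (_ * _ + _).
rewrite horner_prod /ev mevalX; apply: eq_bigr => i _; rewrite horner_exp /l.
have [->|->] := ord2P i; first by rewrite pt0 hornerD hornerM !hornerC hornerX.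
by rewrite pt1 /= hornerD hornerM !hornerC hornerX.
Qed.

Lemma poly_vanish (P : {poly K}) : (forall s, s != 0 -> P.[s] = 0) -> P = 0.
Proof.
move=> H; apply/eqP; apply: contraT => nz.
have := max_poly_roots nz (rs := [seq k.+1%:R | k <- iota 0 (size P)]).
rewrite size_map size_iota ltnn; apply.
  by apply/allP => _ /mapP[k _ ->]; rewrite /root H ?pnatr_eq0.
by rewrite map_inj_uniq ?iota_uniq // => i j /eqP; rewrite eqr_nat eqSS => /eqP.
Qed.

(** A polynomial that vanishes everywhere is zero: so are its homogeneous components, as the
    coefficients of its restriction to each line through the origin. *)
Lemma mpoly_ext h : (forall q, ev q h = 0) -> h = 0.
Proof.
move=> H; rewrite (pihomog_partitionE (mf := mdeg) (leqnn (mmeasure mdeg h))).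
rewrite big1 // => d _; apply: (form_ext (pihomogP mdeg d h)) => q _.
pose P := \poly_(e < mmeasure mdeg h) ev q (pihomog mdeg e h).
have P0 : P = 0.
  apply: poly_vanish => s _; rewrite horner_poly -[RHS](H (s *: q)).
  rewrite [h in RHS](pihomog_partitionE (mf := mdeg) (leqnn (mmeasure mdeg h))).
  rewrite ev_sum; apply: eq_bigr => e _.
  by rewrite (form_scale _ _ (pihomogP mdeg e h)) mulrC.
by have := congr1 (fun P : {poly K} => P`_d) P0; rewrite coef_poly ltn_ord coef0.
Qed.

Lemma poly_nozero (P : {poly K}) : (forall s, P.[s] != 0) -> forall s t, P.[s] = P.[t].
Proof.
move=> H s t; have [s1|s1] := boolP (size P == 1%N).
  by have /size_poly1P[c _ ->] := s1; rewrite !hornerC.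
by case/closed_rootP: s1 => x; rewrite /root (negbTE (H x)).
Qed.

(** On a line that avoids the origin the polynomial has no zero, hence is constant; any two
    points with nonzero coordinates are joined by such lines parallel to the axes. *)
Lemma nonvanishing_const h : (forall q, q != 0 -> ev q h != 0) -> exists c, h = c%:MP.
Proof.
move=> H; exists (ev (pt 0 1) h); apply/eqP; rewrite -subr_eq0; apply/eqP/mpoly_ext => q.
rewrite evB evC.
have hx x y : y != 0 -> ev (pt x y) h = ev (pt 0 y) h.
  move=> y0; have [P HP] := line_poly h 0 1 y 0.
  have E s : P.[s] = ev (pt s y) h by rewrite HP mulr1 mulr0 add0r addr0.
  rewrite -!E; apply: poly_nozero => s; rewrite E; apply: H.
  by rewrite pt_eq0 negb_and y0 orbT.
have hy x y : x != 0 -> ev (pt x y) h = ev (pt x 0) h.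
  move=> x0; have [P HP] := line_poly h x 0 0 1.
  have E s : P.[s] = ev (pt x s) h by rewrite HP mulr1 mulr0 add0r addr0.
  rewrite -!E; apply: poly_nozero => s; rewrite E; apply: H.
  by rewrite pt_eq0 negb_and x0.
have gen x y : x != 0 -> y != 0 -> ev (pt x y) h = ev (pt 0 1) h.
  by move=> x0 y0; rewrite hy // -(hy x 1) // hx ?oner_neq0.
have [P HP] := line_poly h 0 (q 0 0) 0 (q 1 0).
apply/eqP; rewrite subr_eq0; apply/eqP.
have [y0|y0] := eqVneq (q 1 0) 0; last first.
  by rewrite (ptE q) hx // -(hx 1) // gen // oner_neq0.
have [x0|x0] := eqVneq (q 0 0) 0; last by rewrite (ptE q) y0 -(hy _ 1) // gen // oner_neq0.
have [Q HQ] := line_poly h 0 1 0 1.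
have EQ s : Q.[s] = ev (pt s s) h by rewrite HQ mulr1 add0r.
have : Q - (ev (pt 0 1) h)%:P = 0.
  by apply: poly_vanish => s s0; rewrite hornerD hornerN hornerC EQ gen // subrr.
move/eqP; rewrite subr_eq0 => /eqP E; have := congr1 (fun P : {poly K} => P.[0]) E.
by rewrite EQ hornerC (ptE q) x0 y0.
Qed.

(** A common factor of forms without common zero has no zero outside the origin. *)
Lemma is_curve_of_nz m n d (F : 'M[binform R]_(m, n)) : (forall i j, F i j \is d.-homog) ->
  (forall q, q != 0 -> exists ij, ev q (F ij.1 ij.2) != 0) -> is_curve d F.
Proof.
move=> hF nz; split=> // h H; apply: nonvanishing_const => q q0.
have [[i j] /= hij] := nz q q0; have [r E] := H i j.
by apply: contraNneq hij => h0; rewrite E evM h0 mul0r.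
Qed.

(** Seven independent sextics span V_6. If they had a common zero, they would be the
    multiples of seven independent quintics, but V_5 has dimension six. *)
Lemma indep_nz (E : 'I_7 -> binform R) : (forall k, E k \is 6.-homog) ->
  (forall c : 'cV[K]_7, (forall p, \sum_k ev p (E k) * c k 0 = 0) -> c = 0) ->
  forall q, q != 0 -> exists k, ev q (E k) != 0.
Proof.
move=> hE ind q q0; apply/existsP; apply: contraT; rewrite negb_exists => /forallP H.
have /fin_all_exists[e he] : forall k, exists e, e \is 5.-homog /\ E k = lin q * e.
  by move=> k; have [|e he Ee] := form_factor q0 (hE k); [by have := H k; rewrite negbK => /eqP|exists e].
pose C : 'M[K]_(7, 6) := \matrix_(k, j) (e k)@_(M2 (5 - j) j).
have : kermx C != 0.
  by rewrite -mxrank_eq0 mxrank_ker subn_eq0 -ltnNge ltnS rank_leq_col.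
case/rowV0Pn => v /sub_kermxP vC v0; case/negP: v0; rewrite -[v]trmxK trmx_eq0; apply/eqP.
apply: ind => p.
have es : \sum_k ev p (e k) * v 0 k = 0.
  transitivity (\sum_k \sum_(j < 6) (e k)@_(M2 (5 - j) j) * (p 0 0 ^+ (5 - j) * p 1 0 ^+ j) * v 0 k).
    by apply: eq_bigr => k _; rewrite [in LHS](ptE p) (form_ev _ _ (he k).1) mulr_suml.
  rewrite exchange_big big1 //= => j _.
  have := congr1 (fun M : 'rV_6 => M 0 j) vC; rewrite !mxE => vj.
  transitivity ((p 0 0 ^+ (5 - j) * p 1 0 ^+ j) * \sum_k v 0 k * C k j); last by rewrite vj mulr0.
  by rewrite mulr_sumr; apply: eq_bigr => k _; rewrite [C k j]mxE; ring.
transitivity (ev p (lin q) * \sum_k ev p (e k) * v 0 k); last by rewrite es mulr0.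
by rewrite mulr_sumr; apply: eq_bigr => k _; rewrite (he k).2 evM mxE mulrA.
Qed.

Lemma phi0_onto p : p != 0 -> exists2 q, q != 0 & mat_at (phi0 R) q = p.
Proof.
move=> p0; have [q q0 [k k0 E]] := phi0_surj p0.
exists ((4.-root k)^-1 *: q).
  by rewrite scaler_eq0 invr_eq0 rootC_eq0 // negb_or k0.
by rewrite (mat_atN _ (@phi0_homog2 R)) E scalerA exprVn rootCK // mulVf // scale1r.
Qed.

End Zeros.

(** * Lifts from curves *)

Section Orbits.
Variable R : realType.
Notation K := R[i].
Implicit Types (q p : 'cV[K]_2) (A M S T : 'M[K]_2) (f : binform R).

Lemma octa_form_homog : octa_form R \is 6.-homog.
Proof. by rewrite /octa_form; hmgd. Qed.

Lemma ev_octa_form x y : ev (pt x y) (octa_form R) = octa x y.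
Proof. by rewrite /octa_form /octa !(evB, evX, evX0, evX1, evM) pt0 pt1. Qed.

(** Dividing M by a square root of its determinant. *)
Lemma octa_orbit M f : \det M != 0 -> f1 M != 0 -> proj_eq f (f1 M) -> psl2_orbit (octa_form R) f.
Proof.
move=> dM fM H; have s0 : sqrtC (\det M) != 0 by rewrite sqrtC_eq0.
set s := sqrtC _ in s0; have s2 : s ^+ 2 = \det M by rewrite sqrtCK.
have dA : \det (s^-1 *: M) = 1 by rewrite detZ exprVn s2 mulVf.
exists (s^-1 *: M) => //; apply: proj_eq_trans H _; exists (s ^+ 6); first by rewrite expf_neq0.
apply: form_eq => [||u v].
- by rewrite f1E; exact: sextic_of_homog.
- by apply: homZ; apply: lin_subst_homog; exact: octa_form_homog.
rewrite f1E ev_sextic_of evZ ev_sl2_act ev_octa_form sextval_octa_mx.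
rewrite invmx22; last by rewrite unit_det dA oner_neq0.
by rewrite dA invr1 scale1r !mx22E !mxE /octa; field.
Qed.

Lemma ev_sextic f u v : f \is 6.-homog -> ev (pt u v) f = sextval (sextic_coord f) u v.
Proof. exact: form_ev. Qed.

(** The quadratic invariant of binary sextics, a_0 a_6 - a_1 a_5 / 6 + a_2 a_4 / 15 - a_3^2 / 40
    times 120. It vanishes on u^5 v but not on the octahedral form, so the orbit closure of the
    former does not contain the latter. *)
Definition sextic_quad (x : 'I_7 -> K) : K :=
  120 * (x (inord 0) * x (inord 6)) - 20 * (x (inord 1) * x (inord 5)) +
  8 * (x (inord 2) * x (inord 4)) - 3 * x (inord 3) ^+ 2.

Definition sextic_quad_form : {mpoly K[7]} :=
  120%:MP * ('X_(inord 0) * 'X_(inord 6)) - 20%:MP * ('X_(inord 1) * 'X_(inord 5)) +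
  8%:MP * ('X_(inord 2) * 'X_(inord 4)) - 3%:MP * 'X_(inord 3) ^+ 2.

Lemma sextic_quad_formE x : sextic_quad_form.@[x] = sextic_quad x.
Proof.
rewrite /sextic_quad_form /sextic_quad !(mevalB, mevalD); congr (_ - _ + _ - _);
by rewrite mevalM mevalC ?rmorphXn ?mevalM /= !mevalXU.
Qed.

Lemma sextic_quad_form_homog : sextic_quad_form \is 2.-homog.
Proof.
have hX (i : 'I_7) : ('X_i : {mpoly K[7]}) \is 1.-homog by rewrite dhomogX; apply/eqP; exact: mdeg1.
have h2 (c : K) (i j : 'I_7) : c%:MP * ('X_i * 'X_j) \is 2.-homog.
  by rewrite mul_mpolyC; apply: dhomogZ; exact: dhomogM (hX i) (hX j).
by rewrite /sextic_quad_form expr2 !(rpredB, rpredD).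
Qed.

Lemma sextic_quad_orbit2 f : psl2_orbit (X0 ^+ 5 * X1) f -> sextic_quad (sextic_coord f) = 0.
Proof.
case=> A dA [c c0 ->].
have h51 : (X0 ^+ 5 * X1 : binform R) \is 6.-homog by hmgd.
set B := invmx A.
have E : sextic_coord (c *: sl2_act A (X0 ^+ 5 * X1)) =1
    (fun k : 'I_7 => bin51 (B 0 0) (B 0 1) (c * B 1 0) (c * B 1 1) k).
  apply: sextval_inj => u v; rewrite -ev_sextic; last first.
    by apply: homZ; exact: lin_subst_homog.
  by rewrite evZ ev_sl2_act evM evX evX0 evX1 pt0 pt1 sextval_bin51 -/B; ring.
by rewrite /sextic_quad !E !inordK // /bin51; ring.
Qed.

Lemma sextic_quad_octa M : sextic_quad (octa_mx M) = 20 * \det M ^+ 6.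
Proof. by rewrite /sextic_quad /octa_mx !inordK //= det2; ring. Qed.

Lemma sextic_quadZ c (x : 'I_7 -> K) : sextic_quad (fun k => c * x k) = c ^+ 2 * sextic_quad x.
Proof. by rewrite /sextic_quad; ring. Qed.

End Orbits.

Section LiftRows.
Variable R : realType.
Notation K := R[i].

Lemma ratio_of_inverses (A B G : 'M[K]_2) (c : K) : A \in unitmx -> B \in unitmx -> G \in unitmx ->
  invmx A *m G = c *: (invmx B *m G) -> B = c *: A.
Proof.
move=> uA uB uG E; have E' : invmx A = c *: invmx B.
  by apply: (can_inj (mulmxK uG)); rewrite E -scalemxAl.
by rewrite -[LHS](mulKVmx uA) E' -scalemxAl mulVmx // -scalemxAr mulmx1.
Qed.

(** The first row is a multiple of (x, z y), so g determines its argument. *)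
Lemma covar_parallel (z a b c : K) (s t : 'cV[K]_2) : z != 0 ->
  covar z a 1 0 b 0 1 t = c *: covar z a 1 0 b 0 1 s -> \det (covar z a 1 0 b 0 1 t) != 0 ->
  s 0 0 * t 1 0 - s 1 0 * t 0 0 = 0.
Proof.
move=> z0; rewrite det_covar /covar scale_mx22 => E.
have := congr1 (fun M : 'M_2 => M 0 0) E; have := congr1 (fun M : 'M_2 => M 0 1) E.
rewrite !mx22E !mul0r !subr0 !addr0 !mulr1 !mul1r => E1 E0.
rewrite mulf_eq0 negb_or => /andP[_ w0].
have : (s 0 0 * t 1 0 - s 1 0 * t 0 0) * (z * (a * al t ^+ 2 + ga t ^+ 2)) = 0.
  transitivity (s 0 0 * (z * t 1 0 * (a * al t ^+ 2 + ga t ^+ 2)) - z * s 1 0 * (t 0 0 * (a * al t ^+ 2 + ga t ^+ 2))).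
    by ring.
  by rewrite E1 E0; ring.
by move/eqP; rewrite mulf_eq0 [z * _ == 0]mulf_eq0 (negbTE z0) (negbTE w0) !orbF => /eqP.
Qed.
End LiftRows.

Section Existence.
Variable R : realType.
Notation K := R[i].
Implicit Types (q p : 'cV[K]_2) (A M S T : 'M[K]_2) (f : binform R).
Variables (z a b : K) (P : binform R) (E : 'I_7 -> binform R).
Hypothesis z0 : z != 0.
Hypothesis hE : forall k, E k \is 6.-homog.
Hypothesis PE : forall q k, octa_mx (covar z a 1 0 b 0 1 q) k = ev q P * ev (mat_at (phi0 R) q) (E k).
Hypothesis ind : forall c : 'cV[K]_7, (forall p, \sum_k ev p (E k) * c k 0 = 0) -> c = 0.
Hypothesis nz : forall q, q != 0 -> covar z a 1 0 b 0 1 q != 0.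

Let g := lift_form z a b.
Let F : 'rV[binform R]_7 := \row_k E k.

Let Ez : forall q, q != 0 -> exists k, ev q (E k) != 0 := indep_nz hE ind.

Lemma exist_g_curve : is_curve 5 g.
Proof.
apply: is_curve_of_nz => [|q q0]; first exact: lift_form_homog.
apply/existsP; apply: contraT; rewrite negb_exists => /forallP H.
case/eqP: (nz q0); rewrite -mat_lift_form -/g; apply/matrixP => i j.
by have := H (i, j); rewrite negbK [RHS]mxE mat_atE => /eqP.
Qed.

Lemma exist_F_curve : is_curve 6 F.
Proof.
apply: is_curve_of_nz => [i j|q q0]; first by rewrite mxE.
by have [k hk] := Ez q0; exists (0, k); rewrite mxE.
Qed.

Lemma exist_det : \det g != 0.
Proof.
rewrite (covar_det (lift_form_homog z a b) (mat_lift_form z a b)).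
apply: mulf_neq0; last exact: mulf_neq0 (alpha2_neq0 R) (beta2_neq0 R).
apply: mulf_neq0; first by rewrite mpolyC_eq0 mulf_neq0 // two_neq0.
exact: mulf_neq0 (gamma_neq0 R) (wform_neq0 a).
Qed.

Lemma coord_F p k : sextic_coord (curve_at F p) k = ev p (E k).
Proof. by rewrite sextic_coordE mxE. Qed.

Lemma f1_F q : f1 (mat_at g q) = ev q P *: curve_at F (mat_at (phi0 R) q).
Proof.
rewrite f1E /curve_at /sextic_of scaler_sumr; apply: eq_bigr => k _.
by rewrite mat_lift_form PE scalerA mxE.
Qed.

(** For general q the sextic F(phi(q)) is in the orbit of the octahedral form, where H
    vanishes; the form H o F o phi then vanishes identically, and phi is surjective. *)
Lemma exist_F_V5 p : p != 0 -> fano_V5 (curve_at F p).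
Proof.
move=> p0; split; first exact: sextic_of_homog.
  have [k hk] := Ez p0; apply: contraNneq hk => h.
  by rewrite -coord_F h /sextic_coord mcoeff0.
move=> d H hH vH.
pose HF : binform R := H \mPo [tuple E k | k < 7].
have evHF r : ev r HF = H.@[sextic_coord (curve_at F r)].
  rewrite /ev /HF comp_mpoly_meval; apply: meval_eq => k.
  by rewrite tnth_mktuple coord_F.
have [q q0 Eq] := phi0_onto p0; rewrite -evHF -Eq -ev_pull.
suff /eqP : pull (phi0 R) HF * (\det g * P) = 0.
  rewrite mulf_eq0 => /orP[/eqP->|]; first exact: ev0.
  rewrite mulf_eq0 (negbTE exist_det) /= => /eqP P0.
  have [q' _ dq] := form_nz (det_homog (lift_form_homog z a b)) exist_det.
  rewrite ev_det in dq; have [k] := octa_mx_nz dq.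
  by rewrite mat_lift_form PE P0 ev0 mul0r eqxx.
apply: mpoly_ext => r; have evE : ev r (pull (phi0 R) HF * (\det g * P)) =
    ev (mat_at (phi0 R) r) HF * (\det (mat_at g r) * ev r P).
  by rewrite -ev_det -ev_pull -evM; exact: evM.
rewrite evE; have [d0|d0] := eqVneq (\det (mat_at g r)) 0; first by rewrite d0 mul0r mulr0.
have [P0|P0] := eqVneq (ev r P) 0; first by rewrite P0 !mulr0.
rewrite evHF vH ?mul0r //; apply: (octa_orbit d0).
  by apply/f1_octa_mx; exact: octa_mx_nz.
by rewrite f1_F; exists (ev r P)^-1; rewrite ?invr_eq0 // scalerA mulVf // scale1r.
Qed.

(** At a point where det g is not zero the quadratic invariant does not vanish. *)
Lemma exist_F_orbit2 : ~ (forall p, p != 0 -> orbit2_closure (curve_at F p)).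
Proof.
move=> H; have [q q0 dq] := form_nz (det_homog (lift_form_homog z a b)) exist_det.
rewrite ev_det in dq; have [_ _ v] := H _ (mat_phi0_nz q0).
have := v 2%N _ (sextic_quad_form_homog R); rewrite sextic_quad_formE => {}v.
have /eqP : sextic_quad (octa_mx (mat_at g q)) = 0.
  rewrite /sextic_quad mat_lift_form !PE -!coord_F -/(sextic_quad (fun k => ev q P * sextic_coord (curve_at F (mat_at (phi0 R) q)) k)).
  rewrite sextic_quadZ v ?mulr0 // => f' hf'; rewrite sextic_quad_formE.
  exact: sextic_quad_orbit2.
by rewrite sextic_quad_octa mulf_eq0 expf_eq0 pnatr_eq0 /= (negbTE dq).
Qed.

Lemma exist_F_sextic : sextic_curve F.
Proof.
split; [exact: exist_F_curve | | exact: exist_F_V5 | exact: exist_F_orbit2].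
move=> c H; apply: ind => p.
have := congr1 (fun M : 'M_1 => ev p (M 0 0)) H; rewrite !mxE ev0 ev_sum => {}H.
rewrite -[RHS]H; apply: eq_bigr => k _.
by rewrite evM [const_form _ _ _]mxE evC mxE.
Qed.

(** If the values at S and T of the homomorphism agree, g(T q) is a multiple of g(S q) for
    general q, hence T q is a multiple of S q by [covar_parallel], for all q. *)
Lemma exist_lift : galois_lift (phi0 R) F g.
Proof.
split; first exact: exist_det.
  move=> q q0; rewrite f1_F => h; exists (ev q P) => //.
  by apply: contraNneq h => ->; rewrite scale0r.
move=> S T [uS _] [uT _] H.
pose D : binform R := lin_subst S X0 * lin_subst T X1 - lin_subst S X1 * lin_subst T X0.
have evD0 q : ev q D = (S *m q) 0 0 * (T *m q) 1 0 - (S *m q) 1 0 * (T *m q) 0 0.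
  have e0 N : ev q (lin_subst N X0) = (N *m q) 0 0 by exact: etrans (ev_lin_subst _ _ _) (evX0 _).
  have e1 N : ev q (lin_subst N X1) = (N *m q) 1 0 by exact: etrans (ev_lin_subst _ _ _) (evX1 _).
  exact: etrans (evB _ _ _) (congr2 (fun x y : K => x - y)
    (etrans (evM _ _ _) (congr2 *%R (e0 S) (e1 T))) (etrans (evM _ _ _) (congr2 *%R (e1 S) (e0 T)))).
have subst_det N : N \in unitmx -> lin_subst N (\det g) != 0.
  move=> uN; have [q' _ dq] := form_nz (det_homog (lift_form_homog z a b)) exist_det.
  apply: contraNneq dq => h; have := ev_lin_subst (invmx N *m q') N (\det g).
  by rewrite h ev0 mulKVmx // => <-.
have D0 : D = 0.
  apply: (mulIf (mulf_neq0 exist_det (mulf_neq0 (subst_det _ uS) (subst_det _ uT)))).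
  rewrite mul0r; apply: mpoly_ext => q.
  have e : ev q (D * (\det g * (lin_subst S (\det g) * lin_subst T (\det g)))) =
    ev q D * (\det (mat_at g q) * (\det (mat_at g (S *m q)) * \det (mat_at g (T *m q)))).
    rewrite -!ev_det -!ev_lin_subst -!(evM q (lin_subst _ _)) -!(evM q (\det _)); exact: evM.
  rewrite e; have [d0|d0] := eqVneq (\det (mat_at g q)) 0; first by rewrite d0 mul0r mulr0.
  have [d1|d1] := eqVneq (\det (mat_at g (S *m q))) 0; first by rewrite d1 mul0r !mulr0.
  have [d2|d2] := eqVneq (\det (mat_at g (T *m q))) 0; first by rewrite d2 !mulr0.
  rewrite evD0; have [||| c _ Ec] := H q; rewrite ?unit_det //.
  have {}Ec : mat_at g (T *m q) = c *: mat_at g (S *m q).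
    by apply: (ratio_of_inverses _ _ _ Ec); rewrite unit_det.
  move: Ec d2; rewrite !mat_lift_form => Ec d2.
  by rewrite (covar_parallel z0 Ec d2) mul0r.
have U q : (S *m q) 0 0 * (T *m q) 1 0 = (S *m q) 1 0 * (T *m q) 0 0.
  by apply/eqP; rewrite -subr_eq0 -evD0 D0 ev0.
pose N := invmx S *m T; have TE : T = S *m N by rewrite mulKVmx.
clearbody N.
have V q : q 0 0 * (N *m q) 1 0 = q 1 0 * (N *m q) 0 0.
  have dS : \det S != 0 by rewrite -unit_det.
  have := U q; rewrite TE -mulmxA; move: (N *m q) => r; rewrite !mulmx2E => e.
  by apply: (mulfI dS); apply: (eq_of_multiple (c := 1) e); rewrite det2; ring.
have n10 : N 1 0 = 0.
  by have := V (pt 1 0); rewrite !mulmx2E pt0 pt1 !mulr1 !mulr0 !addr0 mul1r mul0r.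
have n01 : N 0 1 = 0.
  by have := V (pt 0 1); rewrite !mulmx2E pt0 pt1 !mulr1 !mulr0 !add0r mul1r mul0r.
have n11 : N 1 1 = N 0 0.
  by have := V (pt 1 1); rewrite !mulmx2E pt0 pt1 !mulr1 !mul1r n10 n01 add0r addr0.
have NE : N = (N 0 0)%:M by rewrite [LHS]mx22_eta n10 n01 n11 scalar_mx22.
have T0 : T = N 0 0 *: S by rewrite TE {1}NE -scalemx1 -scalemxAr mulmx1.
exists (N 0 0)^-1; first rewrite invr_eq0.
  by apply: contraTneq uT => h; rewrite T0 h scale0r unit_det det2 !mxE mul0r subrr eqxx.
rewrite T0 scalerA mulVf ?scale1r //.
by apply: contraTneq uT => h; rewrite T0 h scale0r unit_det det2 !mxE mul0r subrr eqxx.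
Qed.

End Existence.

(** * Generic members of the families *)

Section Interpolation.
Variable T : comNzRingType.

(** Coordinates of the seven points [0, 1], [1, 0], [1, 1], ..., [1, 5]. The ring is a
    parameter, so that a determinant of values can be specialized and reduced modulo a prime. *)
Definition nodeX (j : nat) : T := if j is 0 then 0 else 1.
Definition nodeY (j : nat) : T := if j is j'.+1 then j'%:R else 1.
Definition nodeS j : T := nodeX j ^+ 2 - nodeX j * nodeY j.
Definition nodeW j : T := nodeY j - 2 * nodeX j.

Definition ram_entry (a b : T) j k : T :=
  six_coef (ram_coef (nodeS j) (nodeW j)) (nodeY j - a * nodeX j) (- (b * nodeX j)) k.
(** The value of [exc_form] for a = - n1 / n0 and b = - n2 / n0, multiplied by n0^7 so as to be a
    polynomial in t for the coordinates of the normal vector ([exc_entry_scale]). *)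
Definition exc_entry (n0 n1 n2 : T) j k : T :=
  six_coef (exc_coef (n0 ^+ 2 * nodeS j) (n0 * nodeW j)) (n0 * nodeY j + n1 * nodeX j) (n2 * nodeX j) k.
Definition ram_eval (a b : T) : 'M[T]_7 := \matrix_(j < 7, k < 7) ram_entry a b j k.
Definition exc_eval (n0 n1 n2 : T) : 'M[T]_7 := \matrix_(j < 7, k < 7) exc_entry n0 n1 n2 j k.

Lemma exc_entry_scale n0 a b j k : (k < 7)%N ->
  exc_entry n0 (- (a * n0)) (- (b * n0)) j k = n0 ^+ 7 * exc_entry 1 (- a) (- b) j k.
Proof.
rewrite /exc_entry; move: (nodeS j) (nodeW j) (nodeX j) (nodeY j) => S W X Y.
by case: k => [|[|[|[|[|[|[|//]]]]]]] _; rewrite /six_coef /exc_coef; ring.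
Qed.

Definition check_inverse (f g : nat -> nat -> T) := all (fun i => all (fun j =>
  foldr +%R 0 [seq f i k * g k j | k <- iota 0 7] == (i == j)%:R) (iota 0 7)) (iota 0 7).

Lemma check_inverseP f g : check_inverse f g ->
  (\matrix_(i < 7, j < 7) f i j) *m (\matrix_(i < 7, j < 7) g i j) = 1%:M.
Proof.
move=> /allP H; apply/matrixP => i j; rewrite !mxE.
have /H/allP : (i : nat) \in iota 0 7 by rewrite mem_iota ltn_ord.
have jI : (j : nat) \in iota 0 7 by rewrite mem_iota ltn_ord.
move=> /(_ _ jI)/eqP; rewrite foldrE big_map => E; rewrite -[RHS]E.
rewrite -[iota 0 7]/(index_iota 0 7) big_mkord.
by apply: eq_bigr => k _; rewrite !mxE.
Qed.

Lemma check_inverse_det f g : check_inverse f g -> \det (\matrix_(i < 7, j < 7) f i j) != 0.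
Proof.
move/check_inverseP/(congr1 determinant); rewrite det_mulmx det1 => E.
by apply: contra_eq_neq E => ->; rewrite mul0r eq_sym oner_neq0.
Qed.

End Interpolation.

Section InterpolationMorphism.
Variables (T T' : comNzRingType) (f : {rmorphism T -> T'}).

Lemma nodeX_rmorph j : f (nodeX T j) = nodeX T' j.
Proof. by case: j => [|j]; rewrite /nodeX ?rmorph0 ?rmorph1. Qed.
Lemma nodeY_rmorph j : f (nodeY T j) = nodeY T' j.
Proof. by case: j => [|j]; rewrite /nodeY ?rmorph_nat ?rmorph1. Qed.

Lemma ram_eval_map a b : map_mx f (ram_eval a b) = ram_eval (f a) (f b).
Proof.
apply/matrixP => j k; rewrite !mxE /ram_entry six_coef_rmorph rmorphB rmorphN !rmorphM !nodeX_rmorph nodeY_rmorph.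
rewrite /six_coef; set u := (- _) ^+ k; congr (u * _); rewrite {u} !ram_coef_rmorph.
by rewrite /nodeS /nodeW !rmorphB rmorphXn !rmorphM !nodeX_rmorph nodeY_rmorph rmorph_nat.
Qed.

Lemma exc_eval_map n0 n1 n2 : map_mx f (exc_eval n0 n1 n2) = exc_eval (f n0) (f n1) (f n2).
Proof.
apply/matrixP => j k; rewrite !mxE /exc_entry six_coef_rmorph rmorphD !rmorphM !nodeX_rmorph nodeY_rmorph.
rewrite /six_coef; set u := (- _) ^+ k; congr (u * _); rewrite {u} !exc_coef_rmorph.
by rewrite /nodeS /nodeW !rmorphM !rmorphB !rmorphXn !rmorphM !nodeX_rmorph nodeY_rmorph rmorph_nat ?rmorphXn ?nodeX_rmorph.
Qed.

End InterpolationMorphism.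

(** The inverse matrix certifies that the values at the seven points are independent modulo 7
    for a = b = 3. *)
Lemma ram_eval_F7 : \det (ram_eval (3%:R : 'F_7) 3%:R) != 0.
Proof.
pose B := ([:: [:: 0; 0; 0; 0; 1; 0; 0];
   [:: 3; 6; 4; 5; 6; 1; 2];
   [:: 0; 3; 3; 4; 2; 2; 2];
   [:: 6; 2; 1; 1; 1; 5; 6];
   [:: 5; 4; 3; 0; 5; 6; 3];
   [:: 2; 1; 3; 4; 2; 5; 6];
   [:: 2; 5; 1; 6; 3; 4; 2]])%N.
have : check_inverse (ram_entry (3%:R : 'F_7) 3%:R) (fun i j => (nth 0%N (nth [::] B i) j)%:R).
  by vm_compute.
exact: check_inverse_det.
Qed.

(** The same modulo 11 for a = 50, b = - 14, a rational point of the curve [exc_rel]. *)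
Lemma exc_eval_F11 : \det (exc_eval (1 : 'F_11) (- 50%:R) (- - 14%:R)) != 0.
Proof.
pose B := ([:: [:: 9; 7; 4; 9; 0; 3; 9];
   [:: 9; 2; 4; 1; 5; 0; 9];
   [:: 5; 7; 9; 5; 2; 4; 7];
   [:: 9; 0; 4; 8; 9; 2; 1];
   [:: 1; 8; 10; 2; 3; 3; 0];
   [:: 0; 7; 1; 5; 0; 1; 8];
   [:: 1; 0; 0; 0; 0; 0; 0]])%N.
have : check_inverse (exc_entry (1 : 'F_11) (- 50%:R) (- - 14%:R)) (fun i j => (nth 0%N (nth [::] B i) j)%:R).
  by vm_compute.
exact: check_inverse_det.
Qed.

Section Generic.
Variable R : realType.
Notation K := R[i].
Notation xi := (@xi1 R).

(** A determinant of integers that is not zero modulo a prime is not zero. *)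
Lemma ram_eval_nz : \det (ram_eval (3 : K) 3) != 0.
Proof.
have hZ : \det (ram_eval (3%:R : int) 3%:R) != 0.
  apply: contraNneq ram_eval_F7 => h.
  by have := congr1 (intr : int -> 'F_7) h; rewrite -det_map_mx ram_eval_map !rmorph_nat rmorph0 => ->.
by have := ram_eval_map (intr : {rmorphism int -> K}) 3%:R 3%:R; rewrite !rmorph_nat => <-; rewrite det_map_mx intr_eq0.
Qed.

Lemma exc_eval_nz : \det (exc_eval (1 : K) (- 50) (- - 14)) != 0.
Proof.
have hZ : \det (exc_eval (1 : int) (- 50%:R) (- - 14%:R)) != 0.
  apply: contraNneq exc_eval_F11 => h.
  by have := congr1 (intr : int -> 'F_11) h; rewrite -det_map_mx exc_eval_map !rmorphN !rmorph_nat rmorph1 rmorph0 => ->.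
by have := exc_eval_map (intr : {rmorphism int -> K}) 1 (- 50%:R) (- - 14%:R);
   rewrite !rmorphN !rmorph_nat rmorph1 => <-; rewrite det_map_mx intr_eq0.
Qed.

(** A common zero of the entries would satisfy a = 0 or b = 0. *)
Lemma covar_nz (z a b : K) q : z != 0 -> a != 0 -> b != 0 -> q != 0 -> covar z a 1 0 b 0 1 q != 0.
Proof.
move=> z0 a0 b0 q0; apply/eqP => E.
have := congr1 (fun M : 'M_2 => M 0 0) E; have := congr1 (fun M : 'M_2 => M 0 1) E.
have := congr1 (fun M : 'M_2 => M 1 0) E; have := congr1 (fun M : 'M_2 => M 1 1) E.
rewrite /covar !mx22E !mxE !mul0r !subr0 !addr0 !mul1r => E11 E10 E01 E00 {E}.
have al0 : a * al q ^+ 2 + ga q ^+ 2 = 0 -> al q != 0.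
  move=> w; apply/eqP => h; apply: (al_ga q0 h); move: w; rewrite h expr0n mulr0 add0r => /eqP.
  by rewrite expf_eq0 => /eqP.
have [x0|x0] := eqVneq (q 0 0) 0.
  have y0 : q 1 0 != 0 by apply: contra_neq q0 => y; rewrite (ptE q) x0 y; apply/eqP; rewrite pt_eq0 eqxx.
  have w : a * al q ^+ 2 + ga q ^+ 2 = 0 by apply: (mulfI (mulf_neq0 z0 y0)); rewrite mulr0.
  have := al0 w; move/eqP: w; rewrite [ga q]/ga x0 mul0r expr0n addr0 mulf_eq0 (negbTE a0) /= expf_eq0 /= => /eqP->.
  by rewrite eqxx.
have w : a * al q ^+ 2 + ga q ^+ 2 = 0 by apply: (mulfI x0); rewrite mulr0.
have [y0|y0] := eqVneq (q 1 0) 0.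
  have := al0 w; move/eqP: w; rewrite [ga q]/ga y0 mulr0 expr0n addr0 mulf_eq0 (negbTE a0) /= expf_eq0 /= => /eqP->.
  by rewrite eqxx.
have e1 : b * al q ^+ 2 - al q * be q = 0 by apply: (mulfI x0); rewrite mulr0.
have e2 : b * al q ^+ 2 + al q * be q = 0 by apply: (mulfI (mulf_neq0 z0 y0)); rewrite mulr0.
have : 2 * b * al q ^+ 2 = 0.
  by transitivity ((b * al q ^+ 2 - al q * be q) + (b * al q ^+ 2 + al q * be q)); [ring|rewrite e1 e2 addr0].
by apply/eqP; rewrite mulf_neq0 ?expf_neq0 ?al0 // mulf_neq0 // two_neq0.
Qed.

Lemma ker_of_det (N : 'M[K]_7) (c : 'cV[K]_7) : \det N != 0 ->
  (forall j, \sum_k N j k * c k 0 = 0) -> c = 0.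
Proof.
move=> dN H; have uN : N \in unitmx by rewrite unitmxE unitfE.
rewrite -(mulKmx uN c) (_ : N *m c = 0) ?mulmx0 //.
by apply/colP => j; rewrite !mxE.
Qed.

(** P is the product of a b and of the determinant of the values of the coordinates of F at
    seven points; where it does not vanish, F is linearly full and g has no common zero. *)
Lemma exists_ram : exists2 P : {mpoly K[2]}, P != 0 & forall a1 b1 : K, P.@[tnth [tuple a1; b1]] != 0 ->
  exists F : 'rV[binform R]_7,
    [/\ sextic_curve F, is_curve 5 (g_ram a1 b1) & galois_lift (phi0 R) F (g_ram a1 b1)].
Proof.
(* a b excludes the values for which the entries of g may have a common zero. *)
pose P : {mpoly K[2]} := \det (ram_eval 'X_0 'X_1) * ('X_0 * 'X_1).
have evP a b : P.@[tnth [tuple a; b]] = \det (ram_eval a b) * (a * b).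
  rewrite /P !mevalM !mevalXU -det_map_mx ram_eval_map; congr (\det (ram_eval _ _) * (_ * _)); exact: mevalXU.
exists P.
  apply/eqP => P0; have := evP 3 3; rewrite P0 meval0 => /esym/eqP.
  by rewrite !mulf_eq0 pnatr_eq0 (negbTE ram_eval_nz).
move=> a b; rewrite evP mulf_eq0 negb_or mulf_eq0 negb_or => /and3P[dN a0 b0].
pose Q : binform R := (-4)%:MP * (gamma * alpha2 * beta2).
pose E (k : 'I_7) := ram_form a b k.
have z0 : (1 : K) != 0 := oner_neq0 _.
have hE k : E k \is 6.-homog := ram_form_homog a b (ltn_ord k).
have PE q (k : 'I_7) : octa_mx (covar 1 a 1 0 b 0 1 q) k = ev q Q * ev (mat_at (phi0 R) q) (E k).
  by rewrite octa_mx_ram; congr (_ * _); rewrite /Q !(evM, ev_gamma, ev_alpha2, ev_beta2) evC.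
have ind (c : 'cV[K]_7) : (forall p, \sum_k ev p (E k) * c k 0 = 0) -> c = 0.
  move=> H; apply: (ker_of_det dN) => j; rewrite -[RHS](H (pt (nodeX _ j) (nodeY _ j))).
  by apply: eq_bigr => k _; rewrite [X in X * _ = _]mxE /E ev_ram_form pt0 pt1.
have nz q : q != 0 -> covar 1 a 1 0 b 0 1 q != 0 by apply: covar_nz.
exists (\row_k E k); split; [exact: exist_F_sextic z0 hE PE ind|exact: exist_g_curve nz|exact: exist_lift z0 PE].
Qed.

Definition nv0p : {poly K} := ('X ^+ 2 - 1) ^+ 2 * (xi%:P - 'X).
Definition nv1p : {poly K} := 4 * (xi%:P - 'X) * 'X ^+ 2.
Definition nv2p : {poly K} := ('X ^+ 4 - 1) * (xi%:P + 'X).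

Lemma nvpE t : [/\ nv0p.[t] = nv0 t, nv1p.[t] = nv1 t & nv2p.[t] = nv2 t].
Proof.
have h4 : (4 : {poly K}) = 4%:P by rewrite polyC_natr.
by split; rewrite /nv0p /nv1p /nv2p /nv0 /nv1 /nv2 ?h4 !hornerE.
Qed.

(** The parameter of the point a = 50, b = - 14 of the curve [exc_rel]. It comes from the rational
    parametrization: the relation says that (1 + i m)^2 (1 + i s)^4 is imaginary for
    1 - a = - m^2 and b = m s, which holds for s = 2 and m = - 7. *)
Definition t50 : K := xi * (3 - 4 * xi ^+ 2) / 5.

Lemma nv_t50 : [/\ nv0 t50 != 0, nv1 t50 = - (50 * nv0 t50) & nv2 t50 = - (- 14 * nv0 t50)].
Proof.
have h := xi4 R; have five : (5 : K) != 0 by rewrite pnatr_eq0.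
have e1 : (t50 ^+ 2 - 1) * (7 * xi ^+ 2 - 1) = 2.
  by rewrite /t50; field: h.
have e2 : (xi - t50) * (1 - 2 * xi ^+ 2) = 2 * xi.
  by rewrite /t50; field: h.
split.
- rewrite /nv0; apply: mulf_neq0; first rewrite expf_neq0 //.
    by apply: contra_eq_neq e1 => ->; rewrite mul0r eq_sym two_neq0.
  by apply: contra_eq_neq e2 => ->; rewrite mul0r eq_sym mulf_neq0 ?two_neq0 ?xi_neq0.
- by rewrite /nv0 /nv1 /t50; field: h.
by rewrite /nv0 /nv2 /t50; field: h.
Qed.

(** As for [exists_ram], with the parameters a and b expressed by t. *)
Lemma exists_exc : exists2 P : {poly K}, P != 0 & forall t : K, P.[t] != 0 ->
  exists (a1 b1 : K) (F : 'rV[binform R]_7),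
    [/\ plane_perp t a1 b1, sextic_curve F, is_curve 5 (g_exc a1 b1) &
        galois_lift (phi0 R) F (g_exc a1 b1)].
Proof.
pose P : {poly K} := \det (exc_eval nv0p nv1p nv2p) * (nv0p * (nv1p * nv2p)).
have evP t : P.[t] = \det (exc_eval (nv0 t) (nv1 t) (nv2 t)) * (nv0 t * (nv1 t * nv2 t)).
  have [h0 h1 h2] := nvpE t; rewrite /P hornerM [(nv0p * _).[t]]hornerM [(nv1p * nv2p).[t]]hornerM h0 h1 h2; congr (_ * _).
  by rewrite -[LHS]/(horner_eval t _) -det_map_mx exc_eval_map /= /horner_eval h0 h1 h2.
exists P.
  apply/eqP => P0; have := evP t50; rewrite P0 horner0 => /esym/eqP.
  have [n0 n1 n2] := nv_t50; rewrite n1 n2.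
  have -> : exc_eval (nv0 t50) (- (50 * nv0 t50)) (- (- 14 * nv0 t50)) =
     nv0 t50 ^+ 7 *: exc_eval 1 (- 50) (- - 14).
    by apply/matrixP => j k; rewrite !mxE exc_entry_scale.
  apply/negP; rewrite detZ; apply: mulf_neq0.
    by apply: mulf_neq0 (exc_eval_nz); do 2 apply: expf_neq0.
  apply: (mulf_neq0 n0); apply: mulf_neq0; rewrite oppr_eq0; apply: (mulf_neq0 _ n0).
    by rewrite pnatr_eq0.
  by rewrite oppr_eq0 pnatr_eq0.
move=> t; rewrite evP; move: (nv0 t) (nv1 t) (nv2 t) (plane_perpP t) => m0 m1 m2 ppE.
rewrite !mulf_eq0 !negb_or => /and4P[dN n0 n1 n2].
pose a := - (m1 / m0); pose b := - (m2 / m0).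
have a0 : a != 0 by rewrite oppr_eq0 mulf_neq0 ?invr_eq0.
have b0 : b != 0 by rewrite oppr_eq0 mulf_neq0 ?invr_eq0.
have an : m1 = - (a * m0) by rewrite /a mulNr divfK // opprK.
have bn : m2 = - (b * m0) by rewrite /b mulNr divfK // opprK.
have pp : plane_perp t a b by apply/ppE; split=> //; rewrite ?an ?bn subrr.
have [e he] := exc_div (perp_exc_rel pp).
pose Q : binform R := (- (2 * xi))%:MP * (gamma * wform a).
have z0 := xi_neq0 R; have hz := xi4 R.
have PE q (k : 'I_7) : octa_mx (covar xi a 1 0 b 0 1 q) k = ev q Q * ev (mat_at (phi0 R) q) (e k).
  have evQ : ev q Q = - (2 * xi) * (ga q * (a * al q ^+ 2 + ga q ^+ 2)).
    by rewrite /Q !(ev_wform, ev_gamma, evC, evM).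
  rewrite octa_mx_exc // (he k).2 evM ev_lin mat_phi0 evQ !pt0 !pt1.
  by rewrite mulrA; congr (_ * _); ring.
have ind (c : 'cV[K]_7) : (forall p, \sum_k ev p (e k) * c k 0 = 0) -> c = 0.
  move=> H; apply: (ker_of_det dN) => j; pose p := pt (nodeX K j) (nodeY K j).
  transitivity (m0 ^+ 7 * ev p (lin (pt 1 a)) * \sum_k ev p (e k) * c k 0); last by rewrite H mulr0.
  rewrite mulr_sumr; apply: eq_bigr => k _; rewrite [X in X * _ = _]mxE mulrA; congr (_ * _).
  rewrite an bn exc_entry_scale // -mulrA; congr (_ * _); rewrite -evM -(he k).2 ev_exc_form pt0 pt1.
  by rewrite /exc_entry; congr six_coef; rewrite ?expr1n ?mul1r ?mulNr.
have nz q : q != 0 -> covar xi a 1 0 b 0 1 q != 0 by apply: covar_nz.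
exists a, b, (\row_k e k); split=> //.
- exact: exist_F_sextic z0 (fun k => (he k).1) PE ind.
- exact: exist_g_curve nz.
- exact: exist_lift z0 PE.
Qed.

End Generic.

Theorem theorem7p1 (R : realType) :
  (forall phi : 'cV[binform R]_2, galois_covering 4 phi -> deck_group_D2 phi ->
     (exists mu nu : 'M[R[i]]_2, normalizes phi mu nu) /\
     (forall (n : nat) (F : 'rV[binform R]_7) (g : 'M[binform R]_2),
        sextic_curve F -> is_curve n g -> galois_lift phi F g ->
        [/\ n = 5%N,
            (exists a1 b1 : R[i], equiv_mod_moebius phi g (g_ram a1 b1)) \/
            (exists t a1 b1 : R[i],
               plane_perp t a1 b1 /\ equiv_mod_moebius phi g (g_exc a1 b1)),
            (forall a1 b1 : R[i],
               equiv_mod_moebius phi g (g_ram a1 b1) -> generally_ramified F) &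
            (forall t a1 b1 : R[i], plane_perp t a1 b1 ->
               equiv_mod_moebius phi g (g_exc a1 b1) ->
               exceptional_transversal F)])) /\
  (exists2 P : {mpoly R[i][2]}, P != 0 &
     forall a1 b1 : R[i], P.@[tnth [tuple a1; b1]] != 0 ->
       exists F : 'rV[binform R]_7,
         [/\ sextic_curve F, is_curve 5 (g_ram a1 b1) &
             galois_lift (phi0 R) F (g_ram a1 b1)]) /\
  (exists2 P : {poly R[i]}, P != 0 &
     forall t : R[i], P.[t] != 0 ->
       exists (a1 b1 : R[i]) (F : 'rV[binform R]_7),
         [/\ plane_perp t a1 b1, sextic_curve F, is_curve 5 (g_exc a1 b1) &
             galois_lift (phi0 R) F (g_exc a1 b1)]).
Proof.
split=> [phi [cphi o] d2|]; last by split; [exact: exists_ram|exact: exists_exc].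
split; first exact: d2_normalizes.
by move=> n F g; exact: lift_classification.
Qed.
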